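(* Let $p,n\in\mathbb{Z}^+$ and assume that $\phi_1,\dots,\phi_p:\mathbb{R}^n\to\mathbb{R}$ are continuous functions such that each $\phi_i$ satisfies conditions (A) and (B) stated in the context, where the function $g_i$ in condition (A) for $\phi_i$ satisfies $g_i(x)\le C_i(1+|x|^{k_i})$ for all $x\in\mathbb{R}^n$, for some $k_i\in\mathbb{Z}^+$ and $C_i>0$, $i=1,\dots,p$. Set $$\Phi(\xi):=\sum_{i=1}^{p}\phi_i(\xi),\qquad K:=\max\{k_i : i=1,\dots,p\}.$$ Let $L$ be the linear operator defined by $\widehat{Lf}(\xi)=i\Phi(\xi)\widehat{f}(\xi)$, let $T>0$, and assume $0<s<K$ and $0<b\le s/K$. If $u\in C([-T,T],H^s(\mathbb{R}^n))$ is the solution of the initial value problem $$\begin{cases}\partial_t u+Lu=0,\\ u(0)=u_0\in Z_{s,b}:=H^s(\mathbb{R}^n)\cap L^2(|x|^{2b}dx),\end{cases}$$ then, for all $t\in[-T,T]$, $$\||x|^b u(t)\|_{L^2}\le C\left\{(1+|t|)\|u_0\|_{s,2}+\||x|^b u_0\|_{L^2}\right\},$$ where $C>0$ is a constant depending on $K$, $p$, $s$, $n$, and on $b$ and the functions $\phi_i$ (with the associated data in (A), (B) and the $C_i$), but not on $u_0$, $t$ or $T$.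
   Context: Condition (A) for $\phi:\mathbb{R}^n\to\mathbb{R}$: there exists a continuous function $g:\mathbb{R}^n\to\mathbb{R}$ such that $g>0$ except maybe at $0$, and for all $x,y\in\mathbb{R}^n$ with $|x-y|\le|x|$ we have $|\phi(x)-\phi(y)|\le g(x)|x-y|$. Condition (B) for $\phi$: there exists $C>0$ such that for all $x,y\in\mathbb{R}^n$ satisfying $|x-y|\ge|x|$ we have $|\phi(x)-\phi(y)|\le C|x-y|^a$, for some $a\ge1$ (independent of $x,y$). Each $\phi_i$ has its own function $g_i$, constant and exponent. $\|f\|_{s,2}$ denotes the norm of $H^s(\mathbb{R}^n)$, $\|f\|_{s,2}=\left(\int(1+|\xi|^2)^s|\widehat f(\xi)|^2d\xi\right)^{1/2}$. The solution of the initial value problem is $u(t)=U(t)u_0$, where $\widehat{U(t)u_0}(\xi)=e^{-it\Phi(\xi)}\widehat{u_0}(\xi)$. *)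

(* Defs.v *)
From HB Require Import structures.
From mathcomp Require Import all_boot all_order all_algebra.
From mathcomp Require Import all_classical all_reals all_analysis.
From mathcomp Require Import complex.

Set Implicit Arguments.
Unset Strict Implicit.
Unset Printing Implicit Defensive.

Import Order.TTheory GRing.Theory Num.Theory.
Import numFieldNormedType.Exports.

Local Open Scope classical_set_scope.
Local Open Scope ring_scope.

Section measurable_rV.
Context {R : realType} (n : nat).

Let coord (i : 'I_n) (x : 'rV[R]_n) : measurableTypeR R := x ord0 i.

Let rV_set0 : g_sigma_preimage coord set0.
Proof. exact: sigma_algebra0. Qed.

Let rV_setC A : g_sigma_preimage coord A -> g_sigma_preimage coord (~` A).
Proof. exact: sigma_algebraC. Qed.

Let rV_bigcup (F : _^nat) : (forall i, g_sigma_preimage coord (F i)) ->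
  g_sigma_preimage coord (\bigcup_i (F i)).
Proof. exact: sigma_algebra_bigcup. Qed.

HB.instance Definition _ :=
  @isMeasurable.Build default_measure_display 'rV[R]_n
    (g_sigma_preimage coord) rV_set0 rV_setC rV_bigcup.

Lemma measurable_coord (i : 'I_n) :
  measurable_fun [set: 'rV[R]_n] (fun x => x ord0 i : measurableTypeR R).
Proof.
move=> _ Y mY; rewrite setTI; apply: sub_sigma_algebra => /=.
rewrite -bigcup_seq/=; exists i => /=; first by rewrite mem_index_enum.
by exists Y => //; rewrite setTI.
Qed.

Lemma measurable_fun_coordP d (T : measurableType d) (f : T -> 'rV[R]_n) :
  (forall i, measurable_fun [set: T] (fun x => f x ord0 i : measurableTypeR R)) ->
  measurable_fun [set: T] f.
Proof.
move=> mf _ A.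
suff : @measurable _ 'rV[R]_n `<=`
    [set B | measurable ([set: T] `&` f @^-1` B)] by apply.
apply: smallest_sub.
  split; first by rewrite /= preimage_set0 setI0.
  - move=> B /=; rewrite !setTI setTD => mB.
    by rewrite preimage_setC; exact: measurableC.
  - move=> F /= mF; rewrite preimage_bigcup setI_bigcupr.
    exact: bigcupT_measurable.
rewrite -bigcup_seq => B [i _ [C mC <-]] /=.
have := mf i measurableT C mC.
by rewrite !setTI.
Qed.

End measurable_rV.

Section lebesgue_rV.
Context {R : realType}.

Definition rV_cons n (p : measurableTypeR R * 'rV[R]_n) : 'rV[R]_n.+1 :=
  row_mx (p.1 : R)%:M p.2.

Lemma rV_cons0 n (p : measurableTypeR R * 'rV[R]_n) : rV_cons p ord0 ord0 = p.1.
Proof.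
have := row_mxEl (p.1 : R)%:M p.2 ord0 (ord0 : 'I_1).
by rewrite lshift0 /rV_cons => ->; rewrite mxE eqxx mulr1n.
Qed.

Lemma rV_cons_lift n (p : measurableTypeR R * 'rV[R]_n) (j : 'I_n) :
  rV_cons p ord0 (lift ord0 j) = p.2 ord0 j.
Proof.
have := row_mxEr (p.1 : R)%:M p.2 ord0 j.
by rewrite rshift1.
Qed.

Lemma measurable_rV_cons n : measurable_fun setT (@rV_cons n).
Proof.
apply: measurable_fun_coordP => i.
case: (unliftP ord0 i) => [j ->|->].
  under eq_fun do rewrite rV_cons_lift.
  apply: (@measurableT_comp _ _ _ _ _ _
    (fun x : 'rV[R]_n => x ord0 j : measurableTypeR R)).
    exact: measurable_coord.
  exact: measurable_snd.
under eq_fun do rewrite rV_cons0.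
exact: measurable_fst.
Qed.

Section cons_measure.
Variables (n : nat) (mu : {sigma_finite_measure set 'rV[R]_n -> \bar R}).

Definition cons_measure : set 'rV[R]_n.+1 -> \bar R :=
  pushforward (lebesgue_measure \x mu)%E (@rV_cons n).

Let cons_measure0 : cons_measure set0 = 0%E.
Proof. by rewrite /cons_measure /pushforward preimage_set0 measure0. Qed.

Let cons_measure_ge0 A : (0 <= cons_measure A)%E.
Proof. by rewrite /cons_measure /pushforward; exact: measure_ge0. Qed.

Let cons_measure_sigma_additive : semi_sigma_additive cons_measure.
Proof.
have mcons A : measurable A -> measurable (@rV_cons n @^-1` A).
  by move=> mA; rewrite -[X in measurable X]setTI; exact: measurable_rV_cons.
move=> F mF tF mUF; rewrite /cons_measure /pushforward preimage_bigcup.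
apply: measure_semi_sigma_additive.
- by move=> k; exact: mcons.
- apply/trivIsetP => /= i j _ _ ij; rewrite -preimage_setI.
  by move/trivIsetP : tF => /(_ _ _ _ _ ij) ->//; rewrite preimage_set0.
- by rewrite -preimage_bigcup; exact: mcons.
Qed.

HB.instance Definition _ := isMeasure.Build _ _ _ cons_measure
  cons_measure0 cons_measure_ge0 cons_measure_sigma_additive.

Let cons_measure_sigma_finite : sigma_finite setT cons_measure.
Proof.
have /sigma_finiteP[F [FT ndF mF]] :=
  @sigma_finiteT _ _ _ (@lebesgue_measure R).
have /sigma_finiteP[G [GT ndG mG]] := @sigma_finiteT _ _ _ mu.
pose tl (x : 'rV[R]_n.+1) : 'rV[R]_n := \row_j x ord0 (lift ord0 j).
have tlK p : tl (rV_cons p) = p.2.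
  by apply/rowP => j; rewrite mxE rV_cons_lift.
have mtl : measurable_fun setT tl.
  apply: measurable_fun_coordP => i; under eq_fun do rewrite mxE.
  exact: measurable_coord.
pose H k : set 'rV[R]_n.+1 :=
  (fun x : 'rV[R]_n.+1 => x ord0 ord0 : measurableTypeR R) @^-1` F k `&` tl @^-1` G k.
have HE k : @rV_cons n @^-1` H k = F k `*` G k.
  by apply/seteqP; split => -[x y]; rewrite /H /= rV_cons0 tlK.
exists H.
  apply/seteqP; split => // x _.
  have : [set: measurableTypeR R] (x ord0 ord0) by [].
  rewrite FT => -[i _ Fi].
  have : [set: 'rV[R]_n] (tl x) by [].
  rewrite GT => -[j _ Gj].
  exists (maxn i j) => //; split => /=.
    by move: Fi; apply/subsetPset/ndF/leq_maxl.
  by move: Gj; apply/subsetPset/ndG/leq_maxr.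
move=> k; split.
  rewrite /H; apply: measurableI.
    rewrite -[X in measurable X]setTI.
    by apply: (@measurable_coord R n.+1 ord0) => //; have [] := mF k.
  by rewrite -[X in measurable X]setTI; apply: mtl => //; have [] := mG k.
rewrite /cons_measure /pushforward HE product_measure1E; last 2 first.
- by have [] := mF k.
- by have [] := mG k.
have [_ Foo] := mF k; have [_ Goo] := mG k.
by rewrite lte_mul_pinfty// ge0_fin_numE.
Qed.

HB.instance Definition _ := Measure_isSigmaFinite.Build _ _ _ cons_measure
  cons_measure_sigma_finite.

End cons_measure.

Fixpoint lebesgue_rV n : {sigma_finite_measure set 'rV[R]_n -> \bar R} :=
  match n with
  | 0 => dirac (0 : 'rV[R]_0)
  | m.+1 => cons_measure (lebesgue_rV m)
  end.

End lebesgue_rV.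

Section euclidean.
Context {R : realType} {n : nat}.
Implicit Types (x y : 'rV[R]_n) (phi g : 'rV[R]_n -> R).

Definition dotp x y : R := \sum_(i < n) x ord0 i * y ord0 i.

(* The Euclidean norm; [`|x|] on ['rV[R]_n] is the sup norm. *)
Definition enorm x : R := Num.sqrt (\sum_(i < n) x ord0 i ^+ 2).

Definition conditionA phi g : Prop :=
  [/\ continuous g,
      forall x, x != 0 -> 0 < g x
    & forall x y, enorm (x - y) <= enorm x ->
        `|phi x - phi y| <= g x * enorm (x - y)].

Definition conditionB phi : Prop :=
  exists C a : R, [/\ 0 < C, 1 <= a
    & forall x y, enorm x <= enorm (x - y) ->
        `|phi x - phi y| <= C * enorm (x - y) `^ a].

End euclidean.

Section fourier.
Context {R : realType} {n : nat}.
Local Open Scope complex_scope.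
Local Notation mu := (@lebesgue_rV R n).
Local Notation normc := ComplexField.Normc.normc.
Implicit Types (f F u v : 'rV[R]_n -> R[i]) (s b t T : R).

(* Functions are pointwise Borel representatives: [R^n] carries the Borel
   sigma-algebra and there is no quotient by almost everywhere equality. *)
Definition cmeasurable f : Prop :=
  measurable_fun setT (fun x => complex.Re (f x) : measurableTypeR R) /\
  measurable_fun setT (fun x => complex.Im (f x) : measurableTypeR R).

Definition cintegral (D : set 'rV[R]_n) f : R[i] :=
  (\int[mu]_(x in D) complex.Re (f x)) +i* (\int[mu]_(x in D) complex.Im (f x)).

Definition expi (theta : R) : R[i] := cos theta +i* sin theta.

Definition L2norm f : \bar R := Lnorm mu 2%:E (fun x => (normc (f x))%:E).

Definition in_L2 f : Prop := cmeasurable f /\ (L2norm f < +oo)%E.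

Definition fourier_trunc (r : R) f : 'rV[R]_n -> R[i] := fun xi =>
  (Num.sqrt (2 * pi) ^- n)%:C *
  cintegral [set x | enorm x <= r] (fun x => expi (- dotp x xi) * f x).

(* [F] represents the L^2 (Plancherel) Fourier transform of [f]. Functions in
   L^2 are integrable on balls, so the truncated integrals make sense, and they
   converge in L^2 to the transform. *)
Definition is_fourier f F : Prop :=
  [/\ in_L2 f, in_L2 F
    & L2norm (fun xi => F xi - fourier_trunc k%:R f xi) @[k --> \oo] --> 0%E].

(* Some representative; the zero function when there is none, which by the
   Plancherel theorem happens only if [f] is not in L^2. *)
Definition fourier f : 'rV[R]_n -> R[i] := xget (fun=> 0) (is_fourier f).

Definition sobolev_norm s f : \bar R :=
  ((\int[mu]_x ((1 + enorm x ^+ 2) `^ s * normc (fourier f x) ^+ 2)%R%:E)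
     `^ 2^-1)%E.

(* H^s for [s >= 0], as a subspace of L^2. Existence of the transform is
   automatic by the Plancherel theorem; it is listed so that [fourier f] is
   visibly not the default value. *)
Definition in_Hs s f : Prop :=
  [/\ in_L2 f, exists F, is_fourier f F & (sobolev_norm s f < +oo)%E].

Definition in_Z s b f : Prop :=
  in_Hs s f /\
  (\int[mu]_x (enorm x `^ (2 * b) * normc (f x) ^+ 2)%R%:E < +oo)%E.

Definition continuous_Hs T s (u : R -> 'rV[R]_n -> R[i]) : Prop :=
  (forall t, t \in `[- T, T] -> in_Hs s (u t)) /\
  (forall t0, t0 \in `[- T, T] ->
     sobolev_norm s (fun x => u t x - u t0 x)
       @[t --> within [set` `[- T, T]] (nbhs t0)] --> 0%E).

(* [g] is the image of [f] under the Fourier multiplier of symbol [m]. *)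
Definition is_multiplier (m : 'rV[R]_n -> R[i]) f g : Prop :=
  is_fourier g (fun xi => m xi * fourier f xi).

(* The solution of [u' + L u = 0], [u 0 = u0], where [L] has symbol [i Phi], is
   the orbit [u t = U t u0] of the group [U t = exp (- t L)], of symbol
   [exp (- i t Phi)]. *)
Definition is_solution (Phi : 'rV[R]_n -> R) T u0 (u : R -> 'rV[R]_n -> R[i]) :
    Prop :=
  forall t, t \in `[- T, T] ->
    is_multiplier (fun xi => expi (- (t * Phi xi))) u0 (u t).

End fourier.

(* Main.v *)
Require Import Defs.
From HB Require Import structures.
From mathcomp Require Import all_boot all_order all_algebra.
From mathcomp Require Import all_classical all_reals all_analysis.
From mathcomp Require Import complex measurable_realfun.
From mathcomp Require Import ring lra.

Import Order.TTheory GRing.Theory Num.Theory.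
Import numFieldNormedType.Exports.

Local Open Scope classical_set_scope.
Local Open Scope ring_scope.

(* The weight is handled through modulations: with h_ij = 2^-j e_i,
     |x_i|^(2b) <= 1 + C sum_j 4^(bj) |e^(-i x.h_ij) - 1|^2 <= C' (1 + |x|^(2b)),
   and the Fourier transform turns f |-> (e^(-i x.h) - 1) f into the difference
   F |-> F(. + h) - F. Hence | |x|^b f |_2 is controlled, up to |f|_2, by the sums
   over j of 4^(bj) |F(. + h_ij) - F|_2^2, and conversely. For F = m F0 with
   m = e^(-i t Phi), such a sum splits into the one of F0 and the integral of
   |F0|^2 sum_j 4^(bj) |m(. + h_ij) - m|^2. Conditions (A) and (B) give
   |Phi(xi + h) - Phi(xi)| <= L (1 + |xi|)^K |h| for |h| <= 1, so the inner sum is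
   at most C (1 + A^(2b)) with A = |t| L (1 + |xi|)^K, because b < 1. Since
   b < 1 and b K <= s, this is O((1 + |t|)^2 (1 + |xi|^2)^s).
   Plancherel's theorem is obtained by damping the transform with exp(- e |xi_i|):
   the defect is a quadratic form in the Poisson kernel, which tends to 0 with e
   for indicators of boxes, hence, by a sigma-algebra argument and density, for all
   square integrable functions with bounded support. *)

(** * Poisson and exponential kernels *)

(** Estimates are made for squared norms, through |z + w|^2 <= 2 |z|^2 + 2 |w|^2; the resulting
    factors 2 only enter the final constant. The displacements are dyadic and along the axes,
    instead of an integral over all [h]: a countable sum of nonnegative functions can be integrated
    termwise, and one scale, with 2^j <= |x_i| <= 2^(j+1), already recovers |x_i|^(2b). All steps
    have length at most 1, the range in which (B) with [a >= 1] is a Lipschitz bound. The obstacle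
    is that the increments of the multiplier are controlled by |t| (1 + |xi|)^K |h|, too much to be
    paid with [s < K] derivatives of the data. The other bound, |e^(i d) - 1| <= 2, caps the terms
    with small j, and the two geometric sums together turn A^2 into A^(2b). The damping is
    exponential because the Poisson kernel has the explicit primitive 2 atan(y / e): its mass on a
    box then follows from the fundamental theorem of calculus, and its concentration from the limit
    of atan. *)

Section line.
Context {R : realType}.
Local Notation leb := (@lebesgue_measure R).
Implicit Types (e z x y c d A B : R).

Lemma lebesgue_measure_shift (h : R) (A : set (measurableTypeR R)) : measurable A ->
  pushforward leb (fun x => x + h : measurableTypeR R) A = leb A.
Proof.
move=> mA; apply/esym/lebesgue_measure_unique => //=.
  by apply: measurable_funD.
move=> mh _ [[a b]] _ <-.
rewrite /pushforward.
have -> : (fun x : R => x + h) @^-1` `]a, b] = `](a - h), (b - h)]%classic.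
  by apply/seteqP; split => x /=; rewrite !in_itv/= ltrBlDr lerBrDr.
rewrite !lebesgue_measure_itv/= !lte_fin ltrD2r; case: ifP => // _.
by rewrite -!EFinB opprB addrA subrK.
Qed.

Lemma ge0_integral_shift (h : R) (f : R -> \bar R) :
  measurable_fun [set: measurableTypeR R] f -> (forall x, 0 <= f x)%E ->
  (\int[leb]_x f (x + h)%R = \int[leb]_x f x)%E.
Proof.
move=> mf f0.
transitivity (\int[pushforward leb (fun x => (x + h)%R : measurableTypeR R)]_x f x)%E.
  by rewrite ge0_integral_pushforward//; exact: measurable_funD.
apply: eq_measure_integral => [|mh A mA _]; first exact: measurable_funD.
exact: lebesgue_measure_shift.
Qed.

Lemma ge0_integral_opp (f : R -> \bar R) :
  measurable_fun [set: measurableTypeR R] f -> (forall x, 0 <= f x)%E ->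
  (\int[leb]_x f (- x)%R = \int[leb]_x f x)%E.
Proof.
move=> mf f0.
transitivity (\int[pushforward leb (-%R : _ -> measurableTypeR R)]_x f x)%E.
  by rewrite ge0_integral_pushforward.
by apply: eq_measure_integral => A mA _; exact: lebesgue_measureN.
Qed.

(** [expw] has a corner at 0, and the fundamental theorem is applied on [[0, +oo[], so integrals
    over the line are folded onto this half-line. *)
Lemma ge0_integral_fold (f : R -> R) :
  measurable_fun [set: measurableTypeR R] f -> (forall x, 0 <= f x) ->
  (\int[leb]_x (f x)%:E = \int[leb]_(x in `[0%R, +oo[) (f x)%:E
     + \int[leb]_(x in `[0%R, +oo[) (f (- x))%R%:E)%E.
Proof.
move=> mf f0.
have meas (D : set R) : measurable_fun D (EFin \o f).
  by apply/measurable_EFinP; exact: measurable_funTS.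
rewrite (ge0_integration_by_substitution0 (f := fun x => (f (- x)%R)%:E)) /=; last 2 first.
- by apply/measurable_EFinP; apply: (measurableT_comp mf).
- by move=> r; rewrite lee_fin.
under [X in (_ + X)%E]eq_integral do rewrite opprK.
rewrite addeC -integral_itv_bndo_bndc//.
rewrite -ge0_integral_setU//=.
- by rewrite -setCitvr setvU.
- exact: meas.
- by move=> x _; rewrite lee_fin.
- rewrite disj_set2E; apply/eqP; rewrite -subset0 => x/=.
  by rewrite !in_itv/= andbT ltNge => -[/negP].
Qed.

(* The Fourier transform of [x |-> expR (- e * `|x|)]. *)
Definition poisson e z : R := 2 * e / (e ^+ 2 + z ^+ 2).

Lemma poisson_ge0 e z : 0 < e -> 0 <= poisson e z.
Proof.
by move=> e0; rewrite /poisson divr_ge0 ?mulr_ge0 ?addr_ge0 ?sqr_ge0 ?ltW.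
Qed.

Lemma poissonN e z : poisson e (- z) = poisson e z.
Proof. by rewrite /poisson sqrrN. Qed.

Lemma is_derive_poisson e x : 0 < e ->
  is_derive x 1 (fun t => 2 * atan (t / e)) (poisson e x).
Proof.
move=> e0; apply: is_derive_eq; rewrite /poisson /GRing.scale /=; field.
have h : 0 < e ^+ 2 + x ^+ 2 by rewrite ltr_wpDr// ?sqr_ge0// exprn_gt0.
by rewrite (gt_eqF h) (gt_eqF e0).
Qed.

(* The summand [1] makes the differentiated function nonnegative when the
   trigonometric part is bounded by [1], so that the fundamental theorem for
   nonnegative functions applies on a half-line. *)
Lemma is_derive_dexp e z A B x : 0 < e ->
  is_derive x 1 (fun t => expR (- e * t) * (- e^-1 +
    (A * (z * sin (z * t) - e * cos (z * t)) - B * (e * sin (z * t) + z * cos (z * t))) / (e ^+ 2 + z ^+ 2)))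
   (expR (- e * x) * (1 + (A * cos (z * x) + B * sin (z * x)))).
Proof.
move=> e0; apply: is_derive_eq; rewrite /GRing.scale /=.
have h : 0 < e ^+ 2 + z ^+ 2 by rewrite ltr_wpDr// ?sqr_ge0// exprn_gt0.
field.
by rewrite (gt_eqF h) (gt_eqF e0).
Qed.

Lemma continuous_poisson e x : 0 < e -> continuous (fun y => poisson e (y - x)).
Proof.
move=> e0 y.
have h : 0 < e ^+ 2 + (y - x) ^+ 2 by rewrite ltr_wpDr// ?sqr_ge0// exprn_gt0.
apply: cvgM; first exact: cvg_cst.
apply: cvgV; first by rewrite gt_eqF.
apply: cvgD; first exact: cvg_cst.
under eq_fun do rewrite expr2; rewrite expr2.
by apply: cvgM; apply: cvgB; (exact: cvg_id || exact: cvg_cst).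
Qed.

Lemma continuous_poisson0 e : 0 < e -> continuous (poisson e).
Proof.
move=> e0; have -> : poisson e = fun y => poisson e (y - 0).
  by apply/funext => y; rewrite subr0.
exact: continuous_poisson.
Qed.

Lemma is_derive_continuous (f : R -> R) x (df : R) : is_derive x 1 f df -> {for x, continuous f}.
Proof.
by move=> [dfx _]; apply: differentiable_continuous; apply/derivable1_diffP.
Qed.

(** The primitive [2 * atan (t / e)] grows from 0 to [2 * (pi / 2)] whatever [e] is: the mass of the
    kernel does not depend on the scale. *)
Lemma integral_poisson_ray e : 0 < e ->
  (\int[leb]_(y in `[0%R, +oo[) (poisson e y)%:E = pi%:E)%E.
Proof.
move=> e0.
rewrite (@ge0_continuous_FTC2y R _ (fun t => 2 * atan (t / e)) _ pi).
- by rewrite mul0r atan0 mulr0 sube0.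
- by move=> x _; exact: poisson_ge0.
- by apply: continuous_subspaceT; exact: continuous_poisson0.
- have -> : pi = 2 * (pi / 2) :> R by field.
  apply: cvgM; first exact: cvg_cst.
  have h : y / e @[y --> +oo] --> +oo.
    apply/cvgryPge => M; near=> y.
    by rewrite ler_pdivlMr//; near: y; apply: nbhs_pinfty_ge; exact: num_real.
  exact: (cvg_comp _ _ h (@cvgy_atan R)).
- by move=> x _; have [] := is_derive_poisson e x e0.
- apply: cvg_at_right_filter; exact: (is_derive_continuous _ _ _ (is_derive_poisson e 0 e0)).
- by move=> x _; rewrite derive1E; have [_ ->] := is_derive_poisson e x e0.
Unshelve. all: by end_near. Qed.

Lemma integral_poisson e x : 0 < e ->
  (\int[leb]_y (poisson e (x - y))%:E = (2 * pi)%:E)%E.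
Proof.
move=> e0.
have mp : measurable_fun [set: measurableTypeR R] (EFin \o poisson e).
  apply/measurable_EFinP; apply: continuous_measurable_fun; exact: continuous_poisson0.
under eq_integral do rewrite -opprB poissonN.
rewrite (ge0_integral_shift (- x) (EFin \o poisson e))//=; last first.
  by move=> y; rewrite lee_fin poisson_ge0.
rewrite ge0_integral_fold; last 2 first.
- exact/measurable_EFinP.
- by move=> y; exact: poisson_ge0.
under [X in (_ + X)%E]eq_integral do rewrite poissonN.
by rewrite integral_poisson_ray// -EFinD -mulr2n mulr_natl.
Qed.

(** The value is kept explicit because it shows the limit: for [x] strictly between [c] and [d],
    both arctangents tend to [pi / 2] as [e] tends to 0, and the interval captures the full mass
    [2 * pi]. *)
Lemma integral_poisson_itv e x c d : 0 < e -> c < d ->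
  (\int[leb]_(y in `]c, d[) (poisson e (x - y))%:E =
   (2 * (atan ((d - x) / e) + atan ((x - c) / e)))%:E)%E.
Proof.
move=> e0 cd.
pose F y := 2 * atan ((y - x) / e).
have dF y : is_derive y 1 F (poisson e (y - x)).
  have := @is_derive1_comp _ (fun t => 2 * atan (t / e)) (fun y => y - x) y _ 1 (is_derive_poisson e (y - x) e0).
  rewrite mulr1; apply; apply: is_derive_eq; exact: subr0.
under eq_integral do rewrite -opprB poissonN.
rewrite -(@integral_itv_bndoo _ _ _ _ true false); last first.
  apply/measurable_EFinP; apply: measurable_funTS.
  by apply: continuous_measurable_fun; exact: continuous_poisson.
rewrite (@continuous_FTC2 R _ F)//.
- by rewrite /F -EFinB; congr EFin; rewrite -mulrBr -atanN -mulNr opprB.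
- by apply: continuous_subspaceT; exact: continuous_poisson.
- split.
  + by move=> y _; have [] := dF y.
  + apply: cvg_at_right_filter; exact: (is_derive_continuous _ _ _ (dF c)).
  + apply: cvg_at_left_filter; exact: (is_derive_continuous _ _ _ (dF d)).
- by move=> y _; rewrite derive1E; have [_ ->] := dF y.
Qed.

Lemma sqr_sum_gt0 e z : 0 < e -> 0 < e ^+ 2 + z ^+ 2.
Proof. by move=> e0; rewrite ltr_wpDr// ?sqr_ge0// exprn_gt0. Qed.

Lemma integral_exp_trig_ray e z A B : 0 < e ->
  (forall x, `|A * cos (z * x) + B * sin (z * x)| <= 1) ->
  (\int[leb]_(x in `[0%R, +oo[)
     (expR (- e * x) * (1 + (A * cos (z * x) + B * sin (z * x))))%:E =
   (e^-1 + (A * e + B * z) / (e ^+ 2 + z ^+ 2))%:E)%E.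
Proof.
move=> e0 AB1; have dF := is_derive_dexp e z A B ^~ e0.
set F := fun t => _ in dF.
have cf : continuous (fun x => expR (- e * x) * (1 + (A * cos (z * x) + B * sin (z * x)))).
  by move=> x; apply: (is_derive_continuous _ x); apply: is_derive_eq.
rewrite (@ge0_continuous_FTC2y R _ F _ 0).
- rewrite /F !mulr0 expR0 cos0 sin0 sub0e; congr EFin; field.
  by rewrite (gt_eqF (sqr_sum_gt0 e z e0)) (gt_eqF e0).
- move=> x _; rewrite mulr_ge0 ?expR_ge0//.
  by have := AB1 x; rewrite ler_norml => /andP[+ _]; rewrite -subr_ge0 opprK addrC.
- exact: continuous_subspaceT.
(* [M] bounds the second factor of the primitive uniformly in [t], so that the exponential forces
   the limit 0 at infinity. *)
- pose M := e^-1 + (`|A| * (`|z| + e) + `|B| * (e + `|z|)) / (e ^+ 2 + z ^+ 2).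
  apply: norm_cvg0.
  have h1 : \forall t \near +oo, 0 <= `|F t| <= expR (- (e * t)) * M.
    apply: nearW => t; rewrite normr_ge0/= /F mulNr normrM (ger0_norm (expR_ge0 _)) ler_wpM2l ?expR_ge0//.
    rewrite (le_trans (ler_normD _ _))// lerD//; first by rewrite normrN ger0_norm// invr_ge0 ltW.
    have D0 : 0 < e ^+ 2 + z ^+ 2 by exact: sqr_sum_gt0.
    rewrite normrM normfV (gtr0_norm D0) ler_pM2r ?invr_gt0//.
    rewrite (le_trans (ler_normB _ _))// !normrM lerD// ler_wpM2l//.
      rewrite (le_trans (ler_normB _ _))// !normrM (gtr0_norm e0) lerD//.
        by rewrite ler_piMr// sin_max.
      by rewrite ler_piMr ?cos_max// ltW.
    rewrite (le_trans (ler_normD _ _))// !normrM (gtr0_norm e0) lerD//.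
      by rewrite ler_piMr ?sin_max// ltW.
    by rewrite ler_piMr// cos_max.
  apply: (squeeze_cvgr h1); first exact: cvg_cst.
  rewrite -[X in _ --> X](mul0r M); apply: cvgM; last exact: cvg_cst.
  have h : e * y @[y --> +oo] --> +oo.
    apply/cvgryPge => N; near=> y.
    by rewrite -ler_pdivrMl//; near: y; apply: nbhs_pinfty_ge; exact: num_real.
  exact: (cvg_comp _ _ h (@cvgr_expR R)).
- by move=> x _; have [] := dF x.
- by apply: cvg_at_right_filter; exact: (is_derive_continuous _ _ _ (dF 0)).
- by move=> x _; rewrite derive1E; have [_ ->] := dF x.
Unshelve. all: by end_near. Qed.

Definition expw e x : R := expR (- e * `|x|).

Lemma continuous_expw e : continuous (expw e).
Proof.
move=> x; apply: (@continuous_comp _ _ _ (fun x => - e * `|x|) expR); last exact: continuous_expR.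
by apply: cvgM; [exact: cvg_cst|exact: norm_continuous].
Qed.

(** Folding changes the sign of the sine, so the terms in [B] of the two half-lines cancel, while
    those in [A] add up to a Poisson kernel. *)
Lemma integral_expw_trig e z A B : 0 < e ->
  (forall x, `|A * cos (z * x) + B * sin (z * x)| <= 1) ->
  (\int[leb]_x (expw e x * (1 + (A * cos (z * x) + B * sin (z * x))))%:E =
    (2 / e + A * poisson e z)%:E)%E.
Proof.
move=> e0 AB1.
rewrite ge0_integral_fold; last 2 first.
- apply: continuous_measurable_fun => x; apply: cvgM; first exact: continuous_expw.
  apply: (is_derive_continuous _ x); apply: is_derive_eq.
- move=> x; rewrite mulr_ge0 ?expR_ge0//.
  by have := AB1 x; rewrite ler_norml => /andP[+ _]; rewrite -subr_ge0 opprK addrC.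
have AB2 x : `|A * cos (z * x) + - B * sin (z * x)| <= 1.
  by have := AB1 (- x); rewrite mulrN cosN sinN mulrN mulNr.
have -> : 2 / e + A * poisson e z = e^-1 + (A * e + B * z) / (e ^+ 2 + z ^+ 2) + (e^-1 + (A * e + - B * z) / (e ^+ 2 + z ^+ 2)).
  by rewrite /poisson; field; rewrite (gt_eqF (sqr_sum_gt0 e z e0)) (gt_eqF e0).
rewrite EFinD -!integral_exp_trig_ray//; congr (_ + _)%E; apply: eq_integral => x;
  rewrite inE/= in_itv/= andbT => x0; rewrite /expw.
  by rewrite ger0_norm.
by rewrite normrN ger0_norm// mulrN cosN sinN mulrN (mulNr B).
Qed.

Lemma integral_expw e : 0 < e -> (\int[leb]_x (expw e x)%:E = (2 / e)%:E)%E.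
Proof.
move=> e0; have := @integral_expw_trig e 0 0 0 e0.
rewrite mul0r addr0 => <-; first by apply: eq_integral => x _; rewrite !mul0r !addr0 mulr1.
by move=> x; rewrite !mul0r addr0 normr0.
Qed.

Lemma integrable_expw e : 0 < e -> leb.-integrable setT (EFin \o expw e).
Proof.
move=> e0; apply/integrableP; split.
  by apply/measurable_EFinP; apply: continuous_measurable_fun; exact: continuous_expw.
under eq_integral do rewrite /= ger0_norm ?expR_ge0//.
by rewrite integral_expw// ltry.
Qed.

Lemma integrable_expw_trig e z A B : 0 < e ->
  (forall x, `|A * cos (z * x) + B * sin (z * x)| <= 1) ->
  leb.-integrable setT (fun x => (expw e x * (A * cos (z * x) + B * sin (z * x)))%:E).
Proof.
move=> e0 AB1.
apply: (@le_integrable _ _ _ leb _ measurableT _ (EFin \o expw e)) => //.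
- apply/measurable_EFinP; apply: continuous_measurable_fun => x; apply: cvgM; first exact: continuous_expw.
  apply: (is_derive_continuous _ x); apply: is_derive_eq.
- move=> x _; rewrite /= lee_fin normrM; apply: ler_piMr => //.
- exact: integrable_expw.
Qed.

Lemma integral_expw_trigB e z A B : 0 < e ->
  (forall x, `|A * cos (z * x) + B * sin (z * x)| <= 1) ->
  (\int[leb]_x (expw e x * (A * cos (z * x) + B * sin (z * x)))%:E =
    (A * poisson e z)%:E)%E.
Proof.
move=> e0 AB1.
have i1 := integrable_expw_trig e z A B e0 AB1.
have i0 := integrable_expw e e0.
have := integral_expw_trig e z A B e0 AB1.
under eq_integral do rewrite mulrDr mulr1 EFinD.
rewrite integralD//= integral_expw//.
by rewrite -(fineK (integrable_fin_num measurableT i1)) -EFinD => -[] /addrI ->.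
Qed.

(** Linearity in [(A, B)]: after division by [c] the trigonometric part is bounded by 1, which is
    the case already computed. *)
Lemma integral_expw_cos_sin e z A B : 0 < e ->
  (\int[leb]_x (expw e x * (A * cos (z * x) + B * sin (z * x)))%:E =
    (A * poisson e z)%:E)%E.
Proof.
move=> e0; pose c := `|A| + `|B| + 1.
have c0 : 0 < c by rewrite ltr_wpDl// addr_ge0.
have h x : `|A / c * cos (z * x) + B / c * sin (z * x)| <= 1.
  rewrite !(mulrAC _ c^-1) -mulrDl normrM normfV (gtr0_norm c0) ler_pdivrMr// mul1r.
  rewrite (le_trans (ler_normD _ _))// /c !normrM -[leLHS]addr0 !lerD//.
    by rewrite ler_piMr// cos_max.
  by rewrite ler_piMr// sin_max.
have <- : (c%:E * (A / c * poisson e z)%:E)%E = (A * poisson e z)%:E.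
  by rewrite -EFinM mulrA (mulrCA c) divff ?gt_eqF// mulr1.
rewrite -(integral_expw_trigB _ _ _ (B / c))// -integralZl//; last exact: integrable_expw_trig.
by apply: eq_integral => x _; rewrite -EFinM; congr EFin; field; rewrite gt_eqF.
Qed.
End line.

(** * Integration over R^n, one coordinate at a time *)

Section rV_integral.
Context {R : realType}.
Local Notation leb := (@lebesgue_measure R).
Local Notation mu n := (@lebesgue_rV R n).
Implicit Types (e A B : R).

Definition rV_tail {n} (x : 'rV[R]_n.+1) : 'rV[R]_n := \row_j x ord0 (lift ord0 j).

Lemma rV_consD n (a b : R) (x y : 'rV[R]_n) :
  rV_cons (a + b, x + y) = rV_cons (a, x) + rV_cons (b, y).
Proof.
apply/rowP => i; rewrite [RHS]mxE; case: (unliftP ord0 i) => [j ->|->].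
  by rewrite !rV_cons_lift/= mxE.
by rewrite !rV_cons0.
Qed.

Lemma rV_consN n (a : R) (x : 'rV[R]_n) : rV_cons (- a, - x) = - rV_cons (a, x).
Proof.
apply/rowP => i; rewrite [RHS]mxE; case: (unliftP ord0 i) => [j ->|->].
  by rewrite !rV_cons_lift/= mxE.
by rewrite !rV_cons0.
Qed.

Lemma rV_cons_tail n (x : 'rV[R]_n.+1) : x = rV_cons (x ord0 ord0, rV_tail x).
Proof.
apply/rowP => i; case: (unliftP ord0 i) => [j ->|->].
  by rewrite !rV_cons_lift/= mxE.
by rewrite !rV_cons0.
Qed.

Lemma dotp_cons n (a b : R) (x y : 'rV[R]_n) :
  dotp (rV_cons (a, x)) (rV_cons (b, y)) = a * b + dotp x y.
Proof.
rewrite /dotp big_ord_recl !rV_cons0; congr (_ + _).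
by apply: eq_bigr => i _; rewrite !rV_cons_lift.
Qed.

Lemma measurable_rV_shift n (h : 'rV[R]_n) : measurable_fun setT (fun x : 'rV[R]_n => x + h).
Proof.
apply: measurable_fun_coordP => i; under eq_fun do rewrite mxE.
by apply: measurable_funD => //; exact: measurable_coord.
Qed.

Lemma measurable_rV_opp n : measurable_fun setT (fun x : 'rV[R]_n => - x).
Proof.
apply: measurable_fun_coordP => i; under eq_fun do rewrite mxE.
by apply: measurable_funN => //; exact: measurable_coord.
Qed.

Lemma ge0_integral_rV0 (f : 'rV[R]_0 -> \bar R) :
  measurable_fun setT f -> (\int[mu 0]_x f x = f 0%R)%E.
Proof. by move=> mf; rewrite /= integral_dirac// diracT mul1e. Qed.

Lemma ge0_integral_rV_cons n (f : 'rV[R]_n.+1 -> \bar R) :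
  measurable_fun setT f -> (forall x, 0 <= f x)%E ->
  (\int[mu n.+1]_x f x = \int[leb \x mu n]_p f (rV_cons p))%E.
Proof.
move=> mf f0.
transitivity (\int[pushforward (leb \x mu n)%E (@rV_cons R n)]_x f x)%E => //.
by rewrite ge0_integral_pushforward//; last exact: measurable_rV_cons.
Qed.

Lemma ge0_integral_rVS n (f : 'rV[R]_n.+1 -> \bar R) :
  measurable_fun setT f -> (forall x, 0 <= f x)%E ->
  (\int[mu n.+1]_x f x = \int[leb]_a \int[mu n]_y f (rV_cons (a, y)))%E.
Proof.
move=> mf f0; rewrite ge0_integral_rV_cons// (fubini_tonelli1 (f \o @rV_cons R n))//.
- by apply: measurableT_comp => //; exact: measurable_rV_cons.
- by move=> x; exact: f0.
Qed.

Lemma integral_rVS n (f : 'rV[R]_n.+1 -> \bar R) :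
  (mu n.+1).-integrable setT f ->
  (\int[mu n.+1]_x f x = \int[leb]_a \int[mu n]_y f (rV_cons (a, y)))%E.
Proof.
move=> /integrableP[mf foo].
have mfc : measurable_fun setT (f \o @rV_cons R n).
  by apply: measurableT_comp => //; exact: measurable_rV_cons.
have fc : (leb \x mu n)%E.-integrable setT (f \o @rV_cons R n).
  apply/integrableP; split => //; rewrite (le_lt_trans _ foo)//.
  by rewrite ge0_integral_rV_cons//; exact: measurableT_comp.
transitivity (\int[pushforward (leb \x mu n)%E (@rV_cons R n)]_x f x)%E => //.
rewrite integral_pushforward//; last exact: measurable_rV_cons.
by rewrite -integral12_prod_meas1.
Qed.

Lemma measurable_integral_rV_cons n (f : 'rV[R]_n.+1 -> \bar R) :
  measurable_fun setT f -> (forall x, 0 <= f x)%E ->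
  measurable_fun [set: measurableTypeR R] (fun a => \int[mu n]_y f (rV_cons (a, y)))%E.
Proof.
move=> mf f0; apply: (measurable_fun_fubini_tonelli_F (f \o @rV_cons R n)).
- by apply: (measurableT_comp mf); exact: measurable_rV_cons.
- by move=> x; exact: f0.
Qed.

(** The proof follows the recursive definition of [lebesgue_rV]: Tonelli splits off the first
    coordinate, which is shifted on the line, and the induction hypothesis shifts the tail. *)
Lemma ge0_integral_rV_shift n (h : 'rV[R]_n) (f : 'rV[R]_n -> \bar R) :
  measurable_fun setT f -> (forall x, 0 <= f x)%E ->
  (\int[mu n]_x f (x + h)%R = \int[mu n]_x f x)%E.
Proof.
elim: n h f => [h f|n IH h f] mf f0.
  by congr integral; apply/funext => x; congr f; apply/rowP => -[].
have mfh : measurable_fun setT (fun x : 'rV[R]_n.+1 => f (x + h)%R).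
  by apply: (measurableT_comp mf); exact: measurable_rV_shift.
rewrite (ge0_integral_rVS _ (fun x => f (x + h)%R) mfh (fun x => f0 _)).
rewrite (ge0_integral_rVS _ f mf f0).
pose F a := (\int[mu n]_y f (rV_cons (a, y)))%E.
have F0 x : (0 <= F x)%E by apply: integral_ge0 => y _; exact: f0.
rewrite -[RHS](ge0_integral_shift (h ord0 ord0) F (measurable_integral_rV_cons _ f mf f0) F0).
apply: eq_integral => a _; rewrite /F.
have mfa c : measurable_fun setT (fun y : 'rV[R]_n => f (rV_cons (c, y))).
  apply: (measurableT_comp mf); apply: measurableT_comp; first exact: measurable_rV_cons.
  exact: measurable_pair1.
rewrite -[RHS](IH (rV_tail h) (fun y => f (rV_cons (_, y))) (mfa _) (fun y => f0 _)).
by apply: eq_integral => y _; rewrite rV_consD -rV_cons_tail.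
Qed.

Lemma ge0_integral_rV_opp n (f : 'rV[R]_n -> \bar R) :
  measurable_fun setT f -> (forall x, 0 <= f x)%E ->
  (\int[mu n]_x f (- x)%R = \int[mu n]_x f x)%E.
Proof.
elim: n f => [f|n IH f] mf f0.
  by congr integral; apply/funext => x; congr f; apply/rowP => -[].
have mfh : measurable_fun setT (fun x : 'rV[R]_n.+1 => f (- x)%R).
  by apply: (measurableT_comp mf); exact: measurable_rV_opp.
rewrite (ge0_integral_rVS _ (fun x => f (- x)%R) mfh (fun x => f0 _)).
rewrite (ge0_integral_rVS _ f mf f0).
pose F a := (\int[mu n]_y f (rV_cons (a, y)))%E.
have F0 x : (0 <= F x)%E by apply: integral_ge0 => y _; exact: f0.
rewrite -[RHS](ge0_integral_opp F (measurable_integral_rV_cons _ f mf f0) F0).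
apply: eq_integral => a _; rewrite /F.
have mfa c : measurable_fun setT (fun y : 'rV[R]_n => f (rV_cons (c, y))).
  apply: (measurableT_comp mf); apply: measurableT_comp; first exact: measurable_rV_cons.
  exact: measurable_pair1.
rewrite -[RHS](IH (fun y => f (rV_cons (_, y))) (mfa _) (fun y => f0 _)).
by apply: eq_integral => y _; rewrite rV_consN.
Qed.

Lemma measurable_prod_coord n (h : 'I_n -> R -> R) :
  (forall i, measurable_fun [set: measurableTypeR R] (h i)) ->
  measurable_fun setT (fun x : 'rV[R]_n => \prod_(i < n) h i (x ord0 i)).
Proof.
move=> mh; apply: measurable_prod => i _.
by apply: (measurableT_comp (mh i)); exact: measurable_coord.
Qed.

(** Serves the damping weight, the Poisson kernel and the indicators of boxes alike, all of them
    products of functions of one coordinate. *)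
Lemma ge0_integral_prod_coord n (h : 'I_n -> R -> R) (c : 'I_n -> R) :
  (forall i, measurable_fun [set: measurableTypeR R] (h i)) ->
  (forall i x, 0 <= h i x) ->
  (forall i, \int[leb]_x (h i x)%:E = (c i)%:E)%E ->
  (\int[mu n]_x (\prod_(i < n) h i (x ord0 i))%:E = (\prod_(i < n) c i)%:E)%E.
Proof.
elim: n h c => [h c|n IH h c] mh h0 hc.
  rewrite ge0_integral_rV0 ?big_ord0//.
  by apply/measurable_EFinP; exact: measurable_prod_coord.
rewrite ge0_integral_rVS; last 2 first.
- by apply/measurable_EFinP; exact: measurable_prod_coord.
- by move=> x; rewrite lee_fin prodr_ge0.
have c'0 : 0 <= \prod_(i < n) c (lift ord0 i).
  apply: prodr_ge0 => i _; rewrite -lee_fin -hc; apply: integral_ge0 => x _.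
  by rewrite lee_fin.
transitivity (\int[leb]_a ((h ord0 a)%:E * (\prod_(i < n) c (lift ord0 i))%:E))%E.
  apply: eq_integral => a _.
  rewrite -(IH (fun i => h (lift ord0 i)))// -ge0_integralZl//.
  - apply: eq_integral => y _; rewrite big_ord_recl rV_cons0 EFinM; congr (_ * _%:E)%E.
    by apply: eq_bigr => i _; rewrite rV_cons_lift.
  - apply/measurable_EFinP.
    exact: (measurable_prod_coord _ (fun i => h (lift ord0 i))).
  - by move=> y _; rewrite lee_fin prodr_ge0.
  - by rewrite lee_fin.
rewrite ge0_integralZr//.
- by rewrite hc -EFinM [in RHS]big_ord_recl.
- by apply/measurable_EFinP; exact: mh.
- by move=> y _; rewrite lee_fin.
Qed.

(** A product over the coordinates instead of a function of [enorm]: its Fourier transform is then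
    the product [poissonV] of Poisson kernels on the line. *)
Definition expwV {n} (e : R) (x : 'rV[R]_n) : R := \prod_(i < n) expw e (x ord0 i).

Definition poissonV {n} (e : R) (x : 'rV[R]_n) : R := \prod_(i < n) poisson e (x ord0 i).

Lemma measurable_expw e : measurable_fun [set: measurableTypeR R] (expw e).
Proof. by apply: continuous_measurable_fun; exact: continuous_expw. Qed.

Lemma measurable_poisson e : 0 < e -> measurable_fun [set: measurableTypeR R] (poisson e).
Proof. by move=> e0; apply: continuous_measurable_fun; exact: continuous_poisson0. Qed.

Lemma measurable_expwV n e : measurable_fun setT (@expwV n e).
Proof. by apply: (measurable_prod_coord _ (fun=> expw e)) => _; exact: measurable_expw. Qed.

Lemma measurable_poissonV n e : 0 < e -> measurable_fun setT (@poissonV n e).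
Proof. by move=> e0; apply: (measurable_prod_coord _ (fun=> poisson e)) => _; exact: measurable_poisson. Qed.

Lemma expw_ge0 e x : 0 <= expw e x :> R.
Proof. exact: expR_ge0. Qed.

Lemma expwV_ge0 n e (x : 'rV[R]_n) : 0 <= expwV e x.
Proof. by apply: prodr_ge0 => i _; exact: expw_ge0. Qed.

Lemma poissonV_ge0 n e (x : 'rV[R]_n) : 0 < e -> 0 <= poissonV e x.
Proof. by move=> e0; apply: prodr_ge0 => i _; exact: poisson_ge0. Qed.

Lemma poissonVN n e (x : 'rV[R]_n) : poissonV e (- x) = poissonV e x.
Proof. by apply: eq_bigr => i _; rewrite mxE poissonN. Qed.

Lemma expwV_cons n e a (x : 'rV[R]_n) : expwV e (rV_cons (a, x)) = expw e a * expwV e x.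
Proof.
rewrite /expwV big_ord_recl rV_cons0; congr (_ * _).
by apply: eq_bigr => i _; rewrite rV_cons_lift.
Qed.

Lemma poissonV_cons n e a (x : 'rV[R]_n) :
  poissonV e (rV_cons (a, x)) = poisson e a * poissonV e x.
Proof.
rewrite /poissonV big_ord_recl rV_cons0; congr (_ * _).
by apply: eq_bigr => i _; rewrite rV_cons_lift.
Qed.

Lemma integral_expwV n e : 0 < e ->
  (\int[mu n]_x (expwV e x)%:E = ((2 / e) ^+ n)%:E)%E.
Proof.
move=> e0; rewrite (ge0_integral_prod_coord _ (fun=> expw e) (fun=> 2 / e)).
- by rewrite prodr_const card_ord.
- by move=> _; exact: measurable_expw.
- by move=> _; exact: expw_ge0.
- by move=> _; exact: integral_expw.
Qed.

Lemma integral_poissonV n e (x : 'rV[R]_n) : 0 < e ->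
  (\int[mu n]_y (poissonV e (x - y))%:E = ((2 * pi) ^+ n)%:E)%E.
Proof.
move=> e0.
have := ge0_integral_prod_coord n (fun i y => poisson e (x ord0 i - y)) (fun=> 2 * pi).
rewrite prodr_const card_ord => <-.
- by apply: eq_integral => y _; congr EFin; apply: eq_bigr => i _; rewrite !mxE.
- move=> i; apply: (measurableT_comp (measurable_poisson _ e0)) => //.
  exact: measurable_funB.
- by move=> i y; exact: poisson_ge0.
- by move=> i; exact: integral_poisson.
Qed.

Lemma integrable_expwV n e : 0 < e -> (mu n).-integrable setT (EFin \o expwV e).
Proof.
move=> e0; apply/integrableP; split; first by apply/measurable_EFinP; exact: measurable_expwV.
under eq_integral do rewrite /= ger0_norm ?expwV_ge0//.
by rewrite integral_expwV// ltry.
Qed.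

Lemma measurable_dotp n (z : 'rV[R]_n) : measurable_fun setT (dotp z).
Proof.
apply: measurable_sum => i; apply: measurable_funM => //; exact: measurable_coord.
Qed.

Lemma integrable_expwV_cos_sin n e (z : 'rV[R]_n) A B : 0 < e ->
  (mu n).-integrable setT (fun x => (expwV e x * (A * cos (dotp z x) + B * sin (dotp z x)))%:E).
Proof.
move=> e0.
apply: (@le_integrable _ _ _ (mu n) _ measurableT _ (fun x => ((`|A| + `|B|)%:E * (EFin \o expwV e) x)%E)).
- apply/measurable_EFinP; apply: measurable_funM; first exact: measurable_expwV.
  apply: measurable_funD; apply: measurable_funM => //.
    by apply: measurableT_comp; [apply: continuous_measurable_fun; exact: continuous_cos|exact: measurable_dotp].
  by apply: measurableT_comp; [apply: continuous_measurable_fun; exact: continuous_sin|exact: measurable_dotp].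
- move=> x _; rewrite /= lee_fin mulrC !normrM ler_wpM2r//.
  rewrite (le_trans (ler_normD _ _))// (le_trans _ (ler_norm _))// !normrM lerD//.
    by rewrite ler_piMr// cos_max.
  by rewrite ler_piMr// sin_max.
- by apply: integrableZl => //; exact: integrable_expwV.
Qed.

(** The combinations [A cos + B sin], rather than the cosine alone, are what the induction on the
    dimension preserves: by the addition formulas the integrand has the same shape in the tail, with
    coefficients that depend on the first coordinate, and the induction hypothesis keeps the cosine
    coefficient. *)
Lemma integral_expwV_cos_sin n e (z : 'rV[R]_n) A B : 0 < e ->
  (\int[mu n]_x (expwV e x * (A * cos (dotp z x) + B * sin (dotp z x)))%:E =
   (A * poissonV e z)%:E)%E.
Proof.
move=> e0; elim: n z A B => [|n IH] z A B.
  have mf : measurable_fun setT (fun x : 'rV[R]_0 => (expwV e x * (A * cos (dotp z x) + B * sin (dotp z x)))%:E).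
    exact: (measurable_int (mu 0)) (integrable_expwV_cos_sin _ _ _ _ _ e0).
  rewrite (ge0_integral_rV0 _ mf).
  by rewrite /dotp /expwV /poissonV !big_ord0 cos0 sin0 mul1r mulr0 addr0 mulr1.
rewrite integral_rVS; last exact: integrable_expwV_cos_sin.
rewrite (rV_cons_tail _ z) poissonV_cons.
set a := z ord0 ord0; set w := rV_tail z.
under eq_integral => c _.
  under eq_integral => y _.
    rewrite expwV_cons dotp_cons cosD sinD.
    rewrite (_ : _ * _ = expwV e y * ((expw e c * (A * cos (a * c) + B * sin (a * c))) * cos (dotp w y) +
      (expw e c * (B * cos (a * c) - A * sin (a * c))) * sin (dotp w y))); last by ring.
  over.
  rewrite IH EFinM.
over.
rewrite /= integralZr//.
  by rewrite integral_expw_cos_sin// -EFinM mulrA.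
apply: (@le_integrable _ _ _ leb _ measurableT _ (fun x => ((`|A| + `|B|)%:E * (EFin \o expw e) x)%E)).
- apply/measurable_EFinP; apply: measurable_funM; first exact: measurable_expw.
  apply: continuous_measurable_fun => x.
  by apply: (is_derive_continuous _ x); apply: is_derive_eq.
- move=> x _; rewrite /= lee_fin mulrC !normrM ler_wpM2r//.
  rewrite (le_trans (ler_normD _ _))// (le_trans _ (ler_norm _))// !normrM lerD//.
    by rewrite ler_piMr// cos_max.
  by rewrite ler_piMr// sin_max.
- by apply: integrableZl => //; exact: integrable_expw.
Qed.
End rV_integral.

Lemma sqrB_le (R : realDomainType) (x y : R) : (x - y) ^+ 2 <= 2 * x ^+ 2 + 2 * y ^+ 2.
Proof.
rewrite -subr_ge0; have -> : 2 * x ^+ 2 + 2 * y ^+ 2 - (x - y) ^+ 2 = (x + y) ^+ 2 by ring.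
exact: sqr_ge0.
Qed.

Lemma sqrD_le (R : realDomainType) (x y : R) : (x + y) ^+ 2 <= 2 * x ^+ 2 + 2 * y ^+ 2.
Proof. by have := sqrB_le R x (- y); rewrite opprK sqrrN. Qed.

(** * Sections and domination in product measures *)

Section product_measure.
Context d1 d2 (T1 : measurableType d1) (T2 : measurableType d2) {R : realType}.
Variable m1 : {sigma_finite_measure set T1 -> \bar R}.
Variable m2 : {sigma_finite_measure set T2 -> \bar R}.
Implicit Type f : T1 * T2 -> R.

(** The real integral is [fine] of the difference between the integrals of the positive and negative
    parts. Each of these is measurable by Tonelli, and so is [fine], including the points where it
    returns its default value. *)
Lemma measurable_Rintegral_section f : measurable_fun setT f ->
  measurable_fun setT (fun x => \int[m2]_y f (x, y)).
Proof.
move=> mf; have mf' : measurable_fun setT (EFin \o f) by exact/measurable_EFinP.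
have -> : (fun x => \int[m2]_y f (x, y)) =
    fine \o (fun x => (\int[m2]_y (EFin \o f)^\+ (x, y) - \int[m2]_y (EFin \o f)^\- (x, y))%E).
  apply/funext => x; rewrite /= /Rintegral [in LHS]integralE; congr (fine (_ - _)%E);
  by apply: eq_integral => y _; rewrite ?funeposE ?funenegE.
apply: measurableT_comp => //; apply: emeasurable_funB.
- have h : measurable_fun setT ((EFin \o f)^\+)%E by exact: measurable_funepos.
  exact: (@measurable_fun_fubini_tonelli_F _ _ T1 T2 R m2 _ h).
- have h : measurable_fun setT ((EFin \o f)^\-)%E by exact: measurable_funeneg.
  exact: (@measurable_fun_fubini_tonelli_F _ _ T1 T2 R m2 _ h).
Qed.

(** Tonelli bounds the integral of the modulus by the product of the integrals of [|u|] and [|v|].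
    The interchanges in the damped energy rest on bounds of this form. *)
Lemma integrable_prod_bound f (u : T1 -> R) (v : T2 -> R) :
  measurable_fun setT f ->
  m1.-integrable setT (EFin \o u) -> m2.-integrable setT (EFin \o v) ->
  (forall x y, `|f (x, y)| <= u x * v y) ->
  (m1 \x m2)%E.-integrable setT (EFin \o f).
Proof.
move=> mf iu iv fuv.
have [mu uoo] := integrableP _ _ _ iu; have [mv voo] := integrableP _ _ _ iv.
have mf' : measurable_fun setT (EFin \o f) by exact/measurable_EFinP.
apply/(integrable12ltyP m1 m2 mf').
set U := (\int[m1]_x `|(EFin \o u) x|)%E in uoo.
set V := (\int[m2]_x `|(EFin \o v) x|)%E in voo.
apply: (@le_lt_trans _ _ (\int[m1]_x (`|(EFin \o u) x| * V))%E).
  apply: ge0_le_integral => //.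
  - by move=> x _; exact: integral_ge0.
  - apply: (measurable_fun_fubini_tonelli_F (abse \o (EFin \o f))).
      exact: measurableT_comp.
    by move=> x; exact: abse_ge0.
  - by apply: emeasurable_funM => //; exact: measurableT_comp.
  - move=> x _; rewrite /V -ge0_integralZl//; last exact: measurableT_comp.
    apply: ge0_le_integral => //.
    + by apply: measurableT_comp => //; exact: (measurableT_comp mf').
    + by apply: emeasurable_funM => //; exact: measurableT_comp.
    + move=> y _ /=; rewrite -EFinM lee_fin (le_trans (fuv _ _))// -normrM.
      exact: ler_norm.
rewrite ge0_integralZr//; last 2 first.
- exact: measurableT_comp.
- exact: integral_ge0.
by rewrite lte_mul_pinfty// ?ge0_fin_numE//; exact: integral_ge0.
Qed.
End product_measure.

(** * The damped Plancherel defect *)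

Section poisson_form.
Context {R : realType} {n : nat}.
Local Notation mu := (@lebesgue_rV R n).
Local Notation V := 'rV[R]_n.
Local Notation M := ((2 * pi) ^+ n : R).
Implicit Types (e : R) (a b : V -> R).

Lemma two_pi_ge0 : 0 <= M.
Proof. by rewrite exprn_ge0// mulr_ge0// pi_ge0. Qed.

Lemma measurable_poissonV_sub e : 0 < e ->
  measurable_fun [set: V * V] (fun p => poissonV e (p.1 - p.2)).
Proof.
move=> e0; apply: (measurableT_comp (measurable_poissonV n e e0)).
apply: measurable_fun_coordP => i; under eq_fun do rewrite !mxE.
apply: measurable_funB.
  by apply: (measurableT_comp (@measurable_coord R n i)); exact: measurable_fst.
by apply: (measurableT_comp (@measurable_coord R n i)); exact: measurable_snd.
Qed.

Lemma measurable_poissonV_subr e (x : V) : 0 < e ->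
  measurable_fun setT (fun y : V => poissonV e (x - y)).
Proof.
move=> e0; apply: (measurableT_comp (measurable_poissonV n e e0)).
apply: measurable_fun_coordP => i; under eq_fun do rewrite !mxE.
by apply: measurable_funB => //; exact: measurable_coord.
Qed.

Lemma measurable_comp_fst a : measurable_fun setT a ->
  measurable_fun [set: V * V] (fun p => a p.1).
Proof. by move=> ma; apply: (measurableT_comp ma); exact: measurable_fst. Qed.

Lemma measurable_comp_snd a : measurable_fun setT a ->
  measurable_fun [set: V * V] (fun p => a p.2).
Proof. by move=> ma; apply: (measurableT_comp ma); exact: measurable_snd. Qed.

(** Integrating first over the other variable leaves the mass [M] of the kernel, which is the same
    around every point. *)
Lemma integral_fst_poissonV e b : 0 < e -> measurable_fun setT b -> (forall x, 0 <= b x) ->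
  (\int[mu \x mu]_p (b p.1 * poissonV e (p.1 - p.2))%:E = M%:E * \int[mu]_x (b x)%:E)%E.
Proof.
move=> e0 mb b0.
have mf : measurable_fun [set: V * V] (fun p => (b p.1 * poissonV e (p.1 - p.2))%:E).
  apply/measurable_EFinP; apply: measurable_funM; first exact: measurable_comp_fst.
  exact: measurable_poissonV_sub.
rewrite (fubini_tonelli1 _ mf); last first.
  by move=> p; rewrite lee_fin mulr_ge0// poissonV_ge0.
rewrite -ge0_integralZl//; last 3 first.
- exact/measurable_EFinP.
- by move=> x _; rewrite lee_fin.
- by rewrite lee_fin two_pi_ge0.
apply: eq_integral => x _; rewrite /fubini_F /=.
rewrite -(integral_poissonV _ _ x e0) muleC -ge0_integralZl//.
- by apply/measurable_EFinP; exact: measurable_poissonV_subr.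
- by move=> y _; rewrite lee_fin poissonV_ge0.
- by rewrite lee_fin.
Qed.

Lemma integral_snd_poissonV e b : 0 < e -> measurable_fun setT b -> (forall x, 0 <= b x) ->
  (\int[mu \x mu]_p (b p.2 * poissonV e (p.1 - p.2))%:E = M%:E * \int[mu]_x (b x)%:E)%E.
Proof.
move=> e0 mb b0.
have mf : measurable_fun [set: V * V] (fun p => (b p.2 * poissonV e (p.1 - p.2))%:E).
  apply/measurable_EFinP; apply: measurable_funM; first exact: measurable_comp_snd.
  exact: measurable_poissonV_sub.
rewrite (fubini_tonelli2 _ mf); last first.
  by move=> p; rewrite lee_fin mulr_ge0// poissonV_ge0.
rewrite -ge0_integralZl//; last 3 first.
- exact/measurable_EFinP.
- by move=> x _; rewrite lee_fin.
- by rewrite lee_fin two_pi_ge0.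
apply: eq_integral => y _; rewrite /fubini_G /=.
rewrite -(integral_poissonV _ _ y e0) muleC -ge0_integralZl//.
- by apply: eq_integral => x _; rewrite -EFinM -poissonVN opprB.
- by apply/measurable_EFinP; exact: measurable_poissonV_subr.
- by move=> x _; rewrite lee_fin poissonV_ge0.
- by rewrite lee_fin.
Qed.

(* Twice the defect in Plancherel's identity for [a] when the energy of the
   transform is damped by [expwV e]. *)
Definition pform e a : \bar R :=
  (\int[mu \x mu]_p ((a p.1 - a p.2) ^+ 2 * poissonV e (p.1 - p.2))%:E)%E.

Lemma measurable_pform e a : 0 < e -> measurable_fun setT a ->
  measurable_fun [set: V * V] (fun p => ((a p.1 - a p.2) ^+ 2 * poissonV e (p.1 - p.2))%:E).
Proof.
move=> e0 ma; apply/measurable_EFinP; apply: measurable_funM; last exact: measurable_poissonV_sub.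
apply: measurable_funX; apply: measurable_funB; [exact: measurable_comp_fst|exact: measurable_comp_snd].
Qed.

Lemma le_pform e (f : V * V -> \bar R) a : 0 < e ->
  measurable_fun setT a -> measurable_fun setT f ->
  (forall p, ((a p.1 - a p.2) ^+ 2 * poissonV e (p.1 - p.2))%:E <= f p)%E ->
  (pform e a <= \int[mu \x mu]_p f p)%E.
Proof.
move=> e0 ma mf af; apply: ge0_le_integral => //.
- by move=> p _; rewrite lee_fin mulr_ge0 ?sqr_ge0 ?poissonV_ge0.
- exact: measurable_pform.
Qed.

Lemma pform_ge0 e a : 0 < e -> (0 <= pform e a)%E.
Proof.
by move=> e0; apply: integral_ge0 => p _; rewrite lee_fin mulr_ge0 ?sqr_ge0 ?poissonV_ge0.
Qed.

(** The bound is uniform in [e], which is what makes the class of functions with vanishing defect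
    closed in L^2. The 4 is 2 + 2, from the square of a difference, with one mass [M] per term. *)
Lemma pform_le_L2 e a : 0 < e -> measurable_fun setT a ->
  (pform e a <= (4 * M)%:E * \int[mu]_x (a x ^+ 2)%:E)%E.
Proof.
move=> e0 ma; pose b x := 2 * a x ^+ 2.
have mb : measurable_fun setT b by apply: measurable_funM => //; exact: measurable_funX.
have b0 x : 0 <= b x by rewrite mulr_ge0// sqr_ge0.
have mP := measurable_poissonV_sub e e0.
have m1 : measurable_fun setT (fun p : V * V => (b p.1 * poissonV e (p.1 - p.2))%:E).
  apply/measurable_EFinP; apply: measurable_funM => //; exact: measurable_comp_fst.
have m2 : measurable_fun setT (fun p : V * V => (b p.2 * poissonV e (p.1 - p.2))%:E).
  apply/measurable_EFinP; apply: measurable_funM => //; exact: measurable_comp_snd.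
apply: (@le_trans _ _ (\int[mu \x mu]_p ((b p.1 * poissonV e (p.1 - p.2))%:E + (b p.2 * poissonV e (p.1 - p.2))%:E))%E).
  apply: le_pform => //; first exact: emeasurable_funD.
  move=> p; rewrite -EFinD lee_fin -mulrDl ler_wpM2r ?poissonV_ge0//.
  exact: sqrB_le.
rewrite ge0_integralD//; last 2 first.
- by move=> p _; rewrite lee_fin mulr_ge0 ?poissonV_ge0.
- by move=> p _; rewrite lee_fin mulr_ge0 ?poissonV_ge0.
rewrite integral_fst_poissonV// integral_snd_poissonV//.
have ma2 : measurable_fun setT (fun x => (a x ^+ 2)%:E).
  by apply/measurable_EFinP; exact: measurable_funX.
have -> : (\int[mu]_x (b x)%:E = 2%:E * \int[mu]_x (a x ^+ 2)%:E)%E.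
  by rewrite -ge0_integralZl// => x _; rewrite lee_fin sqr_ge0.
rewrite muleA -EFinM -ge0_muleDl ?lee_fin ?mulr_ge0 ?two_pi_ge0//.
by rewrite -EFinD; apply: lee_pmul => //; rewrite ?lee_fin ?mulr_ge0 ?addr_ge0 ?mulr_ge0 ?two_pi_ge0//;
  [apply: integral_ge0 => x _; rewrite lee_fin sqr_ge0|lra].
Qed.

(** Stated for any [c] whose increments are controlled by those of [a] and [b], so as to serve for
    sums, for products of bounded functions and for approximation. *)
Lemma pform_add_le e a b (c : V -> R) : 0 < e -> measurable_fun setT a -> measurable_fun setT b ->
  measurable_fun setT c ->
  (forall x y, (c x - c y) ^+ 2 <= 2 * (a x - a y) ^+ 2 + 2 * (b x - b y) ^+ 2) ->
  (pform e c <= 2%:E * pform e a + 2%:E * pform e b)%E.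
Proof.
move=> e0 ma mb mc abc.
have ma' := measurable_pform e a e0 ma.
have mb' := measurable_pform e b e0 mb.
rewrite /pform -!ge0_integralZl//; last 2 first.
- by move=> p _; rewrite lee_fin mulr_ge0 ?sqr_ge0 ?poissonV_ge0.
- by move=> p _; rewrite lee_fin mulr_ge0 ?sqr_ge0 ?poissonV_ge0.
rewrite -ge0_integralD//; last 4 first.
- by move=> p _; rewrite mule_ge0// lee_fin mulr_ge0 ?sqr_ge0 ?poissonV_ge0.
- exact: measurable_funeM.
- by move=> p _; rewrite mule_ge0// lee_fin mulr_ge0 ?sqr_ge0 ?poissonV_ge0.
- exact: measurable_funeM.
apply: le_pform => //; first by apply: emeasurable_funD; exact: measurable_funeM.
move=> p; rewrite -!EFinM -EFinD lee_fin.
have dist (r s t : R) : 2 * (r * t) + 2 * (s * t) = (2 * r + 2 * s) * t by ring.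
rewrite dist.
by apply: ler_wpM2r; [exact: poissonV_ge0|exact: abc].
Qed.

Lemma pform_scale e a (c : R) : 0 < e -> measurable_fun setT a ->
  (pform e (fun x => c * a x)%R = (c ^+ 2)%:E * pform e a)%E.
Proof.
move=> e0 ma; rewrite /pform -ge0_integralZl//.
- by apply: eq_integral => p _; rewrite -EFinM -mulrBr exprMn -[in LHS]mulrA.
- exact: measurable_pform.
- by move=> p _; rewrite lee_fin mulr_ge0 ?sqr_ge0 ?poissonV_ge0.
- by rewrite lee_fin sqr_ge0.
Qed.
End poisson_form.

(** * Functions whose defect vanishes with the damping *)

Section vanishing_class.
Context {R : realType} {n : nat}.
Local Notation mu := (@lebesgue_rV R n).
Local Notation V := 'rV[R]_n.
Local Notation M := ((2 * pi) ^+ n : R).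
Implicit Types (e : R) (a b c : V -> R).

(** The damping runs through a sequence tending to 0, so that the convergence theorems for sequences
    of functions apply. *)
Definition scale (k : nat) : R := k.+1%:R^-1.

Lemma scale_gt0 k : 0 < scale k.
Proof. by rewrite invr_gt0. Qed.

Definition vanishing a := measurable_fun setT a /\
  forall eps : R, 0 < eps -> \forall k \near \oo, (pform (scale k) a <= eps%:E)%E.

Lemma vanishing_le2 a b c : measurable_fun setT c -> vanishing a -> vanishing b ->
  (forall x y, (c x - c y) ^+ 2 <= 2 * (a x - a y) ^+ 2 + 2 * (b x - b y) ^+ 2) ->
  vanishing c.
Proof.
move=> mc [ma ha] [mb hb] cab; split => // eps eps0.
have eps4 : 0 < eps / 4 by rewrite divr_gt0.
near=> k.
apply: le_trans (pform_add_le _ _ _ _ (scale_gt0 k) ma mb mc cab) _.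
have -> : eps%:E = (2%:E * (eps / 4)%:E + 2%:E * (eps / 4)%:E)%E.
  by rewrite -!EFinM -EFinD; congr EFin; field.
by apply: leeD; rewrite lee_pmul2l//; near: k; [exact: ha|exact: hb].
Unshelve. all: by end_near. Qed.

Lemma vanishingD a b : vanishing a -> vanishing b -> vanishing (fun x => a x + b x).
Proof.
move=> va vb; apply: (vanishing_le2 a b) => //.
  by apply: measurable_funD; [case: va|case: vb].
by move=> x y; rewrite opprD addrACA; exact: sqrD_le.
Qed.

(** The increment of the product is [b x * (a x - a y) + a y * (b x - b y)], and the bounds by 1
    remove the outer factors. For indicators, this is closure under intersection. *)
Lemma vanishingM a b : (forall x, `|a x| <= 1) -> (forall x, `|b x| <= 1) ->
  vanishing a -> vanishing b -> vanishing (fun x => a x * b x).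
Proof.
move=> a1 b1 va vb; apply: (vanishing_le2 a b) => //.
  by apply: measurable_funM; [case: va|case: vb].
move=> x y.
have -> : a x * b x - a y * b y = b x * (a x - a y) + a y * (b x - b y) by ring.
apply: le_trans (sqrD_le _ _ _) _; rewrite !exprMn.
have h (z : R) : `|z| <= 1 -> z ^+ 2 <= 1 by move=> z1; rewrite -real_normK ?num_real// exprn_ile1.
by rewrite lerD// ler_pM2l// ler_piMl ?sqr_ge0// h.
Qed.

Lemma vanishingZ (r : R) a : vanishing a -> vanishing (fun x => r * a x).
Proof.
move=> [ma ha]; split; first exact: measurable_funM.
move=> eps eps0; have d0 : 0 < eps / (r ^+ 2 + 1) by rewrite divr_gt0// ltr_wpDl ?sqr_ge0.
near=> k; rewrite pform_scale ?scale_gt0//.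
apply: (@le_trans _ _ ((r ^+ 2)%:E * (eps / (r ^+ 2 + 1))%:E)%E).
  by rewrite lee_wpmul2l ?lee_fin ?sqr_ge0//; near: k; exact: ha.
have h : 0 < r ^+ 2 + 1 by rewrite ltr_wpDl ?sqr_ge0.
by rewrite -EFinM lee_fin mulrA ler_pdivrMr// mulrC ler_pM2l// lerDl.
Unshelve. all: by end_near. Qed.

Lemma vanishing0 : vanishing (fun=> 0).
Proof.
split => // eps eps0; apply: nearW => k.
rewrite /pform integral0_eq ?lee_fin ?ltW// => p _.
by rewrite subrr expr0n/= mul0r.
Qed.

Lemma vanishing_sum (I : Type) (r : seq I) (f : I -> V -> R) :
  (forall i, vanishing (f i)) -> vanishing (fun x => \sum_(i <- r) f i x).
Proof.
move=> vf; elim: r => [|i r IH].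
  by under eq_fun do rewrite big_nil; exact: vanishing0.
under eq_fun do rewrite big_cons; exact: vanishingD.
Qed.

(** Write [a] as [(a - b) + b]: the defect of [a - b] is at most a multiple of its squared L^2 norm,
    for every damping, and that of [b] is small for weak damping. *)
Lemma vanishing_closed a : measurable_fun setT a ->
  (forall eps : R, 0 < eps -> exists2 b, vanishing b & (\int[mu]_x ((a x - b x) ^+ 2)%:E <= eps%:E)%E) ->
  vanishing a.
Proof.
move=> ma ha; split => // eps eps0.
(* With this accuracy the defect of [a - b] is at most [4 * M * eps / (16 * (M + 1)) <= eps / 4],
   and [pform_add_le] doubles it. *)
have d0 : 0 < eps / (16 * (M + 1)) by rewrite divr_gt0// mulr_gt0// ltr_wpDl ?two_pi_ge0.
have [b [mb hb] ab] := ha _ d0.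
have eps4 : 0 < eps / 4 by rewrite divr_gt0.
have mab : measurable_fun setT (fun x => a x - b x) by exact: measurable_funB.
near=> k.
have e0 := scale_gt0 k.
have := pform_add_le (scale k) (fun x => a x - b x) b a e0 mab mb ma.
move=> /(_ _)/le_trans; apply.
  move=> x y; have -> : a x - a y = (a x - b x - (a y - b y)) + (b x - b y) by ring.
  exact: sqrD_le.
have -> : eps%:E = (2%:E * (eps / 4)%:E + 2%:E * (eps / 4)%:E)%E.
  by rewrite -!EFinM -EFinD; congr EFin; field.
apply: leeD; rewrite lee_pmul2l//; last by near: k; exact: hb.
apply: le_trans (pform_le_L2 _ _ e0 mab) _.
apply: (@le_trans _ _ ((4 * M)%:E * (eps / (16 * (M + 1)))%:E)%E).
  by rewrite lee_wpmul2l ?lee_fin ?mulr_ge0 ?two_pi_ge0.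
have h : 0 < M + 1 by rewrite ltr_wpDl ?two_pi_ge0.
rewrite -EFinM lee_fin mulrA ler_pdivrMr ?mulr_gt0//.
have -> : eps / 4 * (16 * (M + 1)) = 4 * (M + 1) * eps by field.
by rewrite ler_wpM2r ?ltW// ltr_pM2l// ltrDl.
Unshelve. all: by end_near. Qed.

End vanishing_class.

(** * The Poisson kernel as an approximate identity on boxes *)

Section approximate_identity.
Context {R : realType} {n : nat}.
Local Notation leb := (@lebesgue_measure R).
Local Notation mu := (@lebesgue_rV R n).
Local Notation V := 'rV[R]_n.
Local Notation M := ((2 * pi) ^+ n : R).
Implicit Types (e : R) (a b : V -> R) (c d : 'I_n -> R).

(** Open on all sides: at a point of the box the distances to the faces are positive, as the limit
    of the arctangents requires. *)
Definition box c d : set V := [set x | forall i, c i < x ord0 i < d i].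

Lemma indic_box c d x : \1_(box c d) x = \prod_(i < n) \1_(`]c i, d i[%classic) (x ord0 i) :> R.
Proof.
rewrite indicE; have [xb|xb] := pselect (box c d x).
  rewrite mem_set// big1// => i _; rewrite indicE mem_set//= in_itv/=; exact: xb.
rewrite memNset//; move: xb => /existsNP[i xi].
rewrite (bigD1 i)//= indicE memNset ?mul0r//= in_itv/=.
Qed.

Lemma indic_itv_measurable (c d : R) :
  measurable_fun [set: measurableTypeR R] (\1_(`]c, d[%classic : set R) : R -> R).
Proof. exact: measurable_indic. Qed.

Lemma measurable_box c d : measurable (box c d).
Proof.
apply/(@measurable_indicP _ _ R).
rewrite (_ : \1_(box c d) = fun x => \prod_(i < n) \1_(`]c i, d i[%classic) (x ord0 i)); last first.
  by apply/funext => x; exact: indic_box.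
by apply: (measurable_prod_coord _ (fun i => \1_(`]c i, d i[%classic))) => i; exact: indic_itv_measurable.
Qed.

Lemma integral_indic_box c d : exists r : R, (\int[mu]_x (\1_(box c d) x)%:E = r%:E)%E.
Proof.
exists (\prod_(i < n) fine (leb (`]c i, d i[)%classic)).
under eq_integral do rewrite indic_box.
apply: (ge0_integral_prod_coord _ (fun i => \1_(`]c i, d i[%classic))).
- by move=> i; exact: indic_itv_measurable.
- by move=> i x; rewrite indicE.
- move=> i; rewrite integral_indic// setIT fineK// lebesgue_measure_itv/=.
  by case: ifP.
Qed.

Lemma integrable_indic_box c d : mu.-integrable setT (fun x => (\1_(box c d) x)%:E).
Proof.
apply/integrableP; split.
  by apply/measurable_EFinP; exact: measurable_indic (measurable_box c d).
have [r rE] := integral_indic_box c d.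
under eq_integral do rewrite gee0_abs ?lee_fin ?indicE ?ler0n// -indicE.
by rewrite rE ltry.
Qed.

Lemma integral_box_poissonV c d e (x : V) : 0 < e -> box c d x ->
  (\int[mu]_y (\1_(box c d) y * poissonV e (x - y))%:E =
   (\prod_(i < n) (2 * (atan ((d i - x ord0 i) / e) + atan ((x ord0 i - c i) / e))))%:E)%E.
Proof.
move=> e0 xb.
rewrite -(ge0_integral_prod_coord _ (fun i y => \1_(`]c i, d i[%classic) y * poisson e (x ord0 i - y))).
- apply: eq_integral => y _; congr EFin; rewrite indic_box -big_split/=.
  by apply: eq_bigr => i _; rewrite !mxE.
- move=> i; apply: measurable_funM; first exact: indic_itv_measurable.
  by apply: (measurableT_comp (measurable_poisson _ e0)); exact: measurable_funB.
- by move=> i y; rewrite mulr_ge0 ?poisson_ge0// indicE ler0n.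
- move=> i; have /andP[cx xd] := xb i.
  rewrite -(integral_poisson_itv e (x ord0 i) _ _ e0 (lt_trans cx xd)).
  rewrite [RHS]integral_mkcond; apply: eq_integral => y _.
  by rewrite patchE indicE; case: ifPn => _; rewrite ?mul1r ?mul0r.
Qed.

Lemma cvg_atan_scale (t : R) : 0 < t -> atan (t / scale k) @[k --> \oo] --> pi / 2.
Proof.
move=> t0.
have h : t / scale k @[k --> \oo] --> +oo.
  apply/cvgryPge => A; near=> k; rewrite /scale invrK.
  rewrite mulrC -ler_pdivrMr// (@le_trans _ _ k%:R) ?ler_nat//; near: k.
  by move/cvgryPge : (@cvgr_idn R); exact.
exact: (cvg_comp _ _ h (@cvgy_atan R)).
Unshelve. all: by end_near. Qed.

Lemma cvg_prodr (I : Type) (r : seq I) (f : I -> nat -> R) (l : I -> R) :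
  (forall i, f i k @[k --> \oo] --> l i) ->
  \prod_(i <- r) f i k @[k --> \oo] --> \prod_(i <- r) l i.
Proof.
move=> fl; elim: r => [|i r IH].
  by rewrite big_nil; under eq_fun do rewrite big_nil; exact: cvg_cst.
by rewrite big_cons; under eq_fun do rewrite big_cons; exact: cvgM.
Qed.

(** For an indicator [a], the mass of the kernel centred at [x] that falls outside the set. *)
Let H a k (x : V) : \bar R := (\int[mu]_y ((1 - a y) * poissonV (scale k) (x - y))%:E)%E.

(** The increment of an indicator is nonzero exactly when one point lies in [A] and the other
    outside, so its square is a sum of two products; as the kernel is even, both contribute the same
    integral. *)
Lemma pform_indic_le k (A : set V) : measurable A ->
  (pform (scale k) (\1_A) <= 2%:E * \int[mu]_x ((\1_A x)%:E * H (\1_A) k x))%E.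
Proof.
move=> mA; have e0 := @scale_gt0 R k.
have ma : measurable_fun setT (\1_A : V -> R) by exact: measurable_indic.
have a01 x : 0 <= (\1_A x : R) <= 1 by rewrite indicE; case: (x \in A); rewrite ?ler01 ?lexx.
have mP := @measurable_poissonV_sub R n _ e0.
have a1 x : 0 <= 1 - \1_A x :> R by rewrite subr_ge0; case/andP: (a01 x).
have a0 x : 0 <= \1_A x :> R by case/andP: (a01 x).
have P0 (x : V) : 0 <= poissonV (scale k) x :> R by exact: poissonV_ge0.
have m1 : measurable_fun setT (fun p : V * V => (\1_A p.1 * ((1 - \1_A p.2) * poissonV (scale k) (p.1 - p.2)))%:E).
  apply/measurable_EFinP; apply: measurable_funM; first exact: measurable_comp_fst.
  apply: measurable_funM => //; apply: measurable_funB => //; exact: measurable_comp_snd.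
have m2 : measurable_fun setT (fun p : V * V => (\1_A p.2 * ((1 - \1_A p.1) * poissonV (scale k) (p.1 - p.2)))%:E).
  apply/measurable_EFinP; apply: measurable_funM; first exact: measurable_comp_snd.
  apply: measurable_funM => //; apply: measurable_funB => //; exact: measurable_comp_fst.
have p1 (x y z : V) : (0 <= (\1_A x * ((1 - \1_A y) * poissonV (scale k) z))%:E)%E.
  by rewrite lee_fin mulr_ge0// mulr_ge0.
apply: (@le_trans _ _ (\int[mu \x mu]_p ((\1_A p.1 * ((1 - \1_A p.2) * poissonV (scale k) (p.1 - p.2)))%:E +
   (\1_A p.2 * ((1 - \1_A p.1) * poissonV (scale k) (p.1 - p.2)))%:E))%E).
  apply: le_pform => //; first exact: emeasurable_funD.
  move=> p; rewrite -EFinD lee_fin !mulrA -mulrDl ler_wpM2r// !indicE.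
  by case: (p.1 \in A); case: (p.2 \in A); rewrite /= ?subrr ?subr0 ?mulr0 ?mul0r ?mulr1 ?addr0 ?add0r ?expr0n ?expr1n ?sub0r ?sqrrN ?expr1n.
rewrite ge0_integralD//.
have mP1 x : measurable_fun setT (fun y => ((1 - \1_A y) * poissonV (scale k) (x - y))%:E).
  apply/measurable_EFinP; apply: measurable_funM; last exact: measurable_poissonV_subr.
  exact: measurable_funB.
have sect x : (\int[mu]_y (\1_A x * ((1 - \1_A y) * poissonV (scale k) (x - y)))%:E = (\1_A x)%:E * H (\1_A) k x)%E.
  rewrite /H -ge0_integralZl//.
  by move=> y _; rewrite lee_fin mulr_ge0.
rewrite (fubini_tonelli1 _ m1); last by move=> p; exact: p1.
rewrite (fubini_tonelli2 _ m2); last by move=> p; exact: p1.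
rewrite mule_natl mule2n; apply: leeD; rewrite le_eqVlt; apply/orP; left; apply/eqP.
  by apply: eq_integral => x _; rewrite /fubini_F /= sect.
apply: eq_integral => x _; rewrite /fubini_G /= -sect; apply: eq_integral => y _.
by rewrite -[in LHS]poissonVN opprB.
Qed.

(** Inside the box the escaping mass [H] tends to 0 pointwise; outside, its factor in [f] vanishes.
    The indicator of the box times [M] is an integrable bound, so the integrals tend to 0 as
    well. *)
Lemma vanishing_box c d : vanishing (\1_(box c d)).
Proof.
have mB := measurable_box c d.
have ma : measurable_fun setT (\1_(box c d) : V -> R) by exact: measurable_indic.
split => // eps eps0.
have a0 x : 0 <= \1_(box c d) x :> R by rewrite indicE ler0n.
have a1 x : 0 <= 1 - \1_(box c d) x :> R by rewrite subr_ge0 indicE lern1 leq_b1.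
have P0 k (x : V) : 0 <= poissonV (scale k) x :> R by apply: poissonV_ge0; exact: scale_gt0.
have H0 k x : (0 <= H (\1_(box c d)) k x)%E.
  by apply: integral_ge0 => y _; rewrite lee_fin mulr_ge0.
have mH k : measurable_fun setT (H (\1_(box c d)) k).
  apply: (measurable_fun_fubini_tonelli_F (fun p : V * V => ((1 - \1_(box c d) p.2) * poissonV (scale k) (p.1 - p.2))%:E)).
    apply/measurable_EFinP; apply: measurable_funM; last by apply: measurable_poissonV_sub; exact: scale_gt0.
    by apply: measurable_funB => //; exact: measurable_comp_snd.
  by move=> p; rewrite lee_fin mulr_ge0.
(* Escaping mass plus captured mass is the total mass [M]; the captured one is explicit at the
   points of the box. *)
have HD k x : (H (\1_(box c d)) k x + \int[mu]_y (\1_(box c d) y * poissonV (scale k) (x - y))%:E = M%:E)%E.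
  rewrite /H -ge0_integralD//.
  - rewrite -(integral_poissonV n _ x (scale_gt0 k)); apply: eq_integral => y _.
    by rewrite -EFinD -mulrDl subrK mul1r.
  - by move=> y _; rewrite lee_fin mulr_ge0.
  - apply/measurable_EFinP; apply: measurable_funM; first exact: measurable_funB.
    by apply: measurable_poissonV_subr; exact: scale_gt0.
  - by move=> y _; rewrite lee_fin mulr_ge0.
  - apply/measurable_EFinP; apply: measurable_funM => //.
    by apply: measurable_poissonV_subr; exact: scale_gt0.
have HM k x : (H (\1_(box c d)) k x <= M%:E)%E.
  by rewrite -(HD k x) leeDl//; apply: integral_ge0 => y _; rewrite lee_fin mulr_ge0.
pose f k x : \bar R := ((\1_(box c d) x)%:E * H (\1_(box c d)) k x)%E.
have mf k : measurable_fun setT (f k).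
  by apply: emeasurable_funM; [exact/measurable_EFinP|exact: mH].
have ig : mu.-integrable setT (fun x => (M%:E * (\1_(box c d) x)%:E)%E).
  by apply: integrableZl => //; exact: integrable_indic_box.
have fg k x : (`|f k x| <= M%:E * (\1_(box c d) x)%:E)%E.
  rewrite gee0_abs /f ?mule_ge0 ?lee_fin// [leRHS]muleC.
  by apply: lee_wpmul2l; rewrite ?lee_fin.
have f_cvg x : f ^~ x @ \oo --> 0%E.
  rewrite /f indicE; have [xb|xb] := boolP (x \in box c d); last first.
    by under eq_fun do rewrite mul0e; exact: cvg_cst.
  rewrite inE in xb; under eq_fun do rewrite mul1e.
  pose q k := \prod_(i < n) (2 * (atan ((d i - x ord0 i) / scale k) + atan ((x ord0 i - c i) / scale k))) : R.
  have -> : H (\1_(box c d)) ^~ x = EFin \o (fun k => M - q k).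
    apply/funext => k /=; have := HD k x.
    rewrite integral_box_poissonV ?scale_gt0// -/(q k) => /(congr1 (fun z => z - (q k)%:E)%E).
    by rewrite addeK// -EFinB.
  apply: cvg_EFin; first by apply: nearW.
  rewrite /= -[X in _ --> X](subrr M); apply: cvgB; first exact: cvg_cst.
  rewrite [X in _ --> X](_ : M = \prod_(i < n) (2 * (pi / 2 + pi / 2))); last first.
    by rewrite prodr_const card_ord; congr (_ ^+ _); field.
  apply: (cvg_prodr _ _ (fun i k => 2 * (atan ((d i - x ord0 i) / scale k) + atan ((x ord0 i - c i) / scale k)))) => i.
  have /andP[cx xd] := xb i.
  by apply: cvgM; [exact: cvg_cst|apply: cvgD; apply: cvg_atan_scale; rewrite subr_gt0].
have [_ _] := @dominated_convergence _ _ _ mu setT measurableT f (cst 0%E) _ mf (measurable_cst _)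
  (aeW _ (fun x _ => f_cvg x)) ig (aeW _ (fun x k _ => fg k x)).
rewrite integral0 => /fine_cvgP[fin_f].
move=> /cvgrPdist_le/(_ (eps / 2)) h.
have {}h := h (divr_gt0 eps0 (ltr0n R 2)).
near=> k.
apply: le_trans (pform_indic_le k _ mB) _.
have fk : (\int[mu]_x f k x)%E \is a fin_num by near: k.
rewrite -(fineK fk) -EFinM lee_fin mulrC -ler_pdivlMr//.
apply: le_trans (ler_norm _) _; rewrite -normrN -sub0r.
by near: k.
Unshelve. all: by end_near. Qed.
End approximate_identity.

(** * From boxes to square integrable functions with bounded support *)

Section vanishing_L2.
Context {R : realType} {n : nat} (m : R).
Local Notation mu := (@lebesgue_rV R n).
Local Notation V := 'rV[R]_n.
Implicit Types (a b : V -> R) (A : set V).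

Definition cube : set V := box (fun=> - m) (fun=> m).

(** Dominated convergence turns pointwise convergence into the L^2 approximation that
    [vanishing_closed] asks for. *)
Lemma vanishing_dominated (b : nat -> V -> R) a (h : V -> \bar R) :
  measurable_fun setT a -> (forall k, vanishing (b k)) ->
  (forall x, b k x @[k --> \oo] --> a x) -> mu.-integrable setT h ->
  (forall k x, ((a x - b k x) ^+ 2)%:E <= h x)%E -> vanishing a.
Proof.
move=> ma vb ba ih bh; apply: vanishing_closed => // eps eps0.
pose f k x : \bar R := ((a x - b k x) ^+ 2)%:E.
have mf k : measurable_fun setT (f k).
  apply/measurable_EFinP; apply: measurable_funX; apply: measurable_funB => //; by case: (vb k).
have f_cvg x : f ^~ x @ \oo --> 0%E.
  rewrite /f; apply: cvg_EFin; first exact: nearW.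
  rewrite /= -[X in _ --> X](_ : 0 * 0 = 0 :> R); last by rewrite mul0r.
  have h0 : a x - b k x @[k --> \oo] --> (0 : R).
    by rewrite -[X in _ --> X](subrr (a x)); apply: cvgB; [exact: cvg_cst|exact: ba].
  exact: cvgM.
have fh k x : (`|f k x| <= h x)%E by rewrite gee0_abs ?lee_fin ?sqr_ge0//; exact: bh.
have [_ _] := @dominated_convergence _ _ _ mu setT measurableT f (cst 0%E) h mf (measurable_cst _)
  (aeW _ (fun x _ => f_cvg x)) ih (aeW _ (fun x k _ => fh k x)).
rewrite integral0 => /fine_cvgP[fin_f].
move=> /cvgrPdist_le/(_ _ eps0) {}hh.
have [k [fk ke]] : exists k, (\int[mu]_x f k x)%E \is a fin_num /\
    `|0 - fine (\int[mu]_x f k x)%E| <= eps.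
  have : \forall k \near \oo, (\int[mu]_x f k x)%E \is a fin_num /\
    `|0 - fine (\int[mu]_x f k x)%E| <= eps.
    by near=> k; split; near: k.
  by case=> N _ /(_ N (leqnn N)) NP; exists N.
exists (b k) => //; rewrite -[leLHS]/(\int[mu]_x f k x)%E -(fineK fk) lee_fin.
by apply: le_trans (ler_norm _) _; rewrite -normrN -sub0r.
Unshelve. all: by end_near. Qed.

(** Sets are cut by a fixed cube: the indicator of a complement is then a difference of two
    functions of the class, and the indicator of the cube is an integrable bound for countable
    unions. *)
Let good A := vanishing (\1_(A `&` cube)).

Let good0 : good set0.
Proof.
rewrite /good set0I (_ : \1_set0 = fun=> 0); first exact: vanishing0.
by apply/funext => x; rewrite indic0.
Qed.

Let goodC A : good A -> good (~` A).
Proof.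
move=> gA.
rewrite /good (_ : \1_(~` A `&` cube) = fun x => \1_cube x + -1 * \1_(A `&` cube) x).
  by apply: vanishingD; [exact: vanishing_box|exact: vanishingZ].
apply/funext => x; rewrite !indicE !in_setI in_setC.
by case: (x \in A); case: (x \in cube); rewrite /= ?mulr0 ?addr0 ?mulr1 ?subrr.
Qed.

Let goodU A B : good A -> good B -> good (A `|` B).
Proof.
move=> gA gB; have I1 (C : set V) x : `|\1_C x : R| <= 1.
  by rewrite indicE; case: (_ \in _); rewrite ?normr0 ?normr1 ?ler01.
rewrite /good (_ : \1_((A `|` B) `&` cube) = fun x => (\1_(A `&` cube) x + \1_(B `&` cube) x)
   + -1 * (\1_(A `&` cube) x * \1_(B `&` cube) x)).
  apply: vanishingD; first exact: vanishingD.
  by apply: vanishingZ; apply: vanishingM.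
apply/funext => x; rewrite !indicE !in_setI in_setU.
by case: (x \in A); case: (x \in B); case: (x \in cube); rewrite /=; ring.
Qed.

(** At each point the indicators of the finite unions [G k] are eventually constant, and their
    distance to the limit is at most the indicator of the cube. *)
Let good_bigcup (F : (set V)^nat) : (forall k, good (F k)) -> good (\bigcup_k F k).
Proof.
move=> gF; pose G k := \big[setU/set0]_(i < k) F i.
have gG k : good (G k).
  by rewrite /G; elim/big_ind : _ => //.
apply: (@vanishing_dominated (fun k => \1_(G k `&` cube)) _ (fun x => (\1_cube x)%:E)).
- have -> : \bigcup_k F k `&` cube = \bigcup_k (F k `&` cube) by rewrite setI_bigcupl.
  apply: measurable_indic; apply: bigcupT_measurable => k.
  apply/(@measurable_indicP _ _ R); exact: (gF k).1.
- exact: gG.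
- move=> x; have [[k _ Fk]|nF] := pselect ((\bigcup_k F k) x).
    have xF : x \in \bigcup_k F k by rewrite inE; exists k.
    apply: cvg_near_cst; near=> j; rewrite !indicE !in_setI xF.
    suff -> : x \in G j by [].
    by rewrite inE /G -bigcup_mkord; exists k => //=; near: j; exact: nbhs_infty_gt.
  apply: cvg_near_cst; apply: nearW => j.
  rewrite !indicE !in_setI (memNset nF).
  suff -> : (x \in G j) = false by [].
  by apply: memNset; rewrite /G -bigcup_mkord => -[i _ Fi]; apply: nF; exists i.
- exact: integrable_indic_box.
- move=> k x; rewrite lee_fin !indicE !in_setI.
  by case: (_ \in _); case: (_ \in _); case: (_ \in _); rewrite /= ?subrr ?subr0 ?sub0r ?sqrrN ?expr0n ?expr1n ?ler01.
Unshelve. all: by end_near. Qed.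

(** The [good] sets form a sigma-algebra, so generators suffice: preimages of Borel sets by a
    coordinate, which a second sigma-algebra argument, on the line, reduces to preimages of open
    half-lines. *)
Lemma vanishing_indic A : measurable A -> vanishing (\1_(A `&` cube)).
Proof.
move: A; suff : @measurable _ 'rV[R]_n `<=` good by apply.
have sG : sigma_algebra setT good.
  split => //; first by move=> A; rewrite setTD; exact: goodC.
apply: smallest_sub => //.
rewrite -bigcup_seq => B [i _ [C mC <-]] /=; rewrite setTI.
move: C mC; suff : @measurable _ (measurableTypeR R) `<=`
    [set C | good ((fun x : V => x ord0 i) @^-1` C)] by apply.
move=> C mC; have {mC} : (@RGenOInfty.G R).-sigma.-measurable C.
  by rewrite -RGenOInfty.measurableE.
move: C; apply: smallest_sub.
  split => /=.
  - by rewrite preimage_set0.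
  - by move=> C gC; rewrite setTD preimage_setC; exact: goodC.
  - by move=> F gF; rewrite preimage_bigcup; exact: good_bigcup.
move=> _ [x ->] /=; rewrite /good.
(* A coordinate half-space cuts the open cube in an open box: only the lower face in direction [i]
   moves, up to [x] when [x] exceeds [- m]. *)
rewrite (_ : _ `&` cube = box (fun j => if j == i then Num.max x (- m) else - m) (fun=> m)).
  exact: vanishing_box.
apply/seteqP; split => y /=.
  rewrite in_itv/= andbT => -[xy By] j; have := By j; case: eqP => // -> /andP[m1 ->].
  by rewrite andbT gt_max xy.
move=> By; split.
  by have := By i; rewrite eqxx gt_max in_itv/= andbT => /andP[/andP[]].
by move=> j; have := By j; case: eqP => // ->; rewrite gt_max => /andP[/andP[_ ->]].
Qed.

Import HBNNSimple.

(** Nondecreasing simple functions below [a] converge to it, with squared error at most [a ^+ 2].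
    Their level sets may be cut by the cube, because these functions vanish where [a] does. *)
Lemma vanishing_ge0 a : measurable_fun setT a -> (forall x, 0 <= a x) ->
  (forall x, ~ cube x -> a x = 0) -> (\int[mu]_x (a x ^+ 2)%:E < +oo)%E -> vanishing a.
Proof.
move=> ma a0 supp fin.
have ma' : measurable_fun setT (EFin \o a) by exact/measurable_EFinP.
pose g := nnsfun_approx measurableT ma'.
have ga x : g k x @[k --> \oo] --> a x.
  have := @cvg_nnsfun_approx _ _ _ _ measurableT _ ma' (fun x _ => a0 x) x I.
  by move=> /fine_cvgP[_].
have nd x : nondecreasing_seq (fun k => g k x).
  by move=> i j ij; apply/lefP; exact: nd_nnsfun_approx.
have g_le k x : g k x <= a x.
  rewrite -(cvg_lim _ (ga x))//; apply: (nondecreasing_cvgn_le (nd x)).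
  by apply/cvg_ex; exists (a x).
apply: (@vanishing_dominated g _ (fun x => (a x ^+ 2)%:E)) => //.
- move=> k; rewrite (_ : (g k : V -> R) = fun x => \sum_(y <- finmap.enum_fset (fset_set (range (g k))))
     (y * \1_((g k @^-1` [set y]) `&` cube) x)).
    apply: vanishing_sum => y; apply: vanishingZ; apply: vanishing_indic.
    by rewrite -[X in measurable X]setTI; exact: measurable_funP.
  apply/funext => x; have [xc|xc] := pselect (cube x).
    rewrite [LHS]fimfunE fsbig_finite//; apply: eq_bigr => y _; rewrite !indicE in_setI.
    by rewrite (mem_set xc) andbT.
  rewrite big1; last by move=> y _; rewrite indicE in_setI (memNset xc) andbF mulr0.
  by apply/eqP; rewrite eq_le fun_ge0 andbT -(supp x xc).
- apply/integrableP; split; first by apply/measurable_EFinP; exact: measurable_funX.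
  by under eq_integral do rewrite gee0_abs ?lee_fin ?sqr_ge0//.
- move=> k x; rewrite lee_fin ler_sqr ?nnegrE ?subr_ge0//.
  by rewrite gerBl.
Qed.

Lemma vanishing_L2 a : measurable_fun setT a ->
  (forall x, ~ cube x -> a x = 0) -> (\int[mu]_x (a x ^+ 2)%:E < +oo)%E -> vanishing a.
Proof.
move=> ma supp fin.
pose ap x := Num.max (a x) 0; pose an x := Num.max (- a x) 0.
have map_ : measurable_fun setT ap by apply: measurable_maxr.
have man : measurable_fun setT an by apply: measurable_maxr => //; exact: measurable_funN.
have -> : a = fun x => ap x + -1 * an x.
  apply/funext => x; rewrite /ap /an; case: (leP (a x) 0) => ax.
    by rewrite max_l ?oppr_ge0// add0r mulN1r opprK.
  by rewrite max_r ?oppr_le0 ?ltW// mulr0 addr0.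
have le_fin b : measurable_fun setT b -> (forall x, b x ^+ 2 <= a x ^+ 2) -> (\int[mu]_x (b x ^+ 2)%:E < +oo)%E.
  move=> mb ba; apply: le_lt_trans fin; apply: ge0_le_integral => //.
  - by move=> x _; rewrite lee_fin sqr_ge0.
  - by apply/measurable_EFinP; exact: measurable_funX.
  - by apply/measurable_EFinP; exact: measurable_funX.
  - by move=> x _; rewrite lee_fin.
apply: vanishingD; last apply: vanishingZ; apply: vanishing_ge0 => //.
- by move=> x; rewrite /ap le_max lexx orbT.
- by move=> x /supp ax; rewrite /ap ax maxxx.
- apply: le_fin => // x; rewrite /ap; case: (leP (a x) 0) => ax //.
  by rewrite expr0n sqr_ge0.
- by move=> x; rewrite /an le_max lexx orbT.
- by move=> x /supp ax; rewrite /an ax oppr0 maxxx.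
- apply: le_fin => // x; rewrite /an; case: (leP (- a x) 0) => ax; last by rewrite sqrrN.
  by rewrite expr0n sqr_ge0.
Qed.
End vanishing_L2.

(** * Plancherel *)

Section real_plancherel.
Context {R : realType} {n : nat} (m : R) (a : 'rV[R]_n -> R).
Local Notation mu := (@lebesgue_rV R n).
Local Notation V := 'rV[R]_n.
Local Notation M := ((2 * pi) ^+ n : R).
Implicit Type e : R.
Hypothesis ma : measurable_fun setT a.
Hypothesis supp : forall x, ~ cube m x -> a x = 0.
Hypothesis L2a : (\int[mu]_x (a x ^+ 2)%:E < +oo)%E.

(** For a real [b], the Fourier transform without its normalising factor is
    [cos_transform b - i sin_transform b]. *)
Definition cos_transform (b : V -> R) (xi : V) : R := \int[mu]_x (b x * cos (dotp x xi)).
Definition sin_transform (b : V -> R) (xi : V) : R := \int[mu]_x (b x * sin (dotp x xi)).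

Lemma measurable_dotp2 : measurable_fun [set: V * V] (fun p => dotp p.1 p.2).
Proof.
apply: measurable_sum => i; apply: measurable_funM.
  by apply: (measurableT_comp (@measurable_coord R n i)); exact: measurable_fst.
by apply: (measurableT_comp (@measurable_coord R n i)); exact: measurable_snd.
Qed.

Lemma dotpC (x y : V) : dotp x y = dotp y x.
Proof. by apply: eq_bigr => i _; rewrite mulrC. Qed.

Lemma dotpBl (x y z : V) : dotp (x - y) z = dotp x z - dotp y z.
Proof. by rewrite /dotp -sumrB; apply: eq_bigr => i _; rewrite !mxE mulrBl. Qed.

Lemma dotpDr (x y z : V) : dotp x (y + z) = dotp x y + dotp x z.
Proof. by rewrite /dotp -big_split; apply: eq_bigr => i _; rewrite !mxE mulrDr. Qed.

Lemma dotpNr (x y : V) : dotp x (- y) = - dotp x y.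
Proof. by rewrite /dotp -sumrN; apply: eq_bigr => i _; rewrite !mxE mulrN. Qed.

Lemma measurable_cos : measurable_fun [set: R] (@cos R).
Proof. by apply: continuous_measurable_fun; exact: continuous_cos. Qed.

Lemma measurable_sin : measurable_fun [set: R] (@sin R).
Proof. by apply: continuous_measurable_fun; exact: continuous_sin. Qed.

Lemma measurable_cos_transform (b : V -> R) : measurable_fun setT b ->
  measurable_fun setT (cos_transform b).
Proof.
move=> mb; apply: (measurable_Rintegral_section _ _ _ _ mu (fun p : V * V => b p.2 * cos (dotp p.2 p.1))).
apply: measurable_funM; first exact: measurable_comp_snd.
apply: (measurableT_comp measurable_cos); under eq_fun do rewrite dotpC.
exact: measurable_dotp2.
Qed.

Lemma measurable_sin_transform (b : V -> R) : measurable_fun setT b ->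
  measurable_fun setT (sin_transform b).
Proof.
move=> mb; apply: (measurable_Rintegral_section _ _ _ _ mu (fun p : V * V => b p.2 * sin (dotp p.2 p.1))).
apply: measurable_funM; first exact: measurable_comp_snd.
apply: (measurableT_comp measurable_sin); under eq_fun do rewrite dotpC.
exact: measurable_dotp2.
Qed.

Lemma integrable_sqr : mu.-integrable setT (fun x => (a x ^+ 2)%:E).
Proof.
apply/integrableP; split; first by apply/measurable_EFinP; exact: measurable_funX.
by under eq_integral do rewrite gee0_abs ?lee_fin ?sqr_ge0//.
Qed.

(** On the cube [|a x| <= 1 + a x ^+ 2], a sum of two integrable functions; elsewhere [a]
    vanishes. *)
Lemma integrable_L2_cube : mu.-integrable setT (EFin \o a).
Proof.
apply: (@le_integrable _ _ _ mu _ measurableT _ (fun x => (\1_(cube m) x + a x ^+ 2)%:E)).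
- exact/measurable_EFinP.
- move=> x _; rewrite lee_fin [leRHS]ger0_norm ?addr_ge0 ?sqr_ge0 ?indicE ?ler0n//.
  have [xc|xc] := pselect (cube m x); last by rewrite supp// normr0 memNset// expr0n addr0.
  rewrite mem_set// -(real_normK (num_real (a x))).
  have := normr_ge0 (a x); move: `|a x| => r r0; rewrite -subr_ge0.
  have -> : 1%:R + r ^+ 2 - r = (r - 2^-1) ^+ 2 + 3 / 4 by field.
  by rewrite addr_ge0 ?sqr_ge0.
- under eq_fun do rewrite EFinD.
  by apply: integrableD => //; [exact: integrable_indic_box|exact: integrable_sqr].
Qed.

Lemma integrable_trig (b h : V -> R) : mu.-integrable setT (EFin \o b) ->
  measurable_fun setT h -> (forall x, `|h x| <= 1) ->
  mu.-integrable setT (EFin \o (fun x => b x * h x)).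
Proof.
move=> ib mh h1; apply: (le_integrable measurableT _ _ ib).
- apply/measurable_EFinP; apply: measurable_funM => //.
  by apply/measurable_EFinP; exact: measurable_int ib.
- by move=> x _; rewrite /= lee_fin normrM ler_piMr.
Qed.

Lemma integrable_cos (b : V -> R) xi : mu.-integrable setT (EFin \o b) ->
  mu.-integrable setT (EFin \o (fun x => b x * cos (dotp x xi))).
Proof.
move=> ib; apply: integrable_trig => //; last by move=> x; exact: cos_max.
apply: (measurableT_comp measurable_cos); under eq_fun do rewrite dotpC.
exact: measurable_dotp.
Qed.

Lemma integrable_sin (b : V -> R) xi : mu.-integrable setT (EFin \o b) ->
  mu.-integrable setT (EFin \o (fun x => b x * sin (dotp x xi))).
Proof.
move=> ib; apply: integrable_trig => //; last by move=> x; exact: sin_max.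
apply: (measurableT_comp measurable_sin); under eq_fun do rewrite dotpC.
exact: measurable_dotp.
Qed.

Lemma le_Rintegral_trig (b h : V -> R) : mu.-integrable setT (EFin \o b) ->
  measurable_fun setT h -> (forall x, `|h x| <= 1) ->
  `|\int[mu]_x (b x * h x)| <= \int[mu]_x `|b x|.
Proof.
move=> ib mh h1; have ibh := integrable_trig _ _ ib mh h1.
apply: le_trans (le_normr_Rintegral measurableT ibh) _.
apply: le_Rintegral => //.
- exact: integrable_norm ibh.
- exact: integrable_norm ib.
- by move=> x _; rewrite normrM ler_piMr.
Qed.

Let ia := integrable_L2_cube.
Let Ct := cos_transform a.
Let St := sin_transform a.
Let A := \int[mu]_x `|a x|.

Let Ct_le xi : `|Ct xi| <= A.
Proof.
apply: le_Rintegral_trig => //; last by move=> x; exact: cos_max.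
apply: (measurableT_comp measurable_cos); under eq_fun do rewrite dotpC.
exact: measurable_dotp.
Qed.

Let St_le xi : `|St xi| <= A.
Proof.
apply: le_Rintegral_trig => //; last by move=> x; exact: sin_max.
apply: (measurableT_comp measurable_sin); under eq_fun do rewrite dotpC.
exact: measurable_dotp.
Qed.

(** The real part of the transform of [a] at [xi] multiplied by [expi (dotp y xi)]. Integrated
    against [a y] it gives the energy density, and it is bounded uniformly in [y] and [xi]. *)
Let T y xi := Ct xi * cos (dotp y xi) + St xi * sin (dotp y xi).

Let T_le y xi : `|T y xi| <= 2 * A.
Proof.
rewrite /T (le_trans (ler_normD _ _))// mulr_natl mulr2n lerD// normrM.
  by rewrite (le_trans _ (Ct_le xi))// ler_piMr// cos_max.
by rewrite (le_trans _ (St_le xi))// ler_piMr// sin_max.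
Qed.

Let sqrE xi : Ct xi ^+ 2 + St xi ^+ 2 = \int[mu]_y (a y * T y xi).
Proof.
rewrite (@eq_Rintegral _ _ _ mu setT (fun y => Ct xi * (a y * cos (dotp y xi)) + St xi * (a y * sin (dotp y xi)))); last first.
  by move=> y _; rewrite /T; ring.
have ic := integrable_cos a xi ia; have is_ := integrable_sin a xi ia.
rewrite RintegralD//.
- by rewrite !RintegralZl// !expr2.
- exact: (integrableZl measurableT (Ct xi) ic).
- exact: (integrableZl measurableT (St xi) is_).
Qed.

Let TE y xi : T y xi = \int[mu]_x (a x * cos (dotp (x - y) xi)).
Proof.
rewrite (@eq_Rintegral _ _ _ mu setT (fun x => cos (dotp y xi) * (a x * cos (dotp x xi)) + sin (dotp y xi) * (a x * sin (dotp x xi)))); last first.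
  by move=> x _; rewrite dotpBl cosB; ring.
have ic := integrable_cos a xi ia; have is_ := integrable_sin a xi ia.
rewrite RintegralD//.
- by rewrite !RintegralZl// /T mulrC; congr (_ + _); rewrite mulrC.
- exact: (integrableZl measurableT (cos (dotp y xi)) ic).
- exact: (integrableZl measurableT (sin (dotp y xi)) is_).
Qed.

Lemma EFinM_Rintegral d (X : measurableType d) (m0 : {measure set X -> \bar R}) (f : X -> R) (c : R) :
  m0.-integrable setT (EFin \o f) ->
  ((c * \int[m0]_x f x)%:E = \int[m0]_x (c * f x)%:E)%E.
Proof.
move=> fi; rewrite EFinM /Rintegral fineK; last exact: (integrable_fin_num _ fi).
by rewrite -integralZl.
Qed.

Let measurable_T : measurable_fun [set: V * V] (fun p => T p.2 p.1).
Proof.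
have mc : measurable_fun [set: V * V] (fun p => dotp p.2 p.1).
  by under eq_fun do rewrite dotpC; exact: measurable_dotp2.
apply: measurable_funD; apply: measurable_funM.
- by apply: measurable_comp_fst; exact: measurable_cos_transform.
- exact: (measurableT_comp measurable_cos).
- by apply: measurable_comp_fst; exact: measurable_sin_transform.
- exact: (measurableT_comp measurable_sin).
Qed.

Let A0 : 0 <= A. Proof. by apply: Rintegral_ge0 => x _. Qed.

Let ia2 : mu.-integrable setT (EFin \o (fun x => (2 * A) * `|a x|)).
Proof. exact: (integrableZl measurableT (2 * A) (integrable_norm ia)). Qed.

Let pair_integrable e : 0 < e ->
  mu.-integrable setT (fun x => (a x ^+ 2)%:E) ->
  (mu \x mu)%E.-integrable setT (EFin \o (fun p : V * V => a p.1 ^+ 2 * poissonV e (p.1 - p.2))) /\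
  (mu \x mu)%E.-integrable setT (EFin \o (fun p : V * V => a p.2 ^+ 2 * poissonV e (p.1 - p.2))).
Proof.
move=> e0 isq.
have mf (i : bool) : measurable_fun setT (fun p : V * V => (a (if i then p.1 else p.2) ^+ 2 * poissonV e (p.1 - p.2))%:E).
  apply/measurable_EFinP; apply: measurable_funM; last exact: measurable_poissonV_sub.
  by apply: measurable_funX; case: i; [exact: measurable_comp_fst|exact: measurable_comp_snd].
have fin : (M%:E * \int[mu]_x (a x ^+ 2)%:E < +oo)%E.
  by rewrite lte_mul_pinfty// ?lee_fin ?two_pi_ge0.
have nn x z : 0 <= a x ^+ 2 * poissonV e (z : V).
  by apply: mulr_ge0; [exact: sqr_ge0|exact: poissonV_ge0].
split; apply/integrableP; split.
- exact: (mf true).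
- under eq_integral do rewrite /= (ger0_norm (nn _ _)).
  rewrite (integral_fst_poissonV e (fun x => a x ^+ 2))//; first exact: measurable_funX.
  by move=> x; exact: sqr_ge0.
- exact: (mf false).
- under eq_integral do rewrite /= (ger0_norm (nn _ _)).
  rewrite (integral_snd_poissonV e (fun x => a x ^+ 2))//; first exact: measurable_funX.
  by move=> x; exact: sqr_ge0.
Qed.

Let measurable_q e : 0 < e ->
  measurable_fun setT (fun p : V * V => a p.2 * (a p.1 * poissonV e (p.1 - p.2))).
Proof.
move=> e0; apply: measurable_funM; first exact: measurable_comp_snd.
apply: measurable_funM; [exact: measurable_comp_fst|exact: measurable_poissonV_sub].
Qed.

Let integrable_q e : 0 < e ->
  (mu \x mu)%E.-integrable setT (EFin \o (fun p : V * V => a p.2 * (a p.1 * poissonV e (p.1 - p.2)))).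
Proof.
move=> e0; have [i1 i2] := pair_integrable e e0 integrable_sqr.
have i12 : (mu \x mu)%E.-integrable setT (EFin \o (fun p : V * V =>
    (a p.1 ^+ 2 + a p.2 ^+ 2) * poissonV e (p.1 - p.2))).
  rewrite (_ : (fun p : V * V => _) = fun p =>
    a p.1 ^+ 2 * poissonV e (p.1 - p.2) + a p.2 ^+ 2 * poissonV e (p.1 - p.2)).
    exact: (integrableD measurableT i1 i2).
  by apply/funext => p; rewrite mulrDl.
apply: (le_integrable measurableT _ _ i12).
  by apply/measurable_EFinP; exact: measurable_q.
move=> p _; rewrite lee_fin.
have P0 : 0 <= poissonV e (p.1 - p.2) by exact: poissonV_ge0.
rewrite mulrA !normrM !(ger0_norm P0) [X in _ <= X * _]ger0_norm ?addr_ge0 ?sqr_ge0//.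
apply: ler_wpM2r => //; rewrite -(real_normK (num_real (a p.1))) -(real_normK (num_real (a p.2))).
move: `|a p.1| `|a p.2| (normr_ge0 (a p.1)) (normr_ge0 (a p.2)) => r s r0 s0.
rewrite -subr_ge0; have -> : r ^+ 2 + s ^+ 2 - s * r = 2^-1 * ((r - s) ^+ 2 + r ^+ 2 + s ^+ 2) by field.
by rewrite mulr_ge0 ?invr_ge0// !addr_ge0 ?sqr_ge0.
Qed.

(** The energy density is a double integral over [x] and [y] of [a x * a y * cos (dotp (x - y) xi)].
    The damping makes it legitimate to integrate over [xi] first, and this inner integral is the
    Poisson kernel at [x - y]. *)
Lemma weighted_energy e : 0 < e ->
  (\int[mu]_xi ((Ct xi ^+ 2 + St xi ^+ 2) * expwV e xi)%:E =
   \int[mu \x mu]_p (a p.2 * (a p.1 * poissonV e (p.1 - p.2)))%:E)%E.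
Proof.
move=> e0.
pose G (p : V * V) := expwV e p.1 * (a p.2 * T p.2 p.1).
have mG : measurable_fun setT G.
  apply: measurable_funM; first by apply: measurable_comp_fst; exact: measurable_expwV.
  by apply: measurable_funM => //; exact: measurable_comp_snd.
have iG : (mu \x mu)%E.-integrable setT (EFin \o G).
  apply: (integrable_prod_bound _ _ _ _ mu mu G (expwV e) (fun x => 2 * A * `|a x|)) => //.
    exact: integrable_expwV.
  move=> x y; rewrite /G/= normrM (ger0_norm (expwV_ge0 _ _ _)) ler_wpM2l ?expwV_ge0//.
  by rewrite normrM mulrC ler_wpM2r.
have iaT xi : mu.-integrable setT (EFin \o (fun y => a y * T y xi)).
  apply: (le_integrable measurableT _ _ ia2).
    apply/measurable_EFinP; apply: measurable_funM => //.
    apply: measurable_funD; apply: measurable_funM => //.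
      by apply: (measurableT_comp measurable_cos); under eq_fun do rewrite dotpC; exact: measurable_dotp.
    by apply: (measurableT_comp measurable_sin); under eq_fun do rewrite dotpC; exact: measurable_dotp.
  move=> y _; rewrite lee_fin normrM [leRHS]ger0_norm ?mulr_ge0// mulrC.
  by apply: ler_wpM2r.
transitivity (\int[mu]_xi \int[mu]_y (EFin \o G) (xi, y))%E.
  by apply: eq_integral => xi _; rewrite sqrE mulrC (EFinM_Rintegral _ _ mu).
(* The integral over [xi] moves inside the one over [y]; a second interchange, with [y] fixed, will
   bring it next to the cosine. *)
rewrite (Fubini iG) -(integral21_prod_meas1 (integrable_q e e0)).
apply: eq_integral => y _.
pose K (p : V * V) := a y * (expwV e p.1 * (a p.2 * cos (dotp (p.2 - y) p.1))).
have mK : measurable_fun setT K.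
  apply: measurable_funM => //; apply: measurable_funM; first by apply: measurable_comp_fst; exact: measurable_expwV.
  apply: measurable_funM; first exact: measurable_comp_snd.
  apply: (measurableT_comp measurable_cos); under eq_fun do rewrite dotpBl.
  apply: measurable_funB; first by under eq_fun do rewrite dotpC; exact: measurable_dotp2.
  by apply: measurable_comp_fst; exact: measurable_dotp.
have iK : (mu \x mu)%E.-integrable setT (EFin \o K).
  apply: (integrable_prod_bound _ _ _ _ mu mu K (fun x => `|a y| * expwV e x) (fun x => `|a x|)) => //.
  - exact: (integrableZl measurableT `|a y| (integrable_expwV _ _ e0)).
  - exact: integrable_norm ia.
  - move=> x z; rewrite /K/= !normrM (ger0_norm (expwV_ge0 _ _ _)) -!mulrA.
    by do 2 (apply: ler_wpM2l; rewrite ?expwV_ge0//); rewrite ler_piMr// cos_max.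
transitivity (\int[mu]_xi \int[mu]_x (EFin \o K) (xi, x))%E.
  apply: eq_integral => xi _; rewrite /= /G/= TE.
  have ic : mu.-integrable setT (EFin \o (fun x => a x * cos (dotp (x - y) xi))).
    apply: integrable_trig => //; last by move=> x; exact: cos_max.
    apply: (measurableT_comp measurable_cos); under eq_fun do rewrite dotpBl dotpC.
    by apply: measurable_funB => //; exact: measurable_dotp.
  rewrite mulrCA mulrA (EFinM_Rintegral _ _ mu) //.
  by apply: eq_integral => x _; rewrite /K/=; congr EFin; ring.
rewrite (Fubini iK); apply: eq_integral => x _.
have h := integral_expwV_cos_sin n e (x - y) (a y * a x) 0 e0.
rewrite /= mulrA -h; apply: eq_integral => xi _; rewrite /K/=; congr EFin; ring.
Qed.

Let N := fine (\int[mu]_x (a x ^+ 2)%:E)%E.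

Let NE : (\int[mu]_x (a x ^+ 2)%:E = N%:E)%E.
Proof. by rewrite fineK//; exact: (integrable_fin_num _ integrable_sqr). Qed.

(** Polarisation: [2 a(x) a(y) = a(x)^2 + a(y)^2 - (a(x) - a(y))^2], and each square has integral
    [M * N] against the kernel. The damped energy thus falls short of [M * N] by half of
    [pform e a]. *)
Lemma energy_identity e : 0 < e ->
  (2%:E * \int[mu]_xi ((Ct xi ^+ 2 + St xi ^+ 2) * expwV e xi)%:E + pform e a = (2 * (M * N))%:E)%E.
Proof.
move=> e0; rewrite weighted_energy//.
have [i1 i2] := pair_integrable e e0 integrable_sqr.
have iq := integrable_q e e0.
have iD : (mu \x mu)%E.-integrable setT (fun p : V * V => ((a p.1 - a p.2) ^+ 2 * poissonV e (p.1 - p.2))%:E).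
  rewrite (_ : (fun p : V * V => _) = EFin \o (fun p : V * V =>
    (a p.1 ^+ 2 * poissonV e (p.1 - p.2) + a p.2 ^+ 2 * poissonV e (p.1 - p.2))
    - 2 * (a p.2 * (a p.1 * poissonV e (p.1 - p.2))))); last first.
    by apply/funext => p /=; congr EFin; ring.
  exact: (integrableB measurableT (integrableD measurableT i1 i2) (integrableZl measurableT 2 iq)).
rewrite -integralZl// /pform -integralD//; last exact: (integrableZl measurableT 2 iq).
transitivity (\int[mu \x mu]_p (a p.1 ^+ 2 * poissonV e (p.1 - p.2))%:E +
    \int[mu \x mu]_p (a p.2 ^+ 2 * poissonV e (p.1 - p.2))%:E)%E.
  rewrite -integralD//; apply: eq_integral => p _.
  by rewrite -EFinM -!EFinD; congr EFin; ring.
have ma2 : measurable_fun setT (fun x => a x ^+ 2) by exact: measurable_funX.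
have a20 x : 0 <= a x ^+ 2 by exact: sqr_ge0.
rewrite (integral_fst_poissonV e (fun x => a x ^+ 2))//.
rewrite (integral_snd_poissonV e (fun x => a x ^+ 2))//.
by rewrite NE -EFinM -EFinD; congr EFin; ring.
Qed.

Let J xi := Ct xi ^+ 2 + St xi ^+ 2.
Let E k := (\int[mu]_xi (J xi * expwV (scale k) xi)%:E)%E.

Let J0 xi : 0 <= J xi. Proof. by rewrite addr_ge0 ?sqr_ge0. Qed.

Let mJ : measurable_fun setT J.
Proof.
by apply: measurable_funD; apply: measurable_funX; [exact: measurable_cos_transform|exact: measurable_sin_transform].
Qed.

Let mJW k : measurable_fun setT (fun xi => (J xi * expwV (scale k) xi)%:E).
Proof. by apply/measurable_EFinP; apply: measurable_funM => //; exact: measurable_expwV. Qed.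

Let JW0 k xi : (0 <= (J xi * expwV (scale k) xi)%:E)%E.
Proof. by rewrite lee_fin mulr_ge0 ?expwV_ge0. Qed.

Lemma expw_le1 e x : 0 < e -> expw e x <= 1 :> R.
Proof. by move=> e0; rewrite /expw -[leRHS]expR0 ler_expR mulNr oppr_le0 mulr_ge0// ltW. Qed.

Lemma cvg_expwV (xi : V) : expwV (scale k) xi @[k --> \oo] --> (1 : R).
Proof.
rewrite [X in _ --> X](_ : 1 = \prod_(i < n) 1); last by rewrite big1.
apply: (cvg_prodr _ _ (fun i k => expw (scale k) (xi ord0 i))) => i.
rewrite /expw -expR0; apply: continuous_cvg; first exact: continuous_expR.
rewrite -[X in _ --> X](mul0r `|xi ord0 i|); apply: cvgM; last exact: cvg_cst.
by rewrite -oppr0; apply: cvgN; exact: (@cvg_harmonic R).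
Qed.

Lemma nd_expwV (xi : V) : nondecreasing_seq (fun k => expwV (scale k) xi).
Proof.
move=> i j ij; apply: ler_prod => l _; rewrite expw_ge0/=.
rewrite /expw ler_expR !mulNr lerN2 ler_wpM2r// /scale lef_pV2 ?posrE//.
by rewrite ler_nat.
Qed.

(** For the upper bound, [pform] is nonnegative and the damped energies increase to the full one.
    For the lower bound, [vanishing_L2] provides a damping whose [pform] is at most [eps]. *)
Lemma real_plancherel :
  (\int[mu]_xi (cos_transform a xi ^+ 2 + sin_transform a xi ^+ 2)%:E =
   M%:E * \int[mu]_x (a x ^+ 2)%:E)%E.
Proof.
rewrite NE -EFinM -/J.
have E0 k : (0 <= E k)%E by exact: integral_ge0.
have EN k : (E k <= (M * N)%:E)%E.
  have := energy_identity (scale k) (scale_gt0 k).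
  rewrite -/(E k) EFinM => h.
  by rewrite -(@lee_pmul2l _ 2%:E)// -h leeDl// pform_ge0// scale_gt0.
have limE : (\int[mu]_xi limn (fun k => (J xi * expwV (scale k) xi)%:E) = \int[mu]_xi (J xi)%:E)%E.
  apply: eq_integral => xi _; apply/cvg_lim => //; apply: cvg_EFin; first exact: nearW.
  rewrite -[X in _ --> X](mulr1 (J xi)); apply: cvgM; first exact: cvg_cst.
  exact: cvg_expwV.
have ndE xi : nondecreasing_seq (fun k => (J xi * expwV (scale k) xi)%:E).
  by move=> i j ij; rewrite lee_fin ler_wpM2l//; exact: nd_expwV.
have cvgE : E k @[k --> \oo] --> (\int[mu]_xi (J xi)%:E)%E.
  rewrite -limE; apply: (@cvg_monotone_convergence _ _ _ mu _ measurableT (fun k xi => (J xi * expwV (scale k) xi)%:E)) => //.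
have leJ : (\int[mu]_xi (J xi)%:E <= (M * N)%:E)%E.
  by rewrite -(cvg_lim _ cvgE)//; apply: lime_le; [apply/cvg_ex; eexists; exact: cvgE|exact: nearW].
apply/eqP; rewrite eq_le leJ/=.
apply/lee_addgt0Pr => eps eps0.
have [_ va] := vanishing_L2 m a ma supp L2a.
have [k] : exists k, (pform (scale k) a <= eps%:E)%E.
  by case: (va eps eps0) => k _ /(_ k (leqnn k)); exists k.
move=> pk; have EJ : (E k <= \int[mu]_xi (J xi)%:E)%E.
  apply: ge0_le_integral => //; first exact/measurable_EFinP.
  move=> xi _; rewrite lee_fin ler_piMr//; apply: prodr_ile1 => i.
  by rewrite expw_ge0 expw_le1 ?scale_gt0.
apply: (@le_trans _ _ (E k + eps%:E)%E); last by rewrite leeD2r.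
have := energy_identity (scale k) (scale_gt0 k); rewrite -/(E k) => h.
rewrite -(@lee_pmul2l _ 2%:E)// -EFinM -h.
have -> : (2%:E * (E k + eps%:E) = 2%:E * E k + 2%:E * eps%:E)%E.
  by apply: ge0_muleDr; [exact: E0|rewrite lee_fin ltW].
apply: leeD => //; apply: le_trans pk _; rewrite -EFinM lee_fin ler_peMl ?ltW ?ltr1n//.
Qed.
End real_plancherel.

(** * Squared moduli and squared L^2 norms *)

Section energy.
Context {R : realType} {n : nat}.
Local Open Scope complex_scope.
Local Notation mu := (@lebesgue_rV R n).
Local Notation V := 'rV[R]_n.
Local Notation Re := complex.Re.
Local Notation Im := complex.Im.
Local Notation normc := ComplexField.Normc.normc.
Implicit Types (f g F : V -> R[i]) (z w : R[i]).

Definition csq z : R := Re z ^+ 2 + Im z ^+ 2.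

Lemma csq_ge0 z : 0 <= csq z.
Proof. by rewrite addr_ge0 ?sqr_ge0. Qed.

Lemma normc_sqr z : normc z ^+ 2 = csq z.
Proof. by case: z => a b; rewrite /= sqr_sqrtr ?addr_ge0 ?sqr_ge0. Qed.

Lemma csqM z w : csq (z * w) = csq z * csq w.
Proof. by rewrite -!normc_sqr ComplexField.Normc.normcM exprMn. Qed.

Lemma csqB_le z w : csq (z - w) <= 2 * csq z + 2 * csq w.
Proof.
case: z w => a b [c d]; rewrite /csq /= !mulrDr addrACA.
by apply: lerD; exact: sqrB_le.
Qed.

Lemma csqD_le z w : csq (z + w) <= 2 * csq z + 2 * csq w.
Proof.
case: z w => a b [c d]; rewrite /csq /= !mulrDr addrACA.
by apply: lerD; exact: sqrD_le.
Qed.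

Lemma csqR (r : R) : csq r%:C = r ^+ 2.
Proof. by rewrite /csq /= expr0n addr0. Qed.

Lemma csq_expi (t : R) : csq (expi t) = 1.
Proof. by rewrite /csq /= cos2Dsin2. Qed.

Lemma csq_expi_sub1 (t : R) : csq (expi t - 1) = 2 - 2 * cos t.
Proof.
rewrite /csq /= subr0.
have -> : (cos t - 1) ^+ 2 + sin t ^+ 2 = (cos t ^+ 2 + sin t ^+ 2) + 1 - 2 * cos t by ring.
by rewrite cos2Dsin2; ring.
Qed.

Lemma expiD (s t : R) : expi (s + t) = expi s * expi t.
Proof. by rewrite /expi cosD sinD /GRing.mul /= [_ * sin t + _]addrC. Qed.

Lemma ReM z w : Re (z * w) = Re z * Re w - Im z * Im w.
Proof. by case: z => a b; case: w. Qed.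

Lemma ImM z w : Im (z * w) = Re z * Im w + Im z * Re w.
Proof. by case: z => a b; case: w. Qed.

Lemma ReB z w : Re (z - w) = Re z - Re w.
Proof. by case: z => a b; case: w. Qed.

Lemma ImB z w : Im (z - w) = Im z - Im w.
Proof. by case: z => a b; case: w. Qed.

Lemma cmeasurableB f g : cmeasurable f -> cmeasurable g -> cmeasurable (fun x => f x - g x).
Proof.
move=> [f1 f2] [g1 g2]; split; [under eq_fun do rewrite ReB|under eq_fun do rewrite ImB];
  exact: measurable_funB.
Qed.

Lemma cmeasurableM f g : cmeasurable f -> cmeasurable g -> cmeasurable (fun x => f x * g x).
Proof.
move=> [f1 f2] [g1 g2]; split; [under eq_fun do rewrite ReM|under eq_fun do rewrite ImM].
  by apply: measurable_funB; exact: measurable_funM.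
by apply: measurable_funD; exact: measurable_funM.
Qed.

Lemma cmeasurable_shift f h : cmeasurable f -> cmeasurable (fun x => f (x + h)).
Proof.
by move=> [f1 f2]; split; [apply: (measurableT_comp f1)|apply: (measurableT_comp f2)];
  exact: measurable_rV_shift.
Qed.

Lemma cmeasurable_expi (r : V -> R) : measurable_fun setT r -> cmeasurable (fun x => expi (r x)).
Proof.
by move=> mr; split; [apply: (measurableT_comp measurable_cos)|apply: (measurableT_comp measurable_sin)].
Qed.

Lemma measurable_csq f : cmeasurable f -> measurable_fun setT (fun x => csq (f x)).
Proof. by move=> [f1 f2]; apply: measurable_funD; exact: measurable_funX. Qed.

Definition energy f : \bar R := (\int[mu]_x (csq (f x))%:E)%E.

Lemma energy_ge0 f : (0 <= energy f)%E.
Proof. by apply: integral_ge0 => x _; rewrite lee_fin csq_ge0. Qed.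

Lemma measurable_csqE f : cmeasurable f -> measurable_fun setT (fun x => (csq (f x))%:E).
Proof. by move=> mf; apply/measurable_EFinP; exact: measurable_csq. Qed.

(** Plays the role of the triangle inequality for squared norms; the pointwise hypothesis is met by
    [csqD_le] or [csqB_le]. *)
Lemma energy_le2 f g h : cmeasurable f -> cmeasurable g -> cmeasurable h ->
  (forall x, csq (h x) <= 2 * csq (f x) + 2 * csq (g x)) ->
  (energy h <= 2%:E * energy f + 2%:E * energy g)%E.
Proof.
move=> mf mg mh hfg; rewrite /energy.
have c0 (k : V -> R[i]) x : setT x -> (0 <= (csq (k x))%:E)%E by rewrite lee_fin csq_ge0.
have m2 (k : V -> R[i]) : cmeasurable k -> measurable_fun setT (fun x => 2%:E * (csq (k x))%:E)%E.
  by move=> mk; apply: measurable_funeM; exact: measurable_csqE.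
rewrite -!ge0_integralZl//; try exact: measurable_csqE; try exact: c0.
rewrite -ge0_integralD//; try exact: m2; try by move=> x _; rewrite mule_ge0// lee_fin csq_ge0.
apply: ge0_le_integral => //; try exact: c0; try exact: measurable_csqE.
  by apply: emeasurable_funD; exact: m2.
by move=> x _; rewrite -!EFinM -EFinD lee_fin.
Qed.

Lemma energy_shift f h : cmeasurable f -> energy (fun x => f (x + h)) = energy f.
Proof.
move=> mf; rewrite /energy (ge0_integral_rV_shift n h (fun x => (csq (f x))%:E))//.
  exact: measurable_csqE.
by move=> x; rewrite lee_fin csq_ge0.
Qed.

Lemma L2normE f : L2norm f = (energy f `^ 2^-1)%E.
Proof.
rewrite /L2norm /energy unlock; congr (_ `^ _)%E; apply: eq_integral => x _.
rewrite gee0_abs ?poweR_EFin ?powR_mulrn ?normc_sqr// ?lee_fin.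
  by case: (f x) => a b /=; exact: sqrtr_ge0.
by case: (f x) => a b /=; exact: sqrtr_ge0.
Qed.

Lemma energy_le_L2norm f (d : R) : 0 <= d -> (L2norm f <= d%:E)%E -> (energy f <= (d ^+ 2)%:E)%E.
Proof.
move=> d0; rewrite L2normE; have := energy_ge0 f; case: (energy f) => [r|//|//].
  rewrite lee_fin => r0; rewrite poweR_EFin powR12_sqrt// !lee_fin => h.
  by rewrite -[leLHS](sqr_sqrtr r0) ler_sqr ?nnegrE ?sqrtr_ge0.
by rewrite poweRyr ?invr_neq0.
Qed.

Lemma L2norm_fin_energy f : (L2norm f < +oo)%E -> (energy f < +oo)%E.
Proof. by rewrite L2normE; apply: lty_poweRy; rewrite invr_neq0. Qed.

Lemma energy_cvg0 (h : nat -> V -> R[i]) : L2norm (h k) @[k --> \oo] --> 0%E ->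
  forall eps : R, 0 < eps -> \forall k \near \oo, (energy (h k) <= eps%:E)%E.
Proof.
move=> /fine_cvgP[fin /cvgrPdist_le cvg] eps eps0.
have d0 : 0 < Num.sqrt eps by rewrite sqrtr_gt0.
near=> k.
rewrite -[eps](sqr_sqrtr (ltW eps0)); apply: energy_le_L2norm; first exact: ltW.
have fk : L2norm (h k) \is a fin_num by near: k.
rewrite -(fineK fk) lee_fin; apply: le_trans (ler_norm _) _.
by rewrite -normrN -sub0r; near: k; exact: cvg.
Unshelve. all: by end_near. Qed.
End energy.

(** * The L^2 Fourier transform *)

Section fourier_plancherel.
Context {R : realType} {n : nat}.
Local Open Scope complex_scope.
Local Notation mu := (@lebesgue_rV R n).
Local Notation V := 'rV[R]_n.
Local Notation Re := complex.Re.
Local Notation Im := complex.Im.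
Local Notation M := ((2 * pi) ^+ n : R).
Implicit Types (f g F : V -> R[i]) (r : R).

Definition eball r : set V := [set x | enorm x <= r].

Lemma enorm_ge0 (x : V) : 0 <= enorm x.
Proof. exact: sqrtr_ge0. Qed.

Lemma coord_le_enorm (x : V) i : `|x ord0 i| <= enorm x.
Proof.
rewrite -sqrtr_sqr ler_sqrt; last by apply: sumr_ge0 => j _; exact: sqr_ge0.
by rewrite (bigD1 i)//= lerDl sumr_ge0// => j _; exact: sqr_ge0.
Qed.

Lemma measurable_enorm : measurable_fun setT (@enorm R n).
Proof.
have ms : measurable_fun [set: R] (@Num.sqrt R).
  by apply: continuous_measurable_fun; exact: sqrt_continuous.
apply: (measurableT_comp ms); apply: measurable_sum => i.
by apply: measurable_funX; exact: measurable_coord.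
Qed.

Lemma measurable_eball r : measurable (eball r).
Proof.
rewrite /eball -[X in measurable X]setTI.
have := measurable_enorm measurableT `]-oo, r]%classic (measurable_itv _).
by congr (measurable (_ `&` _)); apply/seteqP; split => x /=; rewrite in_itv.
Qed.

(** The margin 1 is there because the cube is open. *)
Lemma eball_cube r x : eball r x -> cube (r + 1) x.
Proof.
move=> xr i; have := le_trans (coord_le_enorm x i) xr.
by rewrite ler_norml => /andP[h1 h2]; apply/andP; split; lra.
Qed.

(** The cut-off is a factor and not a domain of integration: the result is a function on the whole
    space, supported in a cube, to which Plancherel's identity for real functions applies. *)
Definition Re_cut r f (x : V) : R := \1_(eball r) x * Re (f x).
Definition Im_cut r f (x : V) : R := \1_(eball r) x * Im (f x).

Section cut.
Variables (r : R) (f : V -> R[i]).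
Hypothesis mf : cmeasurable f.
Hypothesis ef : (energy f < +oo)%E.

Lemma measurable_Re_cut : measurable_fun setT (Re_cut r f).
Proof.
by apply: measurable_funM; [exact: measurable_indic (measurable_eball r)|exact: mf.1].
Qed.

Lemma measurable_Im_cut : measurable_fun setT (Im_cut r f).
Proof.
by apply: measurable_funM; [exact: measurable_indic (measurable_eball r)|exact: mf.2].
Qed.

Lemma Re_cut_supp x : ~ cube (r + 1) x -> Re_cut r f x = 0.
Proof.
by move=> nx; rewrite /Re_cut indicE memNset ?mul0r// => /eball_cube.
Qed.

Lemma Im_cut_supp x : ~ cube (r + 1) x -> Im_cut r f x = 0.
Proof.
by move=> nx; rewrite /Im_cut indicE memNset ?mul0r// => /eball_cube.
Qed.

Lemma cut_sqr_le x : Re_cut r f x ^+ 2 <= csq (f x) /\ Im_cut r f x ^+ 2 <= csq (f x).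
Proof.
rewrite /Re_cut /Im_cut indicE; case: (x \in eball r); rewrite ?mul1r ?mul0r ?expr0n/=.
  by rewrite /csq lerDl lerDr !sqr_ge0.
by rewrite csq_ge0.
Qed.

Lemma Re_cut_L2 : (\int[mu]_x (Re_cut r f x ^+ 2)%:E < +oo)%E.
Proof.
apply: le_lt_trans ef; apply: ge0_le_integral => //.
- by move=> x _; rewrite lee_fin sqr_ge0.
- by apply/measurable_EFinP; apply: measurable_funX; exact: measurable_Re_cut.
- exact: measurable_csqE.
- by move=> x _; rewrite lee_fin (cut_sqr_le x).1.
Qed.

Lemma Im_cut_L2 : (\int[mu]_x (Im_cut r f x ^+ 2)%:E < +oo)%E.
Proof.
apply: le_lt_trans ef; apply: ge0_le_integral => //.
- by move=> x _; rewrite lee_fin sqr_ge0.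
- by apply/measurable_EFinP; apply: measurable_funX; exact: measurable_Im_cut.
- exact: measurable_csqE.
- by move=> x _; rewrite lee_fin (cut_sqr_le x).2.
Qed.

Lemma integrable_Re_cut : mu.-integrable setT (EFin \o Re_cut r f).
Proof. exact: (integrable_L2_cube (r + 1) _ measurable_Re_cut Re_cut_supp Re_cut_L2). Qed.

Lemma integrable_Im_cut : mu.-integrable setT (EFin \o Im_cut r f).
Proof. exact: (integrable_L2_cube (r + 1) _ measurable_Im_cut Im_cut_supp Im_cut_L2). Qed.

Local Notation c := (Num.sqrt (2 * pi) ^- n : R).

Lemma Re_fourier_trunc xi :
  Re (fourier_trunc r f xi) = c * (cos_transform (Re_cut r f) xi + sin_transform (Im_cut r f) xi).
Proof.
rewrite /fourier_trunc ReM /= mul0r subr0; congr (_ * _).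
rewrite /cos_transform /sin_transform -RintegralD//; last 2 first.
- by apply: integrable_cos; exact: integrable_Re_cut.
- by apply: integrable_sin; exact: integrable_Im_cut.
rewrite [LHS]Rintegral_mkcond; apply: eq_Rintegral => x _.
rewrite patchE /Re_cut /Im_cut indicE -/(eball r) ReM /= cosN sinN.
by case: (x \in eball r); rewrite /= ?mul0r ?addr0//; ring.
Qed.

Lemma Im_fourier_trunc xi :
  Im (fourier_trunc r f xi) = c * (cos_transform (Im_cut r f) xi - sin_transform (Re_cut r f) xi).
Proof.
rewrite /fourier_trunc ImM /= mul0r addr0; congr (_ * _).
rewrite /cos_transform /sin_transform -RintegralB//; last 2 first.
- by apply: integrable_cos; exact: integrable_Im_cut.
- by apply: integrable_sin; exact: integrable_Re_cut.
rewrite [LHS]Rintegral_mkcond; apply: eq_Rintegral => x _.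
rewrite patchE /Re_cut /Im_cut indicE -/(eball r) ImM /= cosN sinN.
by case: (x \in eball r); rewrite /= ?mul0r ?subr0//; ring.
Qed.

Lemma cmeasurable_fourier_trunc : cmeasurable (fourier_trunc r f).
Proof.
have ma := measurable_Re_cut; have mb := measurable_Im_cut.
split.
  under eq_fun do rewrite Re_fourier_trunc.
  apply: measurable_funM => //; apply: measurable_funD.
    exact: measurable_cos_transform.
  exact: measurable_sin_transform.
under eq_fun do rewrite Im_fourier_trunc.
apply: measurable_funM => //; apply: measurable_funB.
  exact: measurable_cos_transform.
exact: measurable_sin_transform.
Qed.

(* Adding the value at [- xi] cancels the cross terms between the transforms
   of the real and imaginary parts of [f]. *)
Lemma csq_fourier_trunc_sym xi :
  csq (fourier_trunc r f xi) + csq (fourier_trunc r f (- xi)) =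
  2 * M^-1 * ((cos_transform (Re_cut r f) xi ^+ 2 + sin_transform (Re_cut r f) xi ^+ 2)
     + (cos_transform (Im_cut r f) xi ^+ 2 + sin_transform (Im_cut r f) xi ^+ 2)).
Proof.
have cosE b : cos_transform b (- xi) = cos_transform b xi.
  by apply: eq_Rintegral => x _; rewrite dotpNr cosN.
have sinE b : mu.-integrable setT (EFin \o b) -> sin_transform b (- xi) = - sin_transform b xi.
  move=> ib; rewrite -mulN1r /sin_transform -RintegralZl//; last exact: integrable_sin.
  by apply: eq_Rintegral => x _; rewrite dotpNr sinN mulrN mulN1r.
have cM : M^-1 = c ^+ 2.
  by rewrite exprVn -exprM mulnC exprM sqr_sqrtr// mulr_ge0// pi_ge0.
rewrite /csq !Re_fourier_trunc !Im_fourier_trunc !cosE !sinE.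
- by rewrite cM; ring.
- exact: integrable_Re_cut.
- exact: integrable_Im_cut.
Qed.

(** Plancherel's identity holds for [Re_cut] and [Im_cut] separately, and their cross terms
    disappear once the energy is symmetrised. Hence the detour through twice the energy, with one
    copy reflected. *)
Lemma energy_fourier_trunc :
  (energy (fourier_trunc r f) = \int[mu]_x (\1_(eball r) x * csq (f x))%:E)%E.
Proof.
have mt := measurable_csqE _ cmeasurable_fourier_trunc.
have M0 : 0 < M by rewrite exprn_gt0// mulr_gt0// pi_gt0.
have h1 : (energy (fourier_trunc r f) + energy (fourier_trunc r f) =
    2%:E * \int[mu]_x (\1_(eball r) x * csq (f x))%:E)%E.
  rewrite /energy -[X in (_ + X)%E](ge0_integral_rV_opp n (fun x => (csq (fourier_trunc r f x))%:E))//; last first.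
    by move=> x; rewrite lee_fin csq_ge0.
  rewrite -ge0_integralD//; last 3 first.
  - by move=> x _; rewrite lee_fin csq_ge0.
  - by move=> x _; rewrite lee_fin csq_ge0.
  - by apply: (measurableT_comp mt); exact: measurable_rV_opp.
  under eq_integral do rewrite -EFinD csq_fourier_trunc_sym EFinM EFinD.
  have mC b : measurable_fun setT b -> measurable_fun setT (fun xi : V => (cos_transform b xi ^+ 2 + sin_transform b xi ^+ 2)%:E).
    move=> mb; apply/measurable_EFinP; apply: measurable_funD; apply: measurable_funX.
      exact: measurable_cos_transform.
    exact: measurable_sin_transform.
  have nn b (xi : V) : setT xi -> (0 <= (cos_transform b xi ^+ 2 + sin_transform b xi ^+ 2)%:E)%E.
    by rewrite lee_fin addr_ge0 ?sqr_ge0.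
  have ma := measurable_Re_cut; have mb := measurable_Im_cut.
  rewrite ge0_integralZl//; last 3 first.
  - by apply: emeasurable_funD; exact: mC.
  - by move=> x Tx; rewrite adde_ge0// nn.
  - by rewrite lee_fin mulr_ge0// invr_ge0 ltW.
  rewrite ge0_integralD//; [|exact: nn|exact: mC|exact: nn|exact: mC].
  rewrite (real_plancherel (r + 1) _ ma Re_cut_supp Re_cut_L2).
  rewrite (real_plancherel (r + 1) _ mb Im_cut_supp Im_cut_L2).
  rewrite -ge0_muleDr; last 2 first.
  - by apply: integral_ge0 => x _; rewrite lee_fin sqr_ge0.
  - by apply: integral_ge0 => x _; rewrite lee_fin sqr_ge0.
  rewrite muleA -EFinM -mulrA mulVf ?gt_eqF// mulr1; congr (_ * _)%E.
  rewrite -ge0_integralD//.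
  - apply: eq_integral => x _; rewrite -EFinD /Re_cut /Im_cut indicE /csq; congr EFin.
    by case: (x \in eball r); rewrite ?mul1r ?mul0r// expr0n addr0.
  - by move=> x _; rewrite lee_fin sqr_ge0.
  - by apply/measurable_EFinP; exact: measurable_funX.
  - by move=> x _; rewrite lee_fin sqr_ge0.
  - by apply/measurable_EFinP; exact: measurable_funX.
move: h1; rewrite -mule2n -mule_natl => h1.
by apply/eqP; rewrite eq_le; apply/andP; split; rewrite -(@lee_pmul2l _ 2%:E)// h1.
Qed.
End cut.

Lemma fourier_truncB r f g xi : cmeasurable f -> (energy f < +oo)%E ->
  cmeasurable g -> (energy g < +oo)%E -> cmeasurable (fun x => f x - g x) ->
  (energy (fun x => f x - g x)%R < +oo)%E ->
  fourier_trunc r (fun x => f x - g x) xi = fourier_trunc r f xi - fourier_trunc r g xi.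
Proof.
move=> mf ef mg eg mfg efg.
have Re0 : Re_cut r (fun x => f x - g x) = fun x => Re_cut r f x - Re_cut r g x.
  by apply/funext => x; rewrite /Re_cut ReB mulrBr.
have Im0 : Im_cut r (fun x => f x - g x) = fun x => Im_cut r f x - Im_cut r g x.
  by apply/funext => x; rewrite /Im_cut ImB mulrBr.
have cB a b : mu.-integrable setT (EFin \o a) -> mu.-integrable setT (EFin \o b) ->
    cos_transform (fun x => a x - b x) xi = cos_transform a xi - cos_transform b xi.
  move=> ia ib; rewrite /cos_transform -RintegralB//; [|exact: integrable_cos|exact: integrable_cos].
  by apply: eq_Rintegral => x _; rewrite mulrBl.
have sB a b : mu.-integrable setT (EFin \o a) -> mu.-integrable setT (EFin \o b) ->
    sin_transform (fun x => a x - b x) xi = sin_transform a xi - sin_transform b xi.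
  move=> ia ib; rewrite /sin_transform -RintegralB//; [|exact: integrable_sin|exact: integrable_sin].
  by apply: eq_Rintegral => x _; rewrite mulrBl.
have iRf := integrable_Re_cut r f mf ef; have iRg := integrable_Re_cut r g mg eg.
have iIf := integrable_Im_cut r f mf ef; have iIg := integrable_Im_cut r g mg eg.
apply/eqP; rewrite eq_complex; apply/andP; split; apply/eqP.
  rewrite ReB !Re_fourier_trunc// Re0 Im0 cB// sB//; ring.
rewrite ImB !Im_fourier_trunc// Re0 Im0 cB// sB//; ring.
Qed.

(** The truncation is in [x], where modulation is a multiplication; the exchange with a translation
    in frequency is therefore exact before any limit. *)
Lemma fourier_trunc_modulate r f h xi :
  fourier_trunc r (fun x => expi (- dotp x h) * f x) xi = fourier_trunc r f (xi + h).
Proof.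
rewrite /fourier_trunc; congr (_ * cintegral _ _); apply/funext => x.
by rewrite mulrA -expiD dotpDr opprD.
Qed.

(* [is_fourier] with the convergence expressed by [energy], hence stable under
   differences without the triangle inequality in L^2. *)
Definition fourier_pair f F := [/\ cmeasurable f, (energy f < +oo)%E, cmeasurable F &
  forall eps : R, 0 < eps ->
    \forall k \near \oo, (energy (fun xi => F xi - fourier_trunc k%:R f xi)%R <= eps%:E)%E].

Lemma is_fourier_pair f F : is_fourier f F -> fourier_pair f F.
Proof.
move=> [[mf ef] [mF _] cvgF]; split => //; first exact: L2norm_fin_energy.
exact: energy_cvg0.
Qed.

(* The factor 2, absent from Plancherel's identity, comes from [csqD_le] and is
   harmless. *)
Lemma fourier_pair_energy_le f F : fourier_pair f F -> (energy F <= 2%:E * energy f)%E.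
Proof.
move=> [mf ef mF cvgF]; apply/lee_addgt0Pr => eps eps0.
have eps2 : 0 < eps / 2 by rewrite divr_gt0.
have [k _ /(_ k (leqnn k)) hk] := cvgF _ eps2.
have mt := cmeasurable_fourier_trunc k%:R f mf ef.
have := energy_le2 (fourier_trunc k%:R f) (fun xi => F xi - fourier_trunc k%:R f xi) F mt (cmeasurableB _ _ mF mt) mF.
move=> /(_ _)/le_trans; apply.
  move=> x; rewrite -[F x in leLHS](subrK (fourier_trunc k%:R f x)) addrC.
  exact: csqD_le.
have -> : eps%:E = (2%:E * (eps / 2)%:E)%E by rewrite -EFinM; congr EFin; field.
apply: leeD; rewrite lee_pmul2l//.
rewrite energy_fourier_trunc//; apply: ge0_le_integral => //.
- by move=> x _; rewrite lee_fin mulr_ge0 ?csq_ge0// indicE.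
- apply/measurable_EFinP; apply: measurable_funM; last exact: measurable_csq.
  exact: measurable_indic (measurable_eball _).
- exact: measurable_csqE.
- move=> x _; rewrite lee_fin indicE; case: (x \in _); rewrite ?mul1r ?mul0r ?csq_ge0//.
Qed.

(** The energy of [f] on the ball of radius [k] increases to its full energy. By Plancherel for the
    cut-off function it is the energy of the truncated transform, which is close to [F] for large
    [k]. *)
Lemma fourier_pair_energy_ge f F : fourier_pair f F -> (energy f <= 2%:E * energy F)%E.
Proof.
move=> [mf ef mF cvgF].
pose h k x : \bar R := (\1_(eball k%:R) x * csq (f x))%:E.
have mh k : measurable_fun setT (h k).
  apply/measurable_EFinP; apply: measurable_funM; last exact: measurable_csq.
  exact: measurable_indic (measurable_eball _).
have h0 k x : (0 <= h k x)%E by rewrite lee_fin mulr_ge0 ?csq_ge0// indicE.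
have ndh x : nondecreasing_seq (h ^~ x).
  move=> i j ij; rewrite lee_fin ler_wpM2r ?csq_ge0// !indicE ler_nat.
  have [xi|xi] := pselect (eball i%:R x); last by rewrite memNset.
  by rewrite !mem_set//; apply: le_trans xi _; rewrite ler_nat.
have limh x : limn (h ^~ x) = (csq (f x))%:E.
  apply/cvg_lim => //; apply: cvg_near_cst.
  near=> k; rewrite /h indicE mem_set ?mul1r//= /eball/=; near: k.
  by move/cvgryPge : (@cvgr_idn R); exact.
have cvgE : (\int[mu]_x h k x)%E @[k --> \oo] --> energy f.
  rewrite /energy; under eq_integral do rewrite -limh.
  exact: cvg_monotone_convergence.
apply/lee_addgt0Pr => eps eps0.
have eps2 : 0 < eps / 2 by rewrite divr_gt0.
rewrite -(cvg_lim _ cvgE)//; apply: lime_le; first by apply/cvg_ex; eexists; exact: cvgE.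
near=> k.
have hk : (energy (fun xi => F xi - fourier_trunc k%:R f xi)%R <= (eps / 2)%:E)%E by near: k; exact: cvgF.
rewrite -/(\int[mu]_x (\1_(eball k%:R) x * csq (f x))%:E)%E -energy_fourier_trunc//.
have mt := cmeasurable_fourier_trunc k%:R f mf ef.
have := energy_le2 F (fun xi => F xi - fourier_trunc k%:R f xi) (fourier_trunc k%:R f) mF (cmeasurableB _ _ mF mt) mt.
move=> /(_ _)/le_trans; apply.
  move=> x; rewrite [X in csq X <= _](_ : _ = F x - (F x - fourier_trunc k%:R f x)); first exact: csqB_le.
  by rewrite opprB addrC subrK.
have -> : eps%:E = (2%:E * (eps / 2)%:E)%E by rewrite -EFinM; congr EFin; field.
by apply: leeD; rewrite lee_pmul2l.
Unshelve. all: by end_near. Qed.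

Lemma energy_modulate f h : energy (fun x => expi (- dotp x h) * f x) = energy f.
Proof. by apply: eq_integral => x _; rewrite csqM csq_expi mul1r. Qed.

Lemma fourier_pair_difference f F h : fourier_pair f F ->
  fourier_pair (fun x => expi (- dotp x h) * f x - f x) (fun xi => F (xi + h) - F xi).
Proof.
move=> [mf ef mF cvgF].
have me : cmeasurable (fun x => expi (- dotp x h) * f x).
  apply: cmeasurableM => //; apply: cmeasurable_expi; apply: measurable_funN.
  by under eq_fun do rewrite dotpC; exact: measurable_dotp.
have ee : (energy (fun x => expi (- dotp x h) * f x)%R < +oo)%E by rewrite energy_modulate.
have md := cmeasurableB _ _ me mf.
have ed : (energy (fun x => expi (- dotp x h) * f x - f x)%R < +oo)%E.
  apply: le_lt_trans (energy_le2 _ _ _ me mf md (fun x => csqB_le _ _)) _.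
  by rewrite energy_modulate lte_add_pinfty// lte_mul_pinfty.
split; [exact: md|exact: ed|exact: (cmeasurableB _ _ (cmeasurable_shift _ h mF) mF)|].
move=> eps eps0; have eps4 : 0 < eps / 4 by rewrite divr_gt0.
near=> k.
have mt := cmeasurable_fourier_trunc k%:R f mf ef.
have mG := cmeasurableB _ _ mF mt.
have hk : (energy (fun xi => F xi - fourier_trunc k%:R f xi)%R <= (eps / 4)%:E)%E by near: k; exact: cvgF.
(* The error for the difference is [G (xi + h) - G xi]; both terms have the same energy by
   translation invariance, whence the accuracy [eps / 4]. *)
pose G xi := F xi - fourier_trunc k%:R f xi.
have -> : (fun xi => F (xi + h) - F xi - fourier_trunc k%:R (fun x => expi (- dotp x h) * f x - f x) xi) =
    (fun xi => G (xi + h) - G xi).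
  apply/funext => xi; rewrite fourier_truncB// fourier_trunc_modulate /G; ring.
have mGs := cmeasurable_shift _ h mG.
apply: le_trans (energy_le2 _ _ _ mGs mG (cmeasurableB _ _ mGs mG) (fun x => csqB_le _ _)) _.
rewrite (energy_shift G h)//.
have -> : eps%:E = (2%:E * (eps / 4)%:E + 2%:E * (eps / 4)%:E)%E.
  by rewrite -!EFinM -EFinD; congr EFin; field.
by apply: leeD; rewrite lee_pmul2l.
Unshelve. all: by end_near. Qed.
End fourier_plancherel.

(** * Dyadic sums *)

Section dyadic.
Context {R : realType}.
Implicit Types (x t A : R).

Lemma normr_sin_le x : `|sin x| <= `|x|.
Proof.
wlog x0 : x / 0 <= x.
  move=> h; case: (leP 0 x) => [|/ltW x0]; first exact: h.
  by rewrite -(normrN x) -(normrN (sin x)) -sinN h// oppr_ge0.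
have [c _] : exists2 c, c \in `[0, x]%R & sin x - sin 0 = cos c * (x - 0).
  apply: (@MVT_segment _ sin cos 0 x) => //.
    by apply: continuous_subspaceT; exact: continuous_sin.
by rewrite sin0 !subr0 => ->; rewrite normrM ler_piMl// cos_max.
Qed.

(** The squared modulus is [4 * sin (x / 2) ^+ 2], and [|sin y| <= |y|]. *)
Lemma csq_expi_sub1_sqr x : csq (expi x - 1) <= x ^+ 2.
Proof.
rewrite csq_expi_sub1.
have -> : 2 - 2 * cos x = 4 * sin (x / 2) ^+ 2.
  rewrite sin2cos2 -[in LHS](divfK (_ : 2 != 0) x) ?pnatr_eq0//.
  by rewrite mulr_natr cos_mulr2n; ring.
have := normr_sin_le (x / 2).
rewrite -ler_sqr ?nnegrE// !real_normK ?num_real// => h.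
have -> : x ^+ 2 = 4 * (x / 2) ^+ 2 by field.
by rewrite ler_pM2l.
Qed.

Lemma csq_expi_sub1_le4 x : csq (expi x - 1) <= 4.
Proof. by rewrite csq_expi_sub1; have := cos_geN1 x; lra. Qed.

(** The minimum of [|e^(i x) - 1|^2] over [1 <= x <= 2], attained at 1 because the cosine decreases
    on [[0, pi]], which contains this interval. *)
Definition kappa : R := 2 - 2 * cos 1.

Lemma kappa_gt0 : 0 < kappa.
Proof.
have : cos 1 < cos 0 :> R.
  by rewrite ltr_cos ?in_itv/= ?lexx ?ler01 ?ltr01 ?pi_ge0//; have := pi_ge2 R; lra.
by rewrite cos0 /kappa; lra.
Qed.

Lemma csq_expi_sub1_ge x : 1 <= x <= 2 -> kappa <= csq (expi x - 1).
Proof.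
move=> /andP[x1 x2]; rewrite csq_expi_sub1 /kappa lerD2l lerN2 ler_pM2l//.
rewrite leNgt; apply/negP; rewrite ltr_cos ?in_itv/=; first by rewrite ltNge x1.
- by have := pi_ge2 R; lra.
- by have := pi_ge2 R; lra.
Qed.

Variable b : R.
Hypotheses (b0 : 0 < b) (b1 : b < 1).

(** Its power [ratio ^+ j] is the weight (2^j)^(2b) of the scale 2^-j. The bounds [1 < ratio < 4]
    express [0 < b < 1] and make both geometric sums below converge in the right direction. *)
Definition ratio : R := 4 `^ b.

Lemma one_powR c : 1 `^ c = 1 :> R.
Proof. by rewrite powR1. Qed.

Lemma powR_gt1 (r c : R) : 1 < r -> 0 < c -> 1 < r `^ c.
Proof.
move=> r1 c0; rewrite -[X in X < _](one_powR c); apply: gt0_ltr_powR => //.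
  by rewrite nnegrE ler01.
by rewrite nnegrE ltW// (lt_trans ltr01).
Qed.

Lemma ratio_gt1 : 1 < ratio.
Proof. by apply: powR_gt1 => //; rewrite ltr1n. Qed.

Lemma ratio_lt4 : ratio < 4.
Proof.
have -> : 4 = ratio * 4 `^ (1 - b).
  rewrite /ratio -powRD; last by rewrite pnatr_eq0 implybT.
  by rewrite addrCA subrr addr0 powRr1.
rewrite ltr_pMr; last by rewrite (lt_trans ltr01) ?ratio_gt1.
by apply: powR_gt1; rewrite ?ltr1n// subr_gt0.
Qed.

Lemma ratio_exp j : ratio ^+ j = (4 ^+ j) `^ b.
Proof.
rewrite /ratio -(@powR_mulrn R _ j (powR_ge0 4 b)) -(@powR_mulrn R _ j (ler0n R 4)).
by rewrite -!powRrM mulrC.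
Qed.

(* The induction step of [dyadic_pow] is an equality for this [c1], and its base
   case is a geometric series for this [c2]. *)
Let c1 : R := 4 / (ratio - 1).
Let c2 : R := c1 + (1 - ratio / 4)^-1.

Let c1_ge0 : 0 <= c1.
Proof. by rewrite divr_ge0// subr_ge0 ltW// ratio_gt1. Qed.

Let ratio4 : 0 < 1 - ratio / 4.
Proof. by rewrite subr_gt0 ltr_pdivrMr// mul1r ratio_lt4. Qed.

Let ratio_gt0 : 0 < ratio. Proof. exact: lt_trans ltr01 ratio_gt1. Qed.

Let ratio_ge0 : 0 <= ratio. Proof. exact: ltW. Qed.

Let ratio_ge1 : 1 <= ratio. Proof. exact: ltW ratio_gt1. Qed.

Let inv_ge0 : 0 <= (1 - ratio / 4)^-1. Proof. by rewrite invr_ge0 ltW. Qed.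

Let ratioX_ge0 j : 0 <= ratio ^+ j. Proof. exact: exprn_ge0. Qed.

(** The case A = 2^J. For [j < J] the minimum is 4 and the terms grow like [ratio^j]; from [j = J]
    on they decay like [(ratio / 4)^j]. The induction removes the term [j = 0], at a cost of 4, and
    shifts the others, which multiplies the bound by [ratio]; subtracting [c1] absorbs the 4. *)
Let dyadic_pow J : forall N, \sum_(j < N) ratio ^+ j * Num.min 4 (4 ^+ J / 4 ^+ j) <= c2 * ratio ^+ J - c1.
Proof.
elim: J => [|J IH] N.
  rewrite expr0 mulr1 /c2 [c1 + _]addrC addrK.
  apply: (@le_trans _ _ (\sum_(j < N) (ratio / 4) ^+ j)).
    apply: ler_sum => j _; rewrite expr_div_n ler_wpM2l//.
    by rewrite ge_min mul1r lexx orbT.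
  have r0 : 0 <= ratio / 4 by rewrite divr_ge0.
  (* The partial sums of the geometric series stay below the fixed point of [S = 1 + u * S] with
     [u = ratio / 4]. *)
  elim: N => [|N IHN]; first by rewrite big_ord0.
  rewrite big_ord_recl/= expr0.
  under eq_bigr do rewrite /bump/= add1n exprS.
  rewrite -mulr_sumr.
  apply: (@le_trans _ _ (1 + ratio / 4 * (1 - ratio / 4)^-1)).
    by rewrite lerD2l ler_wpM2l.
  have d0 := lt0r_neq0 ratio4.
  have geo (u : R) : 1 - u != 0 -> 1 + u / (1 - u) = (1 - u)^-1 by move=> u0; field.
  by rewrite geo.
case: N => [|N].
  rewrite big_ord0 subr_ge0 (@le_trans _ _ c2)//.
    by rewrite /c2 lerDl.
  by rewrite ler_peMr ?exprn_ege1// /c2 addr_ge0.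
rewrite big_ord_recl/= expr0 mul1r.
apply: (@le_trans _ _ (4 + ratio * (c2 * ratio ^+ J - c1))).
  apply: lerD; first by rewrite ge_min lexx.
  apply: le_trans (_ : _ <= ratio * \sum_(j < N) ratio ^+ j * Num.min 4 (4 ^+ J / 4 ^+ j)) _; last first.
    by rewrite ler_wpM2l.
  rewrite mulr_sumr; apply: ler_sum => j _.
  by rewrite /bump/= add1n !exprS -mulrA invfM mulrACA divff// mul1r lexx.
have h : c1 * (ratio - 1) = 4 by rewrite /c1 divfK// subr_eq0 gt_eqF// ratio_gt1.
rewrite exprS -subr_ge0.
have -> : c2 * (ratio * ratio ^+ J) - c1 - (4 + ratio * (c2 * ratio ^+ J - c1)) = c1 * (ratio - 1) - 4 by ring.
by rewrite h subrr.
Qed.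

(** Take the least [J] with A <= 2^J. By minimality 2^(J-1) <= A unless [J = 0], so [ratio ^+ J] is
    at most [ratio] times 1 + A^(2b). The constant does not depend on [N], which lets the sum become
    a series. *)
Lemma dyadic_sum_le : exists2 C : R, 0 < C & forall N A, 0 <= A ->
  \sum_(j < N) ratio ^+ j * Num.min 4 (A ^+ 2 / 4 ^+ j) <= C * (1 + A `^ (2 * b)).
Proof.
have c20 : 0 < c2 by rewrite /c2 ltr_wpDl// invr_gt0.
exists (c2 * ratio); first by rewrite mulr_gt0.
move=> N A A0.
have [J AJ JA] : exists2 J, A ^+ 2 <= 4 ^+ J & (J = 0%N \/ 4 ^+ J.-1 <= A ^+ 2).
  have ex : exists J, A ^+ 2 <= 4 ^+ J.
    exists (Num.bound (A ^+ 2)); apply: ltW; apply: lt_le_trans (archi_boundP (sqr_ge0 A)) _.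
    by rewrite -natrX ler_nat ltnW// ltn_expl.
  exists (ex_minn ex); first by case: ex_minnP.
  case: ex_minnP => -[|J] AJ mJ; first by left.
  right; rewrite /= leNgt; apply/negP => /ltW /mJ; by rewrite ltnn.
apply: (@le_trans _ _ (c2 * ratio ^+ J)).
  apply: (@le_trans _ _ (c2 * ratio ^+ J - c1)); last by rewrite gerBl.
  apply: le_trans (dyadic_pow J N); apply: ler_sum => j _.
  rewrite ler_wpM2l// le_min ge_min lexx/= ge_min; apply/orP; right.
  by rewrite ler_pM2r ?invr_gt0 ?exprn_gt0.
rewrite -mulrA ler_pM2l//.
case: JA => [->|JA].
  by rewrite expr0 (@le_trans _ _ ratio)// ler_peMr// lerDl powR_ge0.
case: J AJ JA => [_ _|J AJ JA].
  by rewrite expr0 (@le_trans _ _ ratio)// ler_peMr// lerDl powR_ge0.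
rewrite exprS ler_pM2l// (@le_trans _ _ (A `^ (2 * b)))//; last by rewrite lerDr.
rewrite ratio_exp powRrM powR_mulrn//; by apply: ge0_ler_powR; rewrite ?nnegrE ?exprn_ge0// ltW.
Qed.

(** When 2^j <= |x| <= 2^(j+1), the quotient |x| / 2^j lies in [[1, 2]], where [kappa] bounds the
    difference from below. The factor [ratio] accounts for the upper end 2^(j+1), and the summand 1
    for |x| <= 1. *)
Lemma powR_le_dyadic x : exists j, `|x| `^ (2 * b) <=
  1 + ratio / kappa * (ratio ^+ j * csq (expi (- (x / 2 ^+ j)) - 1)).
Proof.
have k0 := kappa_gt0.
have nn j : 0 <= ratio / kappa * (ratio ^+ j * csq (expi (- (x / 2 ^+ j)) - 1)).
  by rewrite !mulr_ge0 ?invr_ge0 ?exprn_ge0 ?csq_ge0 ?ltW.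
case: (leP `|x| 1) => x1.
  exists 0%N; apply: (@le_trans _ _ 1); last by rewrite lerDl.
  apply: (@le_trans _ _ (1 `^ (2 * b))); last by rewrite one_powR.
  by apply: ge0_ler_powR; rewrite ?nnegrE// mulr_ge0// ltW.
have [j jx xj] : exists2 j, 2 ^+ j <= `|x| & `|x| <= 2 ^+ j.+1.
  have ex : exists J, `|x| <= 2 ^+ J.
    exists (Num.bound `|x|); apply: ltW; apply: lt_le_trans (archi_boundP (normr_ge0 x)) _.
    by rewrite -natrX ler_nat ltnW// ltn_expl.
  have : `|x| <= 2 ^+ (ex_minn ex) by case: ex_minnP.
  case: ex_minnP => -[|J] _ mJ; first by rewrite expr0 leNgt x1.
  by exists J => //; rewrite leNgt; apply/negP => /ltW /mJ; rewrite ltnn.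
exists j; apply: (@le_trans _ _ (ratio / kappa * (ratio ^+ j * kappa))); last first.
  apply: (@le_trans _ _ (ratio / kappa * (ratio ^+ j * csq (expi (- (x / 2 ^+ j)) - 1)))); last by rewrite lerDr.
  rewrite ler_wpM2l ?divr_ge0 ?(ltW k0)// ler_wpM2l//.
  have -> : csq (expi (- (x / 2 ^+ j)) - 1) = csq (expi (`|x| / 2 ^+ j) - 1).
    rewrite !csq_expi_sub1 cosN; case: (ger0P x) => // _.
    by rewrite mulNr cosN.
  apply: csq_expi_sub1_ge; rewrite ler_pdivlMr ?exprn_gt0// mul1r jx/=.
  by rewrite ler_pdivrMr ?exprn_gt0// -exprS.
have -> : ratio / kappa * (ratio ^+ j * kappa) = ratio ^+ j.+1.
  by rewrite exprS; field; rewrite gt_eqF.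
rewrite ratio_exp powRrM powR_mulrn//; apply: ge0_ler_powR; rewrite ?nnegrE ?exprn_ge0// ?(ltW b0)//.
have four : 4 = 2 ^+ 2 :> R by rewrite -natrX.
rewrite four -exprM mulnC exprM.
by rewrite ler_sqr ?nnegrE ?exprn_ge0.
Qed.
End dyadic.

(** * Weighted norms as dyadic sums of differences *)

Section dyadic_characterization.
Context {R : realType} {n : nat}.
Local Open Scope complex_scope.
Local Notation mu := (@lebesgue_rV R n).
Local Notation V := 'rV[R]_n.
Implicit Types (f F m : V -> R[i]) (i : 'I_n).
Variable b : R.
Hypotheses (b0 : 0 < b) (b1 : b < 1).
Local Notation q := (ratio b).

Let q_ge0 j : 0 <= q ^+ j.
Proof. by rewrite exprn_ge0// (le_trans ler01)// ltW// ratio_gt1. Qed.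

Definition step i (j : nat) : V := (2 ^- j) *: delta_mx 0 i.

Lemma dotp_step (x : V) i j : dotp x (step i j) = x ord0 i / 2 ^+ j.
Proof.
rewrite /dotp (bigD1 i)//= big1 ?addr0.
  by rewrite /step !mxE !eqxx mulr1.
by move=> k ki; rewrite /step !mxE (negbTE ki) andbF !mulr0.
Qed.

Lemma enorm_step i j : enorm (step i j) = 2 ^- j.
Proof.
rewrite /enorm (bigD1 i)//= big1 ?addr0.
  rewrite /step !mxE !eqxx mulr1 sqrtr_sqr ger0_norm// invr_ge0 exprn_ge0.
by move=> k ki; rewrite /step !mxE (negbTE ki) andbF mulr0 expr0n.
Qed.

Definition modulated f i j : V -> R[i] := fun x => expi (- dotp x (step i j)) * f x - f x.
Definition translated F i j : V -> R[i] := fun x => F (x + step i j) - F x.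

Lemma csq_modulated f i j x :
  csq (modulated f i j x) = csq (expi (- (x ord0 i / 2 ^+ j)) - 1) * csq (f x).
Proof. by rewrite -csqM mulrBl mul1r /modulated dotp_step. Qed.

Lemma cmeasurable_modulated f i j : cmeasurable f -> cmeasurable (modulated f i j).
Proof.
move=> mf; apply: (cmeasurableB _ _ _ mf); apply: (cmeasurableM _ _ _ mf).
apply: cmeasurable_expi; apply: measurable_funN.
by under eq_fun do rewrite dotpC; exact: measurable_dotp.
Qed.

Lemma cmeasurable_translated F i j : cmeasurable F -> cmeasurable (translated F i j).
Proof. by move=> mF; exact: (cmeasurableB _ _ (cmeasurable_shift _ _ mF) mF). Qed.

Definition dyadic_energy (G : nat -> V -> R[i]) : \bar R :=
  (\sum_(j <oo) (q ^+ j)%:E * energy (G j))%E.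

Lemma dyadic_energyE (G : nat -> V -> R[i]) : (forall j, cmeasurable (G j)) ->
  (dyadic_energy G = \int[mu]_x \sum_(j <oo) (q ^+ j * csq (G j x))%:E)%E.
Proof.
move=> mG; rewrite integral_nneseries//.
- apply: eq_eseriesr => j _; rewrite /energy -ge0_integralZl//.
  + exact: measurable_csqE.
  + by move=> x _; rewrite lee_fin csq_ge0.
  + by rewrite lee_fin.
- by move=> j; apply/measurable_EFinP; apply: measurable_funM => //; exact: measurable_csq.
- by move=> j x _; rewrite lee_fin mulr_ge0 ?csq_ge0.
Qed.

Lemma measurable_dyadic (G : nat -> V -> R[i]) : (forall j, cmeasurable (G j)) ->
  measurable_fun setT (fun x => (\sum_(j <oo) (q ^+ j * csq (G j x))%:E)%E).
Proof.
move=> mG; apply: ge0_emeasurable_sum => [j x _ _|j _].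
  by rewrite lee_fin mulr_ge0 ?csq_ge0.
by apply/measurable_EFinP; apply: measurable_funM => //; exact: measurable_csq.
Qed.

Lemma dyadic_ge0 (u : nat -> R) : (forall j, 0 <= u j) ->
  (0 <= \sum_(j <oo) (q ^+ j * u j)%:E)%E.
Proof. by move=> u0; apply: nneseries_ge0 => j _ _; rewrite lee_fin mulr_ge0. Qed.

Lemma nneseries_le_fin (u : nat -> R) (B : R) : (forall j, 0 <= u j) ->
  (forall N, \sum_(j < N) u j <= B) -> (\sum_(j <oo) (u j)%:E <= B%:E)%E.
Proof.
move=> u0 uB; apply: lime_le.
  by apply: is_cvg_nneseries => j _ _; rewrite lee_fin.
by apply: nearW => N; rewrite sumEFin lee_fin big_mkord.
Qed.

Lemma le_nneseries_term (u : nat -> R) j : (forall j, 0 <= u j) ->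
  ((u j)%:E <= \sum_(j <oo) (u j)%:E)%E.
Proof.
move=> u0; apply: le_trans (nneseries_lim_ge j.+1 _); last by move=> k _ _; rewrite lee_fin.
by rewrite big_nat_recr//= leeDr// sume_ge0// => k _; rewrite lee_fin.
Qed.

Definition coord_weighted i f : \bar R := (\int[mu]_x (`|x ord0 i| `^ (2 * b) * csq (f x))%:E)%E.

Definition weighted f : \bar R := (\int[mu]_x (enorm x `^ (2 * b) * csq (f x))%:E)%E.

Lemma measurable_coord_powR i : measurable_fun setT (fun x : V => `|x ord0 i| `^ (2 * b)).
Proof.
apply: (measurableT_comp (@measurable_powR R (2 * b))).
by apply: measurableT_comp => //; exact: measurable_coord.
Qed.

Lemma measurable_enorm_powR (s : R) : measurable_fun setT (fun x : V => enorm x `^ s).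
Proof. by apply: (measurableT_comp (@measurable_powR R s)); exact: measurable_enorm. Qed.

(** Only the scale adapted to [x] is kept from the series. As that scale varies with [x], the series
    is first moved under the integral. *)
Lemma coord_weighted_le i f : cmeasurable f ->
  (coord_weighted i f <= energy f + (q / kappa)%:E * dyadic_energy (modulated f i))%E.
Proof.
move=> mf; have mm j := cmeasurable_modulated f i j mf.
have k0 := @kappa_gt0 R.
have qk : 0 <= q / kappa by have := q_ge0 1; rewrite expr1 => q0; rewrite divr_ge0// ltW.
have mS := measurable_dyadic _ mm.
have S0 x : (0 <= \sum_(j <oo) (q ^+ j * csq (modulated f i j x))%:E)%E.
  by apply: (dyadic_ge0 (fun j => csq (modulated f i j x))) => j; exact: csq_ge0.
rewrite dyadic_energyE// -ge0_integralZl//.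
rewrite /energy -ge0_integralD//; last 4 first.
- by move=> x _; rewrite lee_fin csq_ge0.
- exact: measurable_csqE.
- by move=> x _; rewrite mule_ge0 ?lee_fin//; exact: S0.
- exact: measurable_funeM.
apply: ge0_le_integral => //.
- by move=> x _; rewrite lee_fin mulr_ge0 ?powR_ge0 ?csq_ge0.
- apply/measurable_EFinP; apply: measurable_funM; first exact: measurable_coord_powR.
  exact: measurable_csq.
- by apply: emeasurable_funD; [exact: measurable_csqE|exact: measurable_funeM].
move=> x _; have [j hj] := powR_le_dyadic b b0 (x ord0 i).
apply: (@le_trans _ _ (csq (f x) + (q / kappa) * (q ^+ j * csq (modulated f i j x)))%:E).
  rewrite lee_fin csq_modulated.
  apply: le_trans (ler_wpM2r (csq_ge0 (f x)) hj) _.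
  by rewrite mulrDl mul1r !mulrA.
rewrite EFinD leeD2l// EFinM lee_wpmul2l ?lee_fin//.
by apply: (le_nneseries_term (fun j => q ^+ j * csq (modulated f i j x))) => k; rewrite mulr_ge0 ?csq_ge0.
Qed.

(** All scales count here: [|e^(i y) - 1|^2] is at most 4 and at most [y^2], which gives the minimum
    summed by [dyadic_sum_le] with [A = enorm x]. *)
Lemma dyadic_modulated_le : exists2 C : R, 0 < C & forall i f, cmeasurable f ->
  (dyadic_energy (modulated f i) <= C%:E * (energy f + weighted f))%E.
Proof.
have [C C0 hC] := dyadic_sum_le b b0 b1.
exists C => // i f mf; have mm j := cmeasurable_modulated f i j mf.
have mw : measurable_fun setT (fun x => (enorm x `^ (2 * b) * csq (f x))%:E).
  apply/measurable_EFinP; apply: measurable_funM; first exact: measurable_enorm_powR.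
  exact: measurable_csq.
have w0 x : setT x -> (0 <= (enorm x `^ (2 * b) * csq (f x))%:E)%E.
  by rewrite lee_fin mulr_ge0 ?powR_ge0 ?csq_ge0.
have e0 x : setT x -> (0 <= (csq (f x))%:E)%E by rewrite lee_fin csq_ge0.
have me := measurable_csqE f mf.
rewrite dyadic_energyE// /energy /weighted -ge0_integralD//.
rewrite -ge0_integralZl//; last 3 first.
- exact: emeasurable_funD.
- by move=> x Tx; rewrite adde_ge0 ?e0 ?w0.
- by rewrite lee_fin ltW.
apply: ge0_le_integral => //.
- by move=> x _; apply: (dyadic_ge0 (fun j => csq (modulated f i j x))) => j; exact: csq_ge0.
- exact: measurable_dyadic.
- by apply: measurable_funeM; exact: emeasurable_funD.
move=> x _; rewrite -EFinD -EFinM.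
apply: (nneseries_le_fin (fun j => q ^+ j * csq (modulated f i j x))) => [j|N].
  by rewrite mulr_ge0 ?csq_ge0.
apply: (@le_trans _ _ (C * (1 + enorm x `^ (2 * b)) * csq (f x))); last first.
  by rewrite -mulrA mulrDl mul1r.
apply: le_trans (ler_wpM2r (csq_ge0 (f x)) (hC N (enorm x) (enorm_ge0 x))).
rewrite mulr_suml; apply: ler_sum => j _; rewrite csq_modulated mulrA.
rewrite ler_wpM2r ?csq_ge0// ler_wpM2l// le_min csq_expi_sub1_le4/=.
apply: le_trans (csq_expi_sub1_sqr _) _; rewrite sqrrN expr_div_n.
have four : 4 = 2 ^+ 2 :> R by rewrite -natrX.
rewrite four -!exprM [(j * 2)%N]mulnC ler_wpM2r ?invr_ge0 ?exprn_ge0//.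
by rewrite -[leLHS]real_normK ?num_real// ler_sqr ?nnegrE ?enorm_ge0// coord_le_enorm.
Qed.

Lemma dyadic_translated_le i (m F0 : V -> R[i]) (w : V -> R) (C : R) : 0 <= C ->
  cmeasurable F0 -> cmeasurable (fun x => m x * F0 x) -> measurable_fun setT w ->
  (forall x, 0 <= w x) -> (forall x, csq (m x) = 1) ->
  (forall x N, \sum_(j < N) q ^+ j * csq (m (x + step i j) - m x) <= C * w x) ->
  (dyadic_energy (translated (fun x => m x * F0 x)%R i) <=
    2%:E * dyadic_energy (translated F0 i) +
    (2 * C)%:E * \int[mu]_x (w x * csq (F0 x))%:E)%E.
Proof.
move=> C0 m0 mm mw w0 m1 hC.
have mt0 j := cmeasurable_translated F0 i j m0.
have mt j := cmeasurable_translated _ i j mm.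
have S0 x : setT x -> (0 <= \sum_(j <oo) (q ^+ j * csq (translated F0 i j x))%:E)%E.
  by move=> _; apply: (dyadic_ge0 (fun j => csq (translated F0 i j x))) => j; exact: csq_ge0.
have mS := measurable_dyadic _ mt0.
have mw0 : measurable_fun setT (fun x => (w x * csq (F0 x))%:E).
  by apply/measurable_EFinP; apply: measurable_funM => //; exact: measurable_csq.
have ww0 x : setT x -> (0 <= (w x * csq (F0 x))%:E)%E by rewrite lee_fin mulr_ge0 ?csq_ge0.
have C2 : (0 <= (2 * C)%:E)%E by rewrite lee_fin mulr_ge0.
rewrite !dyadic_energyE// -(ge0_integralZl mu measurableT mS S0)//.
rewrite -(ge0_integralZl mu measurableT mw0 ww0)//.
rewrite -ge0_integralD//; last 4 first.
- by move=> x Tx; rewrite mule_ge0// S0.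
- exact: measurable_funeM.
- by move=> x Tx; rewrite mule_ge0// ww0.
- exact: measurable_funeM.
apply: ge0_le_integral => //.
- by move=> x _; apply: (dyadic_ge0 (fun j => csq (translated _ i j x))) => j; exact: csq_ge0.
- exact: measurable_dyadic.
- by apply: emeasurable_funD; exact: measurable_funeM.
move=> x _.
pose u j : R := 2 * (q ^+ j * csq (translated F0 i j x)).
pose v j : R := 2 * (q ^+ j * csq (m (x + step i j) - m x) * csq (F0 x)).
have u0 j : 0 <= u j by rewrite mulr_ge0// mulr_ge0 ?csq_ge0.
have v0 j : 0 <= v j by rewrite mulr_ge0// mulr_ge0 ?csq_ge0// mulr_ge0 ?csq_ge0.
apply: (@le_trans _ _ (\sum_(j <oo) ((u j)%:E + (v j)%:E))%E).
  apply: lee_nneseries => [j _ _|j _]; first by rewrite lee_fin mulr_ge0 ?csq_ge0.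
  rewrite -EFinD lee_fin /u /v.
  (* The increment of [m] is paired with [F0] at the unshifted point, so that the weight [w] is
     taken where [hC] provides it; the shifted factor [m] has modulus 1. *)
  have -> : translated (fun x => m x * F0 x) i j x =
      m (x + step i j) * translated F0 i j x + (m (x + step i j) - m x) * F0 x.
    by rewrite /translated; ring.
  apply: le_trans (ler_wpM2l (q_ge0 j) (csqD_le _ _)) _.
  by rewrite !csqM m1 mul1r mulrDr; lra.
rewrite nneseriesD; [|by move=> j _ _; rewrite lee_fin|by move=> j _ _; rewrite lee_fin].
apply: leeD.
  rewrite -nneseriesZl; last by move=> j _; rewrite lee_fin mulr_ge0 ?csq_ge0.
  by apply: lee_nneseries => [j _ _|j _]; rewrite ?lee_fin// -EFinM.
rewrite -EFinM; apply: nneseries_le_fin => // N.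
rewrite -mulr_sumr -mulr_suml -mulrA ler_pM2l// mulrA ler_wpM2r ?csq_ge0//.
Qed.

(** The square of [enorm x] is at most [n] times that of the largest coordinate. Raising to the
    power [b <= 1] leaves a factor at most [n], since [n >= 1]. *)
Lemma enorm_powR_le (x : V) : (0 < n)%N ->
  enorm x `^ (2 * b) <= n%:R * \sum_(i < n) `|x ord0 i| `^ (2 * b).
Proof.
move=> n0; pose i0 : 'I_n := Ordinal n0.
have [k _ kmax] := @Order.TotalTheory.arg_maxP _ _ _ i0 xpredT (fun i => `|x ord0 i|) isT.
have n1 : 1 <= n%:R :> R by rewrite ler1n.
have h : enorm x ^+ 2 <= n%:R * `|x ord0 k| ^+ 2.
  rewrite /enorm sqr_sqrtr; last by apply: sumr_ge0 => i _; exact: sqr_ge0.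
  apply: (@le_trans _ _ (\sum_(i < n) `|x ord0 k| ^+ 2)).
    apply: ler_sum => i _; rewrite -[leLHS]real_normK ?num_real//.
    by rewrite ler_sqr ?nnegrE//; exact: kmax.
  by rewrite sumr_const card_ord mulr_natl.
apply: (@le_trans _ _ (n%:R * `|x ord0 k| `^ (2 * b))); last first.
  rewrite ler_wpM2l// (bigD1 k)//= lerDl sumr_ge0// => i _; exact: powR_ge0.
rewrite !powRrM !powR_mulrn ?enorm_ge0//.
apply: (@le_trans _ _ ((n%:R * `|x ord0 k| ^+ 2) `^ b)).
  by apply: ge0_ler_powR; rewrite ?nnegrE ?sqr_ge0 ?mulr_ge0 ?sqr_ge0// ltW.
rewrite powRM ?sqr_ge0// ler_wpM2r ?powR_ge0//.
by apply: ler1_powR => //; exact: ltW.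
Qed.

Lemma weighted_le f : (0 < n)%N -> cmeasurable f ->
  (weighted f <= n%:R%:E * \sum_(i < n) coord_weighted i f)%E.
Proof.
move=> n0 mf.
have mi i : measurable_fun setT (fun x : V => (`|x ord0 i| `^ (2 * b) * csq (f x))%:E).
  apply/measurable_EFinP; apply: measurable_funM; first exact: measurable_coord_powR.
  exact: measurable_csq.
have nn i (x : V) : setT x -> (0 <= (`|x ord0 i| `^ (2 * b) * csq (f x))%:E)%E.
  by rewrite lee_fin mulr_ge0 ?powR_ge0 ?csq_ge0.
rewrite /coord_weighted -ge0_integral_sum// -ge0_integralZl//.
- apply: ge0_le_integral => //.
  + by move=> x _; rewrite lee_fin mulr_ge0 ?powR_ge0 ?csq_ge0.
  + apply/measurable_EFinP; apply: measurable_funM; first exact: measurable_enorm_powR.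
    exact: measurable_csq.
  + by apply: measurable_funeM; exact: emeasurable_sum.
  + move=> x _; rewrite sumEFin -EFinM lee_fin -mulr_suml mulrA ler_wpM2r ?csq_ge0//.
    exact: enorm_powR_le.
- exact: emeasurable_sum.
- by move=> x Tx; apply: sume_ge0 => i _; exact: nn.
Qed.
End dyadic_characterization.

(** * The symbol *)

Section symbol.
Context {R : realType} {n : nat}.
Local Notation V := 'rV[R]_n.

Lemma enormN (x : V) : enorm (- x) = enorm x.
Proof. by rewrite /enorm; under eq_bigr do rewrite mxE sqrrN. Qed.

(** The points [xi] and [xi + h] fall under (A) when [|h| <= |xi|] and under (B) otherwise. In the
    second case [|h|^a <= |h|], because [|h| <= 1 <= a]. *)
Lemma symbol_lipschitz (phi g : V -> R) (k K : nat) (c : R) :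
  conditionA phi g -> conditionB phi -> 0 <= c -> (k <= K)%N ->
  (forall x, g x <= c * (1 + enorm x ^+ k)) ->
  exists L : R, 0 <= L /\ forall xi h : V, enorm h <= 1 ->
    `|phi (xi + h) - phi xi| <= L * (1 + enorm xi) ^+ K * enorm h.
Proof.
move=> [_ _ hA] [cB [a [cB0 a1 hB]]] c0 kK hg.
(* [2 * c] serves (A), since [1 + |xi|^k <= 2 (1 + |xi|)^K], and [cB] serves (B). *)
exists (2 * c + cB); split; first by rewrite addr_ge0 ?mulr_ge0// ltW.
move=> xi h h1; have e0 := enorm_ge0 xi; have h0 := enorm_ge0 h.
have E1 : 1 <= 1 + enorm xi by rewrite lerDl.
have EK : 1 <= (1 + enorm xi) ^+ K by rewrite exprn_ege1.
have dE : xi - (xi + h) = - h by rewrite opprD addNKr.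
rewrite distrC; case: (leP (enorm h) (enorm xi)) => hx.
  have := hA xi (xi + h); rewrite dE enormN => /(_ hx)/le_trans; apply.
  rewrite ler_wpM2r//; apply: le_trans (hg xi) _.
  apply: (@le_trans _ _ (2 * c * (1 + enorm xi) ^+ K)).
    rewrite [2 * c]mulrC -mulrA ler_wpM2l// mulr_natl mulr2n lerD//.
    apply: (@le_trans _ _ ((1 + enorm xi) ^+ k)); last exact: ler_weXn2l.
    by rewrite lerXn2r ?nnegrE ?addr_ge0// lerDr.
  by rewrite ler_wpM2r ?(le_trans ler01 EK)// lerDl ltW.
have := hB xi (xi + h); rewrite dE enormN => /(_ (ltW hx))/le_trans; apply.
apply: (@le_trans _ _ (cB * enorm h)).
  rewrite ler_pM2l//; have [->|hn0] := eqVneq (enorm h) 0.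
    by rewrite powR0// gt_eqF// (lt_le_trans ltr01).
  by apply: ge1r_powR => //; rewrite lt_def hn0 h0.
rewrite ler_wpM2r//; apply: (@le_trans _ _ (cB * (1 + enorm xi) ^+ K)).
  by rewrite ler_peMr// ltW.
by rewrite ler_wpM2r ?(le_trans ler01 EK)// lerDr mulr_ge0.
Qed.

Lemma sum_symbol_lipschitz (p K : nat) (phi : 'I_p -> V -> R) (Phi : V -> R) :
  (forall xi, Phi xi = \sum_(i < p) phi i xi) ->
  (forall i, exists L : R, 0 <= L /\ forall xi h : V, enorm h <= 1 ->
    `|phi i (xi + h) - phi i xi| <= L * (1 + enorm xi) ^+ K * enorm h) ->
  exists L : R, 0 <= L /\ forall xi h : V, enorm h <= 1 ->
    `|Phi (xi + h) - Phi xi| <= L * (1 + enorm xi) ^+ K * enorm h.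
Proof.
move=> PhiE /choice[L hL]; exists (\sum_i L i); split.
  by apply: sumr_ge0 => i _; exact: (hL i).1.
move=> xi h h1; rewrite !PhiE -sumrB (le_trans (ler_norm_sum _ _ _))// !mulr_suml.
by apply: ler_sum => i _; exact: (hL i).2.
Qed.

Variables (b s : R) (K : nat).
Hypotheses (b0 : 0 < b) (b1 : b < 1) (s0 : 0 < s) (bK : b * K%:R <= s).

Lemma multiplier_dyadic_le (Phi : V -> R) (L : R) : 0 <= L ->
  (forall xi h : V, enorm h <= 1 ->
    `|Phi (xi + h) - Phi xi| <= L * (1 + enorm xi) ^+ K * enorm h) ->
  exists2 C : R, 0 <= C & forall t i (xi : V) N,
    \sum_(j < N) ratio b ^+ j *
       csq (expi (- (t * Phi (xi + step i j))) - expi (- (t * Phi xi)))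
    <= C * (1 + `|t|) ^+ 2 * (1 + enorm xi ^+ 2) `^ s.
Proof.
move=> L0 hL; have [C C0 hC] := dyadic_sum_le b b0 b1.
exists (C * (1 + L `^ (2 * b) * 2 `^ s)).
  by rewrite mulr_ge0 ?addr_ge0 ?mulr_ge0 ?powR_ge0// ltW.
move=> t i xi N; set e := enorm xi.
have e0 : 0 <= e := enorm_ge0 xi.
have E0 : 0 <= 1 + e by rewrite addr_ge0.
have E1 : 1 <= 1 + e by rewrite lerDl.
pose A := `|t| * (L * (1 + e) ^+ K).
have A0 : 0 <= A by rewrite mulr_ge0// mulr_ge0// exprn_ge0.
have q0 j : 0 <= ratio b ^+ j.
  by rewrite exprn_ge0// (le_trans ler01)// ltW// ratio_gt1.
apply: (@le_trans _ _ (\sum_(j < N) ratio b ^+ j * Num.min 4 (A ^+ 2 / 4 ^+ j))).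
  apply: ler_sum => j _; rewrite ler_wpM2l//.
  (* Once the value at [xi], of modulus 1, is factored out, the difference becomes [expi d - 1], and
     the Lipschitz bound gives [|d| <= A / 2^j]. *)
  pose d := - (t * (Phi (xi + step i j) - Phi xi)).
  have -> : expi (- (t * Phi (xi + step i j))) - expi (- (t * Phi xi)) =
      expi (- (t * Phi xi)) * (expi d - 1).
    by rewrite mulrBr mulr1 -expiD; congr (expi _ - _); rewrite /d; ring.
  rewrite csqM csq_expi mul1r le_min csq_expi_sub1_le4/=.
  apply: le_trans (csq_expi_sub1_sqr _) _.
  have four : 4 = 2 ^+ 2 :> R by rewrite -natrX.
  rewrite four -exprM mulnC exprM -expr_div_n -[leLHS]real_normK ?num_real//.
  rewrite ler_sqr ?nnegrE ?divr_ge0 ?exprn_ge0// /d normrN normrM -mulrA ler_wpM2l//.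
  have := hL xi (step i j); rewrite enorm_step; apply.
  by rewrite invf_le1 ?exprn_gt0// exprn_ege1// ler1n.
apply: le_trans (hC N A A0) _.
have T1 : 1 <= (1 + `|t|) ^+ 2 by rewrite exprn_ege1// lerDl.
have W1 : 1 <= (1 + e ^+ 2) `^ s.
  rewrite -[leLHS](one_powR s); apply: ge0_ler_powR; rewrite ?nnegrE ?addr_ge0 ?sqr_ge0 ?(ltW s0)//.
  by rewrite lerDl sqr_ge0.
have b2 : 0 <= 2 * b by rewrite mulr_ge0// ltW.
have hA : A `^ (2 * b) = `|t| `^ (2 * b) * (L `^ (2 * b) * ((1 + e) ^+ K) `^ (2 * b)).
  by rewrite /A powRM ?mulr_ge0 ?exprn_ge0// powRM ?exprn_ge0.
have ht : `|t| `^ (2 * b) <= (1 + `|t|) ^+ 2.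
  apply: (@le_trans _ _ ((1 + `|t|) `^ (2 * b))).
    by apply: ge0_ler_powR; rewrite ?nnegrE ?addr_ge0// lerDr.
  rewrite -powR_mulrn ?addr_ge0//; apply: ler_powR; first by rewrite lerDl.
  by rewrite ler_piMr// ltW.
(* The exponent [2 * b * K] is at most [2 * s], and [(1 + e)^2 <= 2 (1 + e^2)]; hence the factor 2^s
   in the constant. *)
have he : ((1 + e) ^+ K) `^ (2 * b) <= 2 `^ s * (1 + e ^+ 2) `^ s.
  rewrite -powRM ?addr_ge0 ?sqr_ge0// -powR_mulrn// -powRrM.
  apply: (@le_trans _ _ ((1 + e) `^ (2 * s))).
    by apply: ler_powR => //; rewrite mulrCA ler_pM2l// mulrC.
  rewrite powRrM powR_mulrn//; apply: ge0_ler_powR; rewrite ?nnegrE ?sqr_ge0 ?mulr_ge0 ?addr_ge0 ?sqr_ge0 ?(ltW s0)//.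
  by have := sqrD_le R 1 e; rewrite expr1n mulrDr.
rewrite hA; move: ((1 + `|t|) ^+ 2) ((1 + e ^+ 2) `^ s) T1 W1 ht he => T W T1 W1 ht he.
have T0 := le_trans ler01 T1; have W0 := le_trans ler01 W1.
have -> : C * (1 + L `^ (2 * b) * 2 `^ s) * T * W =
    C * (T * W + T * (L `^ (2 * b) * (2 `^ s * W))) by ring.
rewrite ler_pM2l// lerD ?mulr_ege1//.
by apply: ler_pM; rewrite ?mulr_ge0 ?powR_ge0// ler_wpM2l ?powR_ge0.
Qed.
End symbol.

(** * Propagation of the weighted energy *)

Section propagation.
Context {R : realType} {n : nat}.
Local Open Scope complex_scope.
Local Notation mu := (@lebesgue_rV R n).
Local Notation V := 'rV[R]_n.
Implicit Types (f F m : V -> R[i]).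
Variables b s : R.
Hypotheses (b0 : 0 < b) (b1 : b < 1) (s0 : 0 < s).

Let q_ge0 j : 0 <= ratio b ^+ j.
Proof. by rewrite exprn_ge0// (le_trans ler01)// ltW// ratio_gt1. Qed.

(** Takes the transform as its argument: for [F = fourier f] it is the square of
    [sobolev_norm s f]. *)
Definition sobolev_energy F : \bar R := (\int[mu]_x ((1 + enorm x ^+ 2) `^ s * csq (F x))%:E)%E.

Lemma measurable_bessel_weight : measurable_fun setT (fun x : V => (1 + enorm x ^+ 2) `^ s).
Proof.
apply: (measurableT_comp (@measurable_powR R s)); apply: measurable_funD => //.
by apply: measurable_funX; exact: measurable_enorm.
Qed.

Lemma energy_le_sobolev F : cmeasurable F -> (energy F <= sobolev_energy F)%E.
Proof.
move=> mF; apply: ge0_le_integral => //.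
- by move=> x _; rewrite lee_fin csq_ge0.
- exact: measurable_csqE.
- apply/measurable_EFinP; apply: measurable_funM; first exact: measurable_bessel_weight.
  exact: measurable_csq.
move=> x _; rewrite lee_fin ler_peMl ?csq_ge0// -[leLHS](one_powR s).
by apply: ge0_ler_powR; rewrite ?nnegrE ?addr_ge0 ?sqr_ge0 ?(ltW s0)// lerDl sqr_ge0.
Qed.

Lemma le_dyadic_energy (G H : nat -> V -> R[i]) (c : R) : 0 <= c ->
  (forall j, energy (G j) <= c%:E * energy (H j))%E ->
  (dyadic_energy b G <= c%:E * dyadic_energy b H)%E.
Proof.
move=> c0 GH; rewrite /dyadic_energy -nneseriesZl; last first.
  by move=> j _; rewrite mule_ge0 ?lee_fin// energy_ge0.
apply: lee_nneseries => [j _ _|j _]; first by rewrite mule_ge0 ?lee_fin// energy_ge0.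
by rewrite muleCA lee_wpmul2l ?lee_fin.
Qed.

Lemma dyadic_modulated_le_translated f F i : fourier_pair f F ->
  (dyadic_energy b (modulated f i) <= 2%:E * dyadic_energy b (translated F i))%E.
Proof.
move=> fF; apply: le_dyadic_energy => [//|j].
exact: (fourier_pair_energy_ge _ _ (fourier_pair_difference _ _ (step i j) fF)).
Qed.

Lemma dyadic_translated_le_modulated f F i : fourier_pair f F ->
  (dyadic_energy b (translated F i) <= 2%:E * dyadic_energy b (modulated f i))%E.
Proof.
move=> fF; apply: le_dyadic_energy => [//|j].
exact: (fourier_pair_energy_le _ _ (fourier_pair_difference _ _ (step i j) fF)).
Qed.

(** The estimates lead from the weight of [f] to its modulations, to the translates of its
    transform, to those of [F0], and back to modulations and the weight of [f0]. The Sobolev energy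
    enters where the multiplier is differenced, and where the plain energies are bounded. *)
Lemma weighted_propagation (m : R -> V -> R[i]) (c : R) : (0 < n)%N -> 0 <= c ->
  (forall t xi, csq (m t xi) = 1) ->
  (forall t (i : 'I_n) (xi : V) N,
    \sum_(j < N) ratio b ^+ j * csq (m t (xi + step i j) - m t xi)
    <= c * (1 + `|t|) ^+ 2 * (1 + enorm xi ^+ 2) `^ s) ->
  exists2 D : R, 0 < D & forall t f0 F0 f,
    fourier_pair f0 F0 -> fourier_pair f (fun xi => m t xi * F0 xi) ->
    (sobolev_energy F0 < +oo)%E -> (weighted b f0 < +oo)%E ->
    (weighted b f <= D%:E * (((1 + `|t|) ^+ 2)%:E * sobolev_energy F0 + weighted b f0))%E.
Proof.
move=> n0 c0 m1 hm; have [C C0 hC] := @dyadic_modulated_le R n b b0 b1.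
pose Q : R := ratio b / kappa.
have Q0 : 0 <= Q by have := q_ge0 1; rewrite expr1 => ?; rewrite divr_ge0// ltW// kappa_gt0.
(* With [S] the Sobolev energy, [w] the weight of [f0] and [T] the squared time factor, the bound
   found below is [2 S + Q (8 C (2 S + w) + 4 c T S)]; [D1] collects its coefficients, using
   [S <= T S]. *)
pose D1 := 2 + 16 * (Q * C) + 4 * (Q * c).
have QC0 : 0 <= Q * C by rewrite mulr_ge0// ltW.
have Qc0 : 0 <= Q * c by rewrite mulr_ge0.
have D10 : 0 < D1 by rewrite /D1; lra.
have n1 : 0 < n%:R :> R by rewrite ltr0n.
(* One factor [n] comes from [weighted_le], the other from the sum over the coordinates. *)
exists (n%:R * (n%:R * D1)); first by rewrite !mulr_gt0.
move=> t f0 F0 f p0 p1 Soo Woo; have [mf0 _ mF0 _] := p0; have [mf _ mF _] := p1.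
set F := fun xi => m t xi * F0 xi in p1 mF.
have S0 : (0 <= sobolev_energy F0)%E.
  by rewrite integral_ge0// => x _; rewrite lee_fin mulr_ge0 ?powR_ge0 ?csq_ge0.
have W0 : (0 <= weighted b f0)%E.
  by rewrite integral_ge0// => x _; rewrite lee_fin mulr_ge0 ?powR_ge0 ?csq_ge0.
have := energy_le_sobolev _ mF0.
have hT : forall i, (dyadic_energy b (translated F i) <=
    2%:E * dyadic_energy b (translated F0 i) +
    (2 * (c * (1 + `|t|) ^+ 2))%:E * sobolev_energy F0)%E.
  move=> i; apply: (dyadic_translated_le b b0) => //.
  - by rewrite mulr_ge0 ?sqr_ge0.
  - exact: measurable_bessel_weight.
  - by move=> x; exact: powR_ge0.
have hW i := hC i f0 mf0.
have T1 : 1 <= (1 + `|t|) ^+ 2 by rewrite exprn_ege1// lerDl.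
(* Both data are finite, so they are replaced by real numbers and the remaining estimates end in
   real arithmetic. *)
move: hT hW Soo Woo S0 W0.
move: (weighted b f0) (sobolev_energy F0) => [w| |]// [S| |]// hT hW _ _.
rewrite !lee_fin => S0 W0 eF0.
move: ((1 + `|t|) ^+ 2) T1 hT => T T1 hT.
have eF : (energy F <= S%:E)%E.
  apply: le_trans eF0; rewrite /energy le_eqVlt; apply/orP; left; apply/eqP.
  by apply: eq_integral => x _; rewrite /F csqM m1 mul1r.
have ef : (energy f <= (2 * S)%:E)%E.
  apply: le_trans (fourier_pair_energy_ge _ _ p1) _.
  by rewrite EFinM lee_wpmul2l ?lee_fin.
have ef0 : (energy f0 <= (2 * S)%:E)%E.
  apply: le_trans (fourier_pair_energy_ge _ _ p0) _.
  by rewrite EFinM lee_wpmul2l ?lee_fin.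
have cw i : (coord_weighted b i f <= (D1 * (T * S + w))%:E)%E.
  apply: le_trans (coord_weighted_le b b0 i f mf) _.
  have dM0 : (dyadic_energy b (modulated f0 i) <= (C * (2 * S + w))%:E)%E.
    apply: le_trans (hW i) _; rewrite EFinM EFinD.
    by rewrite lee_wpmul2l ?lee_fin ?(ltW C0)// leeD2r.
  have dT0 : (dyadic_energy b (translated F0 i) <= (2 * (C * (2 * S + w)))%:E)%E.
    apply: le_trans (dyadic_translated_le_modulated f0 F0 i p0) _.
    by rewrite [leRHS]EFinM lee_wpmul2l ?lee_fin.
  have dT : (dyadic_energy b (translated F i) <=
      (2 * (2 * (C * (2 * S + w))) + 2 * (c * T) * S)%:E)%E.
    apply: le_trans (hT i) _; rewrite -EFinM [leRHS]EFinD leeD2r//.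
    by rewrite [leRHS]EFinM lee_wpmul2l ?lee_fin.
  have dM : (dyadic_energy b (modulated f i) <=
      (2 * (2 * (2 * (C * (2 * S + w))) + 2 * (c * T) * S))%:E)%E.
    apply: le_trans (dyadic_modulated_le_translated f F i p1) _.
    by rewrite [leRHS]EFinM lee_wpmul2l ?lee_fin.
  apply: (@le_trans _ _ ((2 * S)%:E +
    Q%:E * (2 * (2 * (2 * (C * (2 * S + w))) + 2 * (c * T) * S))%:E)%E).
    by apply: leeD => //; rewrite lee_wpmul2l ?lee_fin.
  rewrite -EFinM -EFinD lee_fin.
  have TS : S <= T * S by rewrite ler_peMl.
  have QCS : Q * C * S <= Q * C * (T * S) by rewrite ler_wpM2l.
  have QCw : 0 <= Q * C * w by rewrite mulr_ge0.
  have Qcw : 0 <= Q * c * w by rewrite mulr_ge0.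
  by rewrite /D1; nra.
apply: le_trans (weighted_le b b0 b1 f n0 mf) _.
have -> : ((n%:R * (n%:R * D1))%:E * (T%:E * S%:E + w%:E) =
    n%:R%:E * (n%:R * (D1 * (T * S + w)))%:E)%E.
  by rewrite -(EFinM T S) -(EFinD (T * S) w) -2!EFinM !mulrA.
rewrite lee_wpmul2l ?lee_fin//.
apply: le_trans (lee_sum _ (fun i _ => cw i)) _.
by rewrite sumEFin lee_fin sumr_const card_ord mulr_natl.
Qed.
End propagation.

(** * From energies to norms, and the theorem *)

Local Open Scope complex_scope.

Lemma L2norm_weight {R : realType} {n : nat} (b : R) (f : 'rV[R]_n -> R[i]) :
  L2norm (fun x => (enorm x `^ b)%:C * f x) = (weighted b f `^ 2^-1)%E.
Proof.
rewrite L2normE; congr (_ `^ _)%E; apply: eq_integral => x _.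
by rewrite csqM csqR [2 * b]mulrC powRrM powR_mulrn ?powR_ge0.
Qed.

Lemma sobolev_normE {R : realType} {n : nat} (s : R) (f : 'rV[R]_n -> R[i]) :
  sobolev_norm s f = (sobolev_energy s (fourier f) `^ 2^-1)%E.
Proof.
by congr (_ `^ _)%E; apply: eq_integral => x _; rewrite normc_sqr.
Qed.

(** The existence of a transform rules out the default value of [xget]. *)
Lemma fourierP {R : realType} {n : nat} (f : 'rV[R]_n -> R[i]) :
  (exists F, is_fourier f F) -> is_fourier f (fourier f).
Proof. by move=> [F fF]; rewrite /fourier; case: xgetP => [G _ //|/(_ F)]. Qed.

(** [T ^+ 2 * S + w] is at most the square of [T * sqrt S + sqrt w]: taking roots turns the
    quadratic growth of the energy in time into linear growth of the norm. *)
Lemma half_power_bound {R : realType} (D T S w : R) (z : \bar R) :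
  0 < D -> 0 <= T -> 0 <= S -> 0 <= w -> (0 <= z)%E ->
  (z <= D%:E * ((T ^+ 2)%:E * S%:E + w%:E))%E ->
  (z `^ 2^-1 <= (Num.sqrt D)%:E * (T%:E * S%:E `^ 2^-1 + w%:E `^ 2^-1))%E.
Proof.
move=> D0 T0 S0 w0; case: z => [z| |]//.
rewrite !poweR_EFin.
rewrite (_ : (_ * (_ + w%:E))%E = (D * (T ^+ 2 * S + w))%:E)//.
rewrite (_ : (_ * (_ + _))%E =
  (Num.sqrt D * (T * S `^ 2^-1 + w `^ 2^-1))%:E)//.
rewrite !lee_fin => z0 h; rewrite !powR12_sqrt//.
rewrite -ler_sqr ?nnegrE ?sqrtr_ge0 ?mulr_ge0 ?addr_ge0 ?mulr_ge0 ?sqrtr_ge0//.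
rewrite exprMn !sqr_sqrtr ?(ltW D0)//; apply: le_trans h _; rewrite ler_pM2l//.
have a0 := sqrtr_ge0 S; have c0 := sqrtr_ge0 w.
rewrite -{1}(sqr_sqrtr S0) -{1}(sqr_sqrtr w0) sqrrD -exprMn lerD2r lerDl.
by rewrite mulrn_wge0// mulr_ge0// mulr_ge0.
Qed.

Theorem theorem1p1 (R : realType) (p n : nat) (p_gt0 : (0 < p)%N) (n_gt0 : (0 < n)%N)
    (phi g : 'I_p -> 'rV[R]_n -> R) (k : 'I_p -> nat) (Cg : 'I_p -> R)
    (phi_cont : forall i, continuous (phi i))
    (phiA : forall i, conditionA (phi i) (g i))
    (phiB : forall i, conditionB (phi i))
    (k_gt0 : forall i, (0 < k i)%N)
    (Cg_gt0 : forall i, 0 < Cg i)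
    (g_le : forall i x, g i x <= Cg i * (1 + enorm x ^+ k i))
    (Phi : 'rV[R]_n -> R) (PhiE : forall xi, Phi xi = \sum_(i < p) phi i xi)
    (K : nat) (KE : K = (\max_(i < p) k i)%N)
    (s b : R) (s_gt0 : 0 < s) (s_ltK : s < K%:R)
    (b_gt0 : 0 < b) (b_le : b <= s / K%:R) :
  exists2 C : R, 0 < C &
    forall (T : R) (u0 : 'rV[R]_n -> R[i]) (u : R -> 'rV[R]_n -> R[i]),
      0 < T ->
      in_Z s b u0 ->
      continuous_Hs T s u ->
      is_solution Phi T u0 u ->
      forall t : R, t \in `[- T, T] ->
        (L2norm (fun x => ((enorm x `^ b)%:C * u t x)%R)
         <= C%:E * ((1 + `|t|)%R%:E * sobolev_norm s u0
                    + L2norm (fun x => ((enorm x `^ b)%:C * u0 x)%R)))%E.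
Proof.
have K0 : 0 < K%:R :> R := lt_trans s_gt0 s_ltK.
have bK : b * K%:R <= s by rewrite -ler_pdivlMr.
(* The hypothesis [s < K] enters here: it forces [b < 1], hence [ratio b < 4]. *)
have b1 : b < 1 by apply: le_lt_trans b_le _; rewrite ltr_pdivrMr// mul1r.
have [L [L0 hL]] : exists L : R, 0 <= L /\ forall xi h : 'rV[R]_n, enorm h <= 1 ->
    `|Phi (xi + h) - Phi xi| <= L * (1 + enorm xi) ^+ K * enorm h.
  apply: (sum_symbol_lipschitz p K phi) => // i.
  apply: (symbol_lipschitz (phi i) (g i) (k i) K (Cg i)) => //; first exact: ltW.
  by rewrite KE; exact: (leq_bigmax i).
have [c c0 hc] := multiplier_dyadic_le b s K b_gt0 b1 s_gt0 bK Phi L L0 hL.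
have [D D0 hD] := weighted_propagation b s b_gt0 b1 s_gt0
  (fun t xi => expi (- (t * Phi xi))) c n_gt0 c0 (fun t xi => csq_expi _) hc.
(* [D] comes from [b], [s], [n] and the symbol, before [T], [u0] and [u] are introduced. *)
exists (Num.sqrt D); first by rewrite sqrtr_gt0.
move=> T u0 u T0 [[_ u0F u0s] u0w] _ usol t tT.
have p0 := is_fourier_pair _ _ (fourierP _ u0F).
have p1 := is_fourier_pair _ _ (usol t tT).
rewrite !L2norm_weight sobolev_normE.
have W0 : (0 <= weighted b u0)%E.
  by rewrite integral_ge0// => x _; rewrite lee_fin mulr_ge0 ?powR_ge0 ?csq_ge0.
have S0 : (0 <= sobolev_energy s (fourier u0))%E.
  by rewrite integral_ge0// => x _; rewrite lee_fin mulr_ge0 ?powR_ge0 ?csq_ge0.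
have z0 : (0 <= weighted b (u t))%E.
  by rewrite integral_ge0// => x _; rewrite lee_fin mulr_ge0 ?powR_ge0 ?csq_ge0.
have Woo : (weighted b u0 < +oo)%E.
  by apply: le_lt_trans u0w; rewrite le_eqVlt; apply/orP; left; apply/eqP;
     apply: eq_integral => x _; rewrite normc_sqr.
(* An infinite energy would have an infinite root, against the finiteness of the norm. *)
have Soo : (sobolev_energy s (fourier u0) < +oo)%E.
  rewrite sobolev_normE in u0s; move: (sobolev_energy _ _) u0s S0 => [r| |]//.
    by move=> *; exact: ltry.
  by rewrite poweRyr ?ltxx.
have := hD t _ _ _ p0 p1 Soo Woo.
move: (weighted b u0) (sobolev_energy s (fourier u0)) W0 S0 Woo Soo => [w| |]// [S| |]//.
rewrite !lee_fin => w0 S0 _ _ h.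
by apply: half_power_bound => //; rewrite addr_ge0.
Qed.
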